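(* For every finite $n$-dimensional simplicial complex $K$, $n>0$, and every $\epsilon\in C^0(K;\mathbb{Z}/2\mathbb{Z})$, the relative simplicial chain complex $C_*(K,K_0^\epsilon;\mathbb{Z}/2\mathbb{Z})$ and the shifted cellular chain complex $C_*(V'_\epsilon;\mathbb{Z}/2\mathbb{Z})^{[1]}$ are canonically isomorphic.
   Context: $\epsilon\in C^0(K;\mathbb{Z}/2\mathbb{Z})$ is a function from the vertices of $K$ to $\mathbb{Z}/2\mathbb{Z}$. $K_0^\epsilon$ is the subcomplex of $K$ consisting of the simplices on whose vertices $\epsilon$ is constant. $V'_\epsilon\subset|K|$ is the subset such that, for every simplex $\sigma\in K$, $V'_\epsilon\cap\sigma$ is the convex hull of the midpoints of the edges of $\sigma$ on which $\epsilon$ is not constant. The set $V'_\epsilon\cap\sigma$ is empty if $\epsilon$ is constant on $\sigma$; otherwise it is a closed convex cell of dimension $\dim\sigma-1$, isomorphic to the product of the simplex spanned by the vertices of $\sigma$ where $\epsilon=0$ and the simplex spanned by those where $\epsilon=1$. This gives $V'_\epsilon$ the structure of a CW-complex having exactly one $p$-cell, $V'_\epsilon\cap\sigma$, for every $(p+1)$-simplex $\sigma$ of $K$ on which $\epsilon$ is not constant, $p\in\{0,\ldots,n-1\}$; $C_*(V'_\epsilon;\mathbb{Z}/2\mathbb{Z})$ is its cellular chain complex. The shift is by one degree: $C_p(V'_\epsilon;\mathbb{Z}/2\mathbb{Z})^{[1]}=C_{p-1}(V'_\epsilon;\mathbb{Z}/2\mathbb{Z})$. ''Canonically isomorphic''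 refers to the isomorphism identifying the canonical bases: the simplex $\sigma$ on which $\epsilon$ is not constant, as a generator of $C_*(K,K_0^\epsilon;\mathbb{Z}/2\mathbb{Z})$, corresponds to the cell $V'_\epsilon\cap\sigma$. *)

(* Defs.v *)
From HB Require Import structures.
From mathcomp Require Import all_boot all_order all_algebra.
From mathcomp Require Import all_classical all_reals all_analysis.
From mathcomp Require Import zify ring lra freeg.

Set Implicit Arguments.
Unset Strict Implicit.
Unset Printing Implicit Defensive.

Import Order.TTheory GRing.Theory Num.Theory.
Import numFieldNormedType.Exports.

Local Open Scope classical_set_scope.
Local Open Scope ring_scope.

(* ------------------------------------------------------------------ *)
Section QuotientMap.
Variables (V W : zmodType) (A : zmodClosed V) (B : zmodClosed W).
Variables (f : {additive V -> W}) (fAB : forall c, c \in A -> f c \in B).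

Definition quot_map of (forall c, c \in A -> f c \in B) :=
  fun x : Quotient.quot A => \pi_(Quotient.quot B)%qT (f (repr x)).

Lemma quot_mapE c :
  quot_map fAB (\pi_(Quotient.quot A)%qT c) = \pi_(Quotient.quot B)%qT (f c).
Proof.
apply/eqP; rewrite -Quotient.idealrBE -raddfB; apply: fAB.
by rewrite Quotient.idealrBE reprK.
Qed.

Lemma quot_map_is_zmod_morphism : zmod_morphism (quot_map fAB).
Proof.
by elim/quotW=> x; elim/quotW=> y; rewrite -raddfB !quot_mapE raddfB raddfB.
Qed.

HB.instance Definition _ := GRing.isZmodMorphism.Build
  (Quotient.quot A) (Quotient.quot B) (quot_map fAB) quot_map_is_zmod_morphism.
End QuotientMap.

(* Every chain group below is a vector space over 'F_2.  Additive maps between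
   such spaces are automatically 'F_2-linear, so only the additive structure
   is recorded. *)
Record chain_complex := ChainComplex {
  chain :> nat -> zmodType;
  bd : forall p, {additive chain p.+1 -> chain p};
  bdK : forall p (c : chain p.+2), bd p (bd p.+1 c) = 0 }.
Arguments bd {_} p.

Record chain_iso (C D : chain_complex) := ChainIso {
  iso_map : forall p, {additive C p -> D p};
  iso_bij : forall p, bijective (iso_map p);
  iso_bd : forall p (c : C p.+1), iso_map p (bd p c) = bd p (iso_map p.+1 c) }.
Arguments iso_map {C D} _ p.

Section Shift.
Variable C : chain_complex.

Definition shift_chain (p : nat) : zmodType :=
  if p is q.+1 then C q else 'rV['F_2]_0.

Definition shift_bd (p : nat) : {additive shift_chain p.+1 -> shift_chain p} :=
  match p return {additive shift_chain p.+1 -> shift_chain p} with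
  | 0 => (\0 : C 0 -> 'rV['F_2]_0)
  | q.+1 => bd q
  end.

Lemma shift_bdK p (c : shift_chain p.+2) : shift_bd p (shift_bd p.+1 c) = 0.
Proof. by case: p c => [|p] c //=; rewrite bdK. Qed.

(* C^{[1]}: the group in degree p is C_{p-1}, with C_{-1} = 0. *)
Definition shift_complex := ChainComplex shift_bdK.
End Shift.

(* ------------------------------------------------------------------ *)
Record subcomplex (C : chain_complex) := Subcomplex {
  sub_chain : forall p, zmodClosed (C p);
  sub_bd : forall p (c : C p.+1),
    c \in sub_chain p.+1 -> bd p c \in sub_chain p }.
Arguments sub_chain {C} _ p.

Section QuotientComplex.
Variables (C : chain_complex) (A : subcomplex C).

Definition quo_chain (p : nat) : zmodType := Quotient.quot (sub_chain A p).

Definition quo_bd (p : nat) : {additive quo_chain p.+1 -> quo_chain p} :=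
  quot_map (@sub_bd C A p).

Lemma quo_bdK p (c : quo_chain p.+2) : quo_bd p (quo_bd p.+1 c) = 0.
Proof. by elim/quotW: c => c; rewrite /quo_bd /= !quot_mapE bdK raddf0. Qed.

(* C / A *)
Definition quotient_complex := ChainComplex quo_bdK.

Definition quo_class (p : nat) (c : C p) : quotient_complex p :=
  \pi_(Quotient.quot (sub_chain A p))%qT c.
End QuotientComplex.

(* ------------------------------------------------------------------ *)
(* For subcomplexes A of X of C, H_p(X, A) is the quotient of
   {c in X_p | bd c in A_(p-1)} by {bd b + a | b in X_(p+1), a in A_p}. *)

Section RelativeHomology.
Variables (C : chain_complex) (X A : subcomplex C).

Definition is_rel_cycle (p : nat) : pred (C p) :=
  match p return pred (C p) with
  | 0 => fun c => c \in sub_chain X 0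
  | q.+1 => fun c => (c \in sub_chain X q.+1) && (bd q c \in sub_chain A q)
  end.

Lemma is_rel_cycle_zmod_closed p : zmod_closed (@is_rel_cycle p).
Proof.
case: p => [|p]; split.
- exact: (rpred0 (sub_chain X 0)).
- by move=> x y; exact: (rpredB (S := sub_chain X 0)).
- apply/andP; split; first exact: (rpred0 (sub_chain X p.+1)).
  by rewrite raddf0 rpred0.
- move=> x y /andP[xX xA] /andP[yX yA]; apply/andP; split; first exact: rpredB.
  by rewrite raddfB rpredB.
Qed.
HB.instance Definition _ p :=
  GRing.isZmodClosed.Build (C p) (@is_rel_cycle p)
    (@is_rel_cycle_zmod_closed p).

Record rel_cycle (p : nat) := RelCycle {
  rel_cycle_chain :> C p;
  _ : is_rel_cycle rel_cycle_chain }.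
HB.instance Definition _ p := [isSub for @rel_cycle_chain p].
HB.instance Definition _ p := [Choice of rel_cycle p by <:].
HB.instance Definition _ p := [SubChoice_isSubZmodule of rel_cycle p by <:].

Definition is_rel_boundary (p : nat) : pred (rel_cycle p) :=
  fun c => `[< exists b a, [/\ b \in sub_chain X p.+1, a \in sub_chain A p
                             & (c : C p) = bd p b + a] >].

Lemma is_rel_boundary_zmod_closed p : zmod_closed (@is_rel_boundary p).
Proof.
split=> [|x y].
  by apply/asboolP; exists 0, 0; rewrite !rpred0 raddf0 addr0.
move=> /asboolP[b [a [bX aA e]]] /asboolP[b' [a' [bX' aA' e']]].
apply/asboolP; exists (b - b'), (a - a'); rewrite !rpredB //.
have -> : rel_cycle_chain (x - y) = rel_cycle_chain x - rel_cycle_chain y.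
  exact: (raddfB \val).
by split=> //; rewrite e e' raddfB opprD addrACA.
Qed.
HB.instance Definition _ p := GRing.isZmodClosed.Build (rel_cycle p)
  (@is_rel_boundary p) (@is_rel_boundary_zmod_closed p).

Definition rel_boundary (p : nat) : zmodClosed (rel_cycle p) :=
  GRing.ZmodClosed.clone _ (@is_rel_boundary p) _.

Definition homology (p : nat) : zmodType := Quotient.quot (rel_boundary p).

Definition hclass (p : nat) (z : rel_cycle p) : homology p :=
  \pi_(Quotient.quot (rel_boundary p))%qT z.
End RelativeHomology.

Section Connecting.
Variables (C : chain_complex) (X A B : subcomplex C) (p : nat).

Lemma bd_is_rel_cycle (z : rel_cycle X A p.+1) :
  is_rel_cycle A B (bd p (z : C p.+1)).
Proof.
case: z => c /= /andP[_ cA]; case: p c cA => [|q] c cA //=.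
by rewrite cA bdK rpred0.
Qed.

Definition bd_rel_cycle (z : rel_cycle X A p.+1) : rel_cycle A B p :=
  RelCycle (bd_is_rel_cycle z).

Lemma bd_rel_cycle_is_zmod_morphism : zmod_morphism bd_rel_cycle.
Proof. by move=> x y; apply: val_inj; rewrite /= !raddfB. Qed.
HB.instance Definition _ := GRing.isZmodMorphism.Build
  (rel_cycle X A p.+1) (rel_cycle A B p) bd_rel_cycle
  bd_rel_cycle_is_zmod_morphism.

Lemma bd_rel_cycle_boundary (z : rel_cycle X A p.+1) :
  z \in rel_boundary X A p.+1 -> bd_rel_cycle z \in rel_boundary A B p.
Proof.
move=> /asboolP[b [a [_ aA e]]]; apply/asboolP; exists a, 0; split=> //.
  exact: rpred0.
by rewrite /= e raddfD bdK add0r addr0.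
Qed.

(* the connecting homomorphism H_{p+1}(X, A) -> H_p(A, B) of a triple *)
Definition connecting : {additive homology X A p.+1 -> homology A B p} :=
  quot_map bd_rel_cycle_boundary.
End Connecting.

(* For a filtration X 0, X 1, ... of C, the complex with groups
   H_p(X p.+1, X p) and the connecting homomorphisms of triples as
   differentials. *)
Section Filtration.
Variables (C : chain_complex) (X : nat -> subcomplex C).

Definition filt_chain (p : nat) : zmodType := homology (X p.+1) (X p) p.

Definition filt_bd (p : nat) : {additive filt_chain p.+1 -> filt_chain p} :=
  @connecting C (X p.+2) (X p.+1) (X p) p.

Lemma filt_bdK p (c : filt_chain p.+2) : filt_bd p (filt_bd p.+1 c) = 0.
Proof.
elim/quotW: c => c; rewrite /filt_bd /connecting /= !quot_mapE /=.
rewrite (_ : bd_rel_cycle _ _ = 0) ?raddf0 //.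
by apply: val_inj; rewrite /= bdK.
Qed.

Definition filtration_complex := ChainComplex filt_bdK.
End Filtration.

(* ------------------------------------------------------------------ *)
Lemma F2P (k : 'F_2) : k = 0 \/ k = 1.
Proof. by case: k => -[|[|//]] ?; [left|right]; exact: val_inj. Qed.

Section FreeModule.
Variable S : choiceType.

Section Lift.
Variables (M : lmodType 'F_2) (f : S -> M).

Definition free_lift : {additive {freeg S / 'F_2} -> M} :=
  HB.pack_for {additive {freeg S / 'F_2} -> M} (fglift f)
    (GRing.isZmodMorphism.Build _ _ (fglift f) (lift_is_additive f)).

Lemma free_liftU x : free_lift << x >> = f x.
Proof. by rewrite /free_lift /= liftU scale1r. Qed.

Lemma F2_scale_closed (A : zmodClosed M) (k : 'F_2) (x : M) :
  x \in A -> k *: x \in A.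
Proof.
by move=> xA; have [->|->] := F2P k; rewrite ?scale0r ?rpred0 ?scale1r.
Qed.

Lemma free_liftE c :
  free_lift c = \sum_(x <- dom c) coeff x c *: f x.
Proof.
rewrite -{1}[c]freeg_sumE raddf_sum; apply: eq_bigr => x _.
by rewrite /free_lift /= liftU.
Qed.
End Lift.

Variable P : pred S.

Definition supported : pred {freeg S / 'F_2} := fun c => all P (dom c).

Lemma supportedP (c : {freeg S / 'F_2}) :
  reflect (forall x, ~~ P x -> coeff x c = 0) (supported c).
Proof.
apply: (iffP allP) => [h x Px|h x]; last first.
  by rewrite mem_dom; apply: contraNT => /h ->.
by apply: coeff_outdom; apply: contra Px; exact: h.
Qed.

Lemma supported_zmod_closed : zmod_closed supported.
Proof.
split=> [|c d]; first by apply/supportedP => x _; rewrite coeff0.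
move=> /supportedP hc /supportedP hd; apply/supportedP => x Px.
by rewrite coeffB hc // hd // subrr.
Qed.
HB.instance Definition _ :=
  GRing.isZmodClosed.Build {freeg S / 'F_2} supported supported_zmod_closed.

Lemma supportedU x : P x -> << x >> \in supported.
Proof. by move=> Px; rewrite unfold_in /supported domU1 /= Px. Qed.

Lemma free_lift_supported (M : lmodType 'F_2) (A : zmodClosed M) (f : S -> M) :
  (forall x, P x -> f x \in A) ->
  forall c, c \in supported -> free_lift f c \in A.
Proof.
move=> fA c /allP cP; rewrite free_liftE big_seq rpred_sum // => x xc.
by apply: F2_scale_closed; apply: fA; exact: cP.
Qed.
End FreeModule.

Lemma free_lift_comp0 (S S' : choiceType) (M : lmodType 'F_2)
    (g : S' -> M) (f : S -> {freeg S' / 'F_2}) :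
  (forall x, free_lift g (f x) = 0) ->
  forall c, free_lift g (free_lift f c) = 0.
Proof.
move=> gf c; rewrite [free_lift f c]free_liftE raddf_sum big1 // => x _.
have [->|->] := F2P (coeff x c); first by rewrite scale0r raddf0.
by rewrite scale1r gf.
Qed.

Lemma free_addxx (S : choiceType) (c : {freeg S / 'F_2}) : c + c = 0.
Proof.
apply/eqP/freeg_eqP => x; rewrite coeffD coeff0.
by have [->|->] := F2P (coeff x c); exact: val_inj.
Qed.

(* ------------------------------------------------------------------ *)
(* A finite simplicial complex with vertex set T; the simplices are its
   nonempty ones. *)
Record scomplex (T : finType) := SComplex {
  simplices :> {set {set T}};
  sc_nonempty : finset.set0 \notin simplices;
  sc_face : forall s t : {set T},
    s \in simplices -> t \subset s -> t != finset.set0 -> t \in simplices;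
  sc_vertex : forall v : T, [set v]%SET \in simplices }.

Definition sc_dim (T : finType) (K : scomplex T) : nat :=
  \max_(s in (K : {set {set T}})) #|s|.-1.

Section SimplicialChains.
Import mathcomp.boot.finset.
Variables (T : finType) (K : scomplex T).

Record psimplex (p : nat) := PSimplex {
  psimplex_set :> {set T};
  _ : (psimplex_set \in (K : {set {set T}})) && (#|psimplex_set| == p.+1) }.
HB.instance Definition _ p := [isSub for @psimplex_set p].
HB.instance Definition _ p := [Finite of psimplex p by <:].

Definition schain (p : nat) := {freeg (psimplex p) / 'F_2}.

Definition sbd (p : nat) : {additive schain p.+1 -> schain p} :=
  free_lift (fun s : psimplex p.+1 =>
    \sum_(t : psimplex p | (t : {set T}) \subset s) << t >>).

Lemma card_between p (r : psimplex p) (s : psimplex p.+2) : r \subset s ->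
  #|[set t : psimplex p.+1 | (r \subset t) && (t \subset s)]%SET| = 2%N.
Proof.
move=> rs; rewrite -(card_imset _ val_inj).
have [/andP[sK /eqP cs] /andP[_ /eqP cr]] := (valP s, valP r).
have cD : #|(s :\: r)%SET| = 2%N.
  by rewrite cardsD (setIidPr rs) cs cr -[p.+3]/(2 + p.+1)%N addnK.
rewrite -cD -[RHS](card_in_imset (f := fun v => v |: (r : {set T}))%SET).
  apply: eq_card => t; apply/imsetP/imsetP => [[u]|[v]].
    rewrite inE => /andP[ru us] ->.
    have /andP[_ /eqP cu] := valP u.
    have /eqP/cards1P[v uv] : #|(u :\: r)%SET| = 1%N.
      by rewrite cardsD (setIidPr ru) cu cr -[p.+2]/(1 + p.+1)%N addnK.
    have : v \in (u :\: r)%SET by rewrite uv inE.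
    rewrite inE => /andP[vr vu]; exists v.
      by rewrite inE vr (fintype.subsetP us).
    by rewrite /= -[LHS](setID _ r) uv (setIidPr ru) setUC.
  rewrite inE => /andP[vr vs] tE.
  have tK : (t \in (K : {set {set T}})) && (#|t| == p.+2).
    apply/andP; split; last by rewrite tE cardsU1 vr cr.
    apply: (sc_face sK); first by rewrite tE subUset sub1set vs.
    by apply/set0Pn; exists v; rewrite tE !inE eqxx.
  exists (PSimplex tK) => //; rewrite inE /= tE subsetUr subUset sub1set vs.
  exact: rs.
move=> u v; rewrite !inE => /andP[ur us] /andP[vr vs] uv.
have : u \in (v |: (r : {set T}))%SET by rewrite -uv !inE eqxx.
by rewrite !inE (negbTE ur) orbF => /eqP.
Qed.

Lemma sbdK p (c : schain p.+2) : sbd p (sbd p.+1 c) = 0.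
Proof.
apply: free_lift_comp0 => s; rewrite raddf_sum.
under eq_bigr do rewrite free_liftU.
rewrite (exchange_big_dep xpredT) //= big1 // => r _; rewrite sumr_const.
have [rs|rNs] := boolP ((r : {set T}) \subset s).
  rewrite (_ : #|_| = 2%N) ?mulr2n ?free_addxx // -(card_between rs).
  by apply: eq_card => t; rewrite !inE andbC.
rewrite (_ : #|_| = 0%N) ?mulr0n //; apply: eq_card0 => t; rewrite !inE.
by apply: contraNF rNs => /andP[ts rt]; exact: fintype.subset_trans rt ts.
Qed.

Definition simplicial_chains := ChainComplex sbdK.
End SimplicialChains.

Section RelativeSimplicial.
Import mathcomp.boot.finset.
Variables (T : finType) (K L : scomplex T).

Definition in_sub (p : nat) : pred (psimplex K p) :=
  fun s => (s : {set T}) \in (L : {set {set T}}).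

Definition sub_schain (p : nat) : zmodClosed (simplicial_chains K p) :=
  GRing.ZmodClosed.clone _ (supported (@in_sub p)) _.

Lemma sub_sbd p (c : simplicial_chains K p.+1) :
  c \in sub_schain p.+1 -> bd p c \in sub_schain p.
Proof.
apply: free_lift_supported => s sL; apply: rpred_sum => t ts.
apply: supportedU; apply: (sc_face sL ts).
by have /andP[_ /eqP ct] := valP t; rewrite -card_gt0 ct.
Qed.

Definition sub_simplicial := Subcomplex sub_sbd.

(* C_*(K, L) *)
Definition relative_chains : chain_complex := quotient_complex sub_simplicial.

Definition simplex_class (p : nat) (s : psimplex K p) : relative_chains p :=
  quo_class sub_simplicial (<< s >> : schain K p).
End RelativeSimplicial.

(* ------------------------------------------------------------------ *)
Section SingularChains.
Local Notation lift := fintype.lift.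
Variables (R : realType) (E : topologicalType).

Definition stdsimplex (p : nat) : set 'rV[R]_p.+1 :=
  [set x | (forall i, 0 <= x ord0 i) /\ \sum_i x ord0 i = 1].
Arguments stdsimplex : clear implicits.

Definition coface_row (p : nat) (i : 'I_p.+2) (x : 'rV[R]_p.+1) : 'rV[R]_p.+2 :=
  \row_j oapp (x ord0) 0 (unlift i j).

Lemma coface_rowP p i (x : stdsimplex p) :
  stdsimplex p.+1 (coface_row i (set_val x)).
Proof.
have [x0 x1] := set_valP x; split=> [j|].
  by rewrite mxE; case: unliftP => [k _|_] /=.
rewrite (bigD1_ord i) //= mxE unlift_none add0r -[RHS]x1.
by apply: eq_bigr => j _; rewrite mxE liftK.
Qed.

Definition coface p i (x : stdsimplex p) : stdsimplex p.+1 :=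
  SigSub (mem_set (coface_rowP i x)).

Lemma continuous_coface p i : continuous (@coface p i).
Proof.
apply: continuous_comp_initial => x A [B nB BA]; rewrite /nbhs /=.
have xcont (k : 'I_p.+1) :
    continuous (fun y : stdsimplex p => set_val y ord0 k).
  move=> y; apply: (@continuous_comp _ _ _ set_val
    (fun M : 'rV[R]_p.+1 => M ord0 k)).
    exact: initial_continuous.
  exact: coord_continuous.
have cB a j :
    nbhs x [set y : stdsimplex p | B a j (coface_row i (set_val y) a j)].
  rewrite (ord1 a); have := nB ord0 j; rewrite /= mxE.
  case ij : (unlift i j) => [k|] /= nb.
    have : nbhs x [set y : stdsimplex p | B ord0 j (set_val y ord0 k)].
      exact: xcont nb.
    by apply: filterS => y /=; rewrite mxE ij.
  apply: filterS (@filterT _ (nbhs x) _) => y _ /=; rewrite mxE ij.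
  exact: nbhs_singleton nb.
have : nbhs x [set y : stdsimplex p | forall aj : 'I_1 * 'I_p.+2,
    B aj.1 aj.2 (coface_row i (set_val y) aj.1 aj.2)].
  apply: (@filter_forall _ _ (fun aj : 'I_1 * 'I_p.+2 =>
    [set y : stdsimplex p | B aj.1 aj.2 (coface_row i (set_val y) aj.1 aj.2)])
    (nbhs x)) => -[a j]; exact: cB.
by apply: filterS => y yB; apply: BA => a j; exact: (yB (a, j)).
Qed.
HB.instance Definition _ p i := @isContinuous.Build
  (stdsimplex p) (stdsimplex p.+1) (@coface p i) (@continuous_coface p i).

Lemma lift_swap p (a b : 'I_p.+3) (j j' : 'I_p.+2) (k : 'I_p.+1) :
  lift a j = b -> lift b j' = a -> lift a (lift j k) = lift b (lift j' k).
Proof.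
move=> /(congr1 val) /= ab /(congr1 val) /= ba; apply: val_inj => /=.
move: ab ba; rewrite /bump.
by do ![case: leqP => ?]; lia.
Qed.

Lemma coface_swap p (a b : 'I_p.+3) (j j' : 'I_p.+2) :
  lift a j = b -> lift b j' = a ->
  coface a \o coface j =1 coface b \o @coface p j'.
Proof.
move=> ab ba x; apply: val_inj; pose y := set_val x.
rewrite -[LHS]/(coface_row a (coface_row j y)).
rewrite -[RHS]/(coface_row b (coface_row j' y)).
have rowE (a0 : 'I_p.+3) j0 k :
    coface_row a0 (coface_row j0 y) ord0 (lift a0 (lift j0 k)) = y ord0 k.
  by rewrite mxE liftK /= mxE liftK.
have row0 (a0 : 'I_p.+3) j0 c :
    (exists k, c = lift a0 (lift j0 k)) \/
    coface_row a0 (coface_row j0 y) ord0 c = 0.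
  rewrite mxE; case: unliftP => [c1 ->|_] /=; last by right.
  rewrite mxE; case: unliftP => [k ->|_] /=; last by right.
  by left; exists k.
apply/rowP => c.
have [[k ->]|La] := row0 a j c; first by rewrite {2}(lift_swap k ab ba) !rowE.
have [[k ->]|->] := row0 b j' c; last by rewrite La.
by rewrite -{1}(lift_swap k ab ba) !rowE.
Qed.

Definition sing (p : nat) := continuousType (stdsimplex p) E.

Definition sface (p : nat) (i : 'I_p.+2) (s : sing p.+1) : sing p :=
  s \o coface i.

Lemma sface_swap p (a b : 'I_p.+3) (j j' : 'I_p.+2) (s : sing p.+2) :
  lift a j = b -> lift b j' = a ->
  sface j (sface a s) = sface j' (sface b s).
Proof.
by move=> ab ba; apply/continuousEP => x /=; congr (s _); exact: coface_swap.
Qed.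

Definition sing_chain (p : nat) := {freeg (sing p) / 'F_2}.

Definition sing_bd (p : nat) : {additive sing_chain p.+1 -> sing_chain p} :=
  free_lift (fun s : sing p.+1 => \sum_(i < p.+2) << sface i s >>).

Lemma sum_symmetric n p (g : 'I_n -> 'I_n -> sing_chain p) :
  (forall a, g a a = 0) -> (forall a b, g a b = g b a) ->
  \sum_a \sum_b g a b = 0.
Proof.
move=> g0 gC; pose T := ('I_n * 'I_n)%type; rewrite pair_big /=.
rewrite (bigID (fun ab : T => ab.1 < ab.2)%N) /=.
rewrite [X in _ + X](bigID (fun ab : T => ab.1 == ab.2)) /=.
rewrite [X in _ + (X + _)]big1 ?add0r; last first.
  by move=> [a b] /= /andP[_ /eqP ->].
rewrite [X in _ + X](reindex_inj (h := fun ab : T => (ab.2, ab.1))) /=;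
  last first.
  by move=> [a b] [c d] /= [-> ->].
rewrite [X in _ + X](eq_big (fun ab : T => ab.1 < ab.2)%N
  (fun ab => g ab.1 ab.2)).
- exact: free_addxx.
- move=> [a b] /=; rewrite -leqNgt ltn_neqAle andbC.
  by congr (~~ _ && _); rewrite eq_sym.
- by move=> [a b] _; exact: gC.
Qed.

Lemma sing_bdK p (c : sing_chain p.+2) : sing_bd p (sing_bd p.+1 c) = 0.
Proof.
apply: free_lift_comp0 => s; rewrite raddf_sum.
under eq_bigr do rewrite free_liftU.
pose g (a b : 'I_p.+3) : sing_chain p :=
  oapp (fun j => << sface j (sface a s) >>) 0 (unlift a b).
transitivity (\sum_a \sum_b g a b).
  apply: eq_bigr => a _; rewrite [RHS](bigD1_ord a) //= {1}/g unlift_none add0r.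
  by apply: eq_bigr => j _; rewrite /g liftK.
apply: sum_symmetric => [a|a b]; first by rewrite /g unlift_none.
rewrite /g; case: (unliftP a b) => [j ba|->]; last by rewrite unlift_none.
case: (unliftP b a) => [j' ab|ab] /=; last first.
  by have := neq_lift a j; rewrite -ba ab eqxx.
by rewrite (sface_swap s (esym ba) (esym ab)).
Qed.

Definition singular_chains := ChainComplex sing_bdK.

Definition sing_in (X : set E) (p : nat) : pred (sing p) :=
  fun s => `[< range s `<=` X >].

Definition sing_in_chain (X : set E) (p : nat) :
    zmodClosed (singular_chains p) :=
  GRing.ZmodClosed.clone _ (supported (@sing_in X p)) _.

Lemma sing_in_bd (X : set E) p (c : singular_chains p.+1) :
  c \in sing_in_chain X p.+1 -> bd p c \in sing_in_chain X p.
Proof.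
apply: free_lift_supported => s /asboolP sX; apply: rpred_sum => i _.
apply: supportedU; apply/asboolP => _ [x _ <-].
by apply: sX; exists (coface i x).
Qed.

(* the singular chains of the subspace X of E *)
Definition singular_in (X : set E) : subcomplex singular_chains :=
  Subcomplex (@sing_in_bd X).
End SingularChains.

Section CellularChains.
Variables (R : realType) (E : topologicalType) (X : nat -> set E).

(* The cellular chain complex of a CW-complex with p-skeleton X p: the groups
   are the singular homology groups H_p(X^p, X^(p-1)), with X^(-1) empty. *)
Definition cellular_chains : chain_complex :=
  filtration_complex (fun p => singular_in R (if p is q.+1 then X q else set0)).

(* c is the element of H_p(X^p, X^(p-1)) given by the closed p-cell e, that is,
   the image of the only nonzero element of H_p(e, e `&` X^(p-1)). *)
Definition is_cell_class (p : nat) (e : set E) (c : cellular_chains p) : Prop :=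
  let Y := if p is q.+1 then X q else set0 in
  exists (z : rel_cycle (singular_in R e) (singular_in R (e `&` Y)) p)
         (z' : rel_cycle (singular_in R (X p)) (singular_in R Y) p),
    [/\ z = z' :> singular_chains R E p,
        forall h : homology _ _ p, h <> 0 <-> h = hclass z
      & c = hclass z'].
End CellularChains.

(* ------------------------------------------------------------------ *)
Definition convex_hull (R : numDomainType) (M : lmodType R) (A : set M) :
    set M :=
  smallest (fun B : set M => @convex_set R M B) A.

Section ConvexCombination.
Variables (R : realType) (M : lmodType R) (B : set M).
Hypothesis Bconv : @convex_set R M B.

Lemma convex_pair (a b : R) (x y : M) : 0 <= a -> 0 <= b -> a + b = 1 ->
  B x -> B y -> B (a *: x + b *: y).
Proof.
move=> a0 b0 ab Bx By; have a1 : a <= 1 by rewrite -ab lerDl.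
have := @Bconv x y (Itv01 a0 a1) (mem_set Bx) (mem_set By).
have -> : b = 1 - a by rewrite -ab addrC addKr.
by rewrite inE.
Qed.

Lemma convex_sum (I : finType) (w : I -> R) (x : I -> M) :
  (forall i, 0 <= w i) -> \sum_i w i = 1 -> (forall i, 0 < w i -> B (x i)) ->
  B (\sum_i w i *: x i).
Proof.
move=> w0 w1 Bx.
suff [[W0 _]|[y By ->]] : (\sum_i w i = 0 /\ \sum_i w i *: x i = 0) \/
    exists2 y, B y & \sum_i w i *: x i = (\sum_i w i) *: y.
- by move: w1; rewrite W0 => /esym/eqP; rewrite oner_eq0.
- by rewrite w1 scale1r.
elim: (index_enum I) => [|i r IH]; first by left; rewrite !big_nil.
rewrite !big_cons.
have [wi0|wi0] := eqVneq (w i) 0; first by rewrite wi0 scale0r !add0r.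
have {}wi0 : 0 < w i by rewrite lt_neqAle eq_sym wi0 w0.
right; case: IH => [[-> ->]|[y By ->]].
  by exists (x i); [exact: Bx|rewrite !addr0].
have W0 : 0 <= \sum_(j <- r) w j by rewrite sumr_ge0.
set W := \sum_(j <- r) w j in W0 *.
have wW : 0 < w i + W by rewrite ltr_wpDr.
exists ((w i / (w i + W)) *: x i + (W / (w i + W)) *: y).
  apply: convex_pair => //; last exact: Bx.
  - by rewrite divr_ge0 // ltW.
  - by rewrite divr_ge0 // ltW.
  - by rewrite -mulrDl divff // gt_eqF.
by rewrite scalerDr !scalerA !(mulrC (w i + W)) !divfK // gt_eqF.
Qed.
End ConvexCombination.

(* ------------------------------------------------------------------ *)
Section DualHypersurface.
Variables (R : realType) (T : finType) (eps : T -> 'F_2).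

Definition constant_on (s : {set T}) : bool :=
  [forall u in s, forall v in s, eps u == eps v].

(* |K| is realized in R^T, the vertices of K being the standard basis. *)
Definition vertex_point (v : T) : {ptws T -> R} := fun w => (w == v)%:R.

Definition midpoint (u v : T) : {ptws T -> R} :=
  2^-1 *: (vertex_point u + vertex_point v).

Definition closed_simplex (s : {set T}) : set {ptws T -> R} :=
  [set x | [/\ forall v, 0 <= x v, \sum_v x v = 1
             & forall v, v \notin s -> x v = 0]].

Definition midpoint_hull (s : {set T}) : set {ptws T -> R} :=
  convex_hull [set x | exists u v,
    [/\ u \in s, v \in s, eps u != eps v & x = midpoint u v]].

Lemma midpointE u v w :
  midpoint u v w = 2^-1 * ((w == u)%:R + (w == v)%:R).
Proof. by []. Qed.

Lemma midpoint_simplex (s : {set T}) u v : u \in s -> v \in s ->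
  closed_simplex s (midpoint u v).
Proof.
move=> us vs; split=> [w||w ws].
- by rewrite mulr_ge0 ?invr_ge0 ?addr_ge0 ?ler0n.
- rewrite -mulr_sumr big_split /=.
  have sum1 a : \sum_(w : T) (w == a)%:R = 1 :> R.
    by rewrite (bigD1 a) //= eqxx big1 ?addr0 // => w /negbTE ->.
  by rewrite !sum1 mulVf // pnatr_eq0.
- have [wu wv] : w != u /\ w != v.
    by split; apply: contraNneq ws => ->.
  by rewrite midpointE (negbTE wu) (negbTE wv) addr0 mulr0.
Qed.

Lemma midpoint_hullE (s : {set T}) :
  midpoint_hull s =
  [set x | closed_simplex s x /\ \sum_(v | eps v == 0) x v = 2^-1].
Proof.
apply/seteqP; split.
  apply: smallest_sub.
    move=> x y l; rewrite !inE => -[[x0 x1 xs] xh] [[y0 y1 ys] yh].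
    have l0 : 0 <= l%:num by []. have l1 : 0 <= 1 - l%:num by rewrite subr_ge0.
    have cE v : conv l x y v = l%:num * x v + (1 - l%:num) * y v by [].
    have cS (P : pred T) : \sum_(v | P v) conv l x y v =
        l%:num * \sum_(v | P v) x v + (1 - l%:num) * \sum_(v | P v) y v.
      by rewrite !mulr_sumr -big_split.
    split; first split.
    - by move=> v; rewrite cE addr_ge0 // mulr_ge0.
    - by rewrite cS x1 y1; ring.
    - by move=> v vs; rewrite cE xs // ys // !mulr0 addr0.
    - by rewrite cS xh yh; ring.
  move=> _ [u [v [us vs uv ->]]]; split; first exact: midpoint_simplex.
  rewrite -mulr_sumr big_split /=.
  have sum1 a : \sum_(w | eps w == 0) (w == a)%:R = (eps a == 0)%:R :> R.
    have [ea|ea] := boolP (eps a == 0); last first.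
      by rewrite big1 // => w ew; case: eqP => // wa; rewrite -wa ew in ea.
    by rewrite (bigD1 a) //= eqxx big1 ?addr0 // => w /andP[_ /negbTE ->].
  rewrite !sum1; move: uv.
  have [->|->] := F2P (eps u); have [->|->] := F2P (eps v) => //= _.
  - by rewrite addr0 mulr1.
  - by rewrite add0r mulr1.
move=> x [[x0 x1 xs] xh].
have xh' : \sum_(v | eps v != 0) x v = 2^-1.
  by move: x1; rewrite (bigID (fun v => eps v == 0)) /= xh; lra.
move=> B [Bconv AB].
pose w (uv : T * T) : R :=
  if (eps uv.1 == 0) && (eps uv.2 != 0) then 4 * (x uv.1 * x uv.2) else 0.
have wsum (g : T -> T -> R) : \sum_uv w uv * g uv.1 uv.2 =
    \sum_(u | eps u == 0) \sum_(v | eps v != 0) 4 * (x u * x v) * g u v.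
  rewrite pair_big_dep /= [RHS]big_mkcond /=; apply: eq_bigr => -[u v] _ /=.
  by rewrite /w /=; case: ifP; rewrite ?mul0r.
have w1 : \sum_uv w uv = 1.
  have := wsum (fun _ _ => 1); under eq_bigr do rewrite mulr1.
  move=> ->; under eq_bigr do under eq_bigr do rewrite mulr1.
  under eq_bigr do rewrite -mulr_sumr -mulr_sumr xh'.
  by rewrite -mulr_sumr -mulr_suml xh; field.
have -> : x = \sum_uv w uv *: midpoint uv.1 uv.2.
  apply/funext => a; rewrite fct_sumE.
  transitivity (\sum_uv w uv * (2^-1 * ((a == uv.1)%:R + (a == uv.2)%:R)));
    last by [].
  rewrite (wsum (fun u v => 2^-1 * ((a == u)%:R + (a == v)%:R))).
  pose Y (P : pred T) := \sum_(u | P u) x u * (a == u)%:R.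
  transitivity (Y (fun u => eps u == 0) + Y (fun u => eps u != 0)).
    transitivity (\sum_u x u * (a == u)%:R).
      rewrite (bigD1 a) //= eqxx mulr1 big1 ?addr0 // => u.
      by rewrite eq_sym => /negbTE ->; rewrite mulr0.
    by rewrite (bigID (fun u => eps u == 0)).
  transitivity (\sum_(u | eps u == 0)
      (x u * (a == u)%:R + 2 * Y (fun v => eps v != 0) * x u)).
    by rewrite big_split /= -[X in _ = _ + X]mulr_sumr xh /Y; field.
  apply: eq_bigr => u _; transitivity (2 * x u * (a == u)%:R *
      (\sum_(v | eps v != 0) x v) + 2 * x u * Y (fun v => eps v != 0)).
    by rewrite xh'; field.
  rewrite /Y !mulr_sumr -big_split; apply: eq_bigr => v _ /=.
  by field.
apply: (convex_sum Bconv) => // [uv|[u v]].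
  by rewrite /w; case: ifP => // _; rewrite !mulr_ge0.
rewrite /w /=; case: ifP => [/andP[/eqP eu ev]|_]; last by rewrite ltxx.
move=> xx; have {}xx : x u * x v != 0.
  by move: xx; apply: contraTneq => ->; rewrite mulr0 ltxx.
have ins a : x a != 0 -> a \in s by apply: contraNT => /xs ->.
move: xx; rewrite mulf_eq0 negb_or => /andP[/ins us /ins vs].
by apply: AB; exists u, v; split=> //; rewrite eu eq_sym.
Qed.

Variable K : scomplex T.

Definition const_simplices : {set {set T}} := [set s in K | constant_on s]%SET.

Lemma const_nonempty : finset.set0 \notin const_simplices.
Proof. by rewrite inE negb_and sc_nonempty. Qed.

Lemma const_face (s t : {set T}) :
  s \in const_simplices -> t \subset s -> t != finset.set0 ->
  t \in const_simplices.
Proof.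
rewrite !inE => /andP[sK /forall_inP sc] ts t0.
rewrite (sc_face sK ts t0); apply/forall_inP => u ut.
apply/forall_inP => v vt; have /forall_inP := sc u (fintype.subsetP ts _ ut).
by apply; exact: (fintype.subsetP ts).
Qed.

Lemma const_vertex v : [set v]%SET \in const_simplices.
Proof.
rewrite inE sc_vertex; apply/forall_inP => a /set1P ->.
by apply/forall_inP => b /set1P ->.
Qed.

(* K_0^eps *)
Definition const_subcomplex : scomplex T :=
  SComplex const_nonempty const_face const_vertex.

(* V'_eps *)
Definition dual_set : set {ptws T -> R} :=
  \bigcup_(s in [set s | s \in (K : {set {set T}})]) midpoint_hull s.

Definition dual_cell (s : {set T}) : set {ptws T -> R} :=
  dual_set `&` closed_simplex s.

Lemma dual_cellE (s : {set T}) : s \in (K : {set {set T}}) ->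
  dual_cell s = midpoint_hull s.
Proof.
move=> sK; apply/seteqP; split=> [x [[t _]]|x xs].
  by rewrite !midpoint_hullE => -[[_ _ _] xh] sx.
by split; [exists s|move: xs; rewrite midpoint_hullE => -[]].
Qed.

(* the p-skeleton of V'_eps; its p-cells come from the (p+1)-simplices *)
Definition dual_skeleton (p : nat) : set {ptws T -> R} :=
  \bigcup_(s in [set s | [/\ s \in (K : {set {set T}}), ~~ constant_on s
                            & (#|s| <= p.+2)%N]]) dual_cell s.

(* C_*(V'_eps) *)
Definition dual_chains : chain_complex :=
  @cellular_chains R {ptws T -> R} dual_skeleton.

Definition is_dual_cell_class (p : nat) (s : {set T}) (c : dual_chains p) :
    Prop :=
  is_cell_class (dual_cell s) c.
End DualHypersurface.
Arguments dual_chains R {T} eps K.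
Arguments is_dual_cell_class R {T} eps K p s c.

(* Main.v *)
Require Import Defs.
From HB Require Import structures.
From mathcomp Require Import all_boot all_order all_algebra.
From mathcomp Require Import all_classical all_reals all_analysis.
From mathcomp Require Import lra freeg.

(** The cells of V'_eps are products of two simplices, and the claim is that
    the relative homology of consecutive skeleta has the classes of these cells
    as a basis, with the simplicial boundary of the nonconstant simplices as
    differential.  An explicit comparison of chain complexes shows this.

    Write S for the simplicial chains (modulo two) of the full simplex on T.
    There are maps in both directions between singular chains of the ambient
    space and S.

    From S to singular chains: [fill] chooses a point in every cell and cones,
    inductively, the filling of the boundary of a simplex from the point chosen
    for it.  A simplex with several vertices on which eps is constant is killed,
    and the degree drops by one.  The chain so obtained for s lies in the convex
    cell of s.

    From singular chains to S: each point x of the hypersurface has a vertex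
    with eps = 0 and one with eps <> 0 at which its coordinates are at least
    [gap], since each of the two groups of coordinates adds up to 1/2.  The
    labels of the vertices of a singular simplex are thus pairs (a_i, b_i), and
    the Alexander-Whitney sum of the simplices [a_0 .. a_i b_i .. b_p] is a
    chain map up to constant simplices ([diag_bd]); it raises the degree by one,
    which is the shift in the theorem.

    If a singular simplex is so small that its coordinates vary by less than
    [gap], then all of its labels are vertices of the carrier of each of its
    points ([small]).  Hence the straight segments from its points to the convex
    hull of the midpoints of its labels stay in every union of closed cells that
    contains the simplex, and the simplex is homotopic there to the filling of
    the chain of its labels ([total_homotopyP]).  Iterated barycentric
    subdivision makes all chains small ([small_sd]).  So relative cycles of a
    pair of skeleta are homologous to fillings of chains of top cells
    ([filling_surj]).  Conversely, subdividing the filling of a top cell and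
    reading off its labels gives that cell back ([recoverE]), because the result
    is a multiple of the cell and has the right boundary; labels of a chain one
    degree higher, or of a chain in the smaller skeleton, vanish for reasons of
    dimension, so no nonzero combination of top cells has a filling that bounds
    ([filling_inj]).

    The constructions on singular chains are carried out on formal chains of
    lists of points, read as affine simplices.  In that complex, augmented by
    the empty list, prepending a point is a cone, and all homotopies are built
    by coning; only the straight-line homotopy and the subdivision meet
    arbitrary continuous maps. *)

Set Implicit Arguments.
Unset Strict Implicit.
Unset Printing Implicit Defensive.

Import Order.TTheory GRing.Theory Num.Theory.
Import numFieldNormedType.Exports.

Local Open Scope classical_set_scope.
Local Open Scope ring_scope.

(** * Vector spaces over the field with two elements *)

Section FreeF2.
Variable S : choiceType.
Implicit Types a b c : {freeg S / 'F_2}.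

Lemma free_addrK a b : b + a + a = b.
Proof. by rewrite -addrA free_addxx addr0. Qed.

(** As the scalars are 0 and 1, supported chains are sums of generators,
    without coefficients. *)
Lemma supported_ind (P : pred S) (Q : {freeg S / 'F_2} -> Prop) :
  Q 0 -> (forall x c, P x -> Q c -> Q (<< x >> + c)) ->
  forall c, c \in supported P -> Q c.
Proof.
move=> Q0 QD c /allP cP; rewrite -[c]freeg_sumE.
elim: (dom c) cP => [|x r IH] rP; first by rewrite big_nil.
have {}IH : Q (\sum_(y <- r) << coeff y c *g y >>).
  by apply: IH => y yr; apply: rP; rewrite inE yr orbT.
rewrite big_cons; have [->|->] := F2P (coeff x c).
  by rewrite freegU0 add0r.
by apply: QD => //; apply: rP; rewrite inE eqxx.
Qed.

Lemma free_ind (Q : {freeg S / 'F_2} -> Prop) :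
  Q 0 -> (forall x c, Q c -> Q (<< x >> + c)) -> forall c, Q c.
Proof.
move=> Q0 QD c; apply: (supported_ind (P := xpredT)) => // [x d _|].
  exact: QD.
by apply/allP.
Qed.

Lemma supported_sub (P P' : pred S) c : (forall x, P x -> P' x) ->
  c \in supported P -> c \in supported P'.
Proof. by move=> PP' /allP cP; apply/allP => x /cP /PP'. Qed.

Lemma supported_and (P P' : pred S) c :
  c \in supported P -> c \in supported P' ->
  c \in supported (fun x => P x && P' x).
Proof. by move=> /allP cP /allP cP'; apply/allP => x xc; rewrite cP ?cP'. Qed.

Lemma supported_pred1 x c : c \in supported (pred1 x) -> c = 0 \/ c = << x >>.
Proof.
move: c; apply: supported_ind => [|_ c /eqP -> [->|->]]; first by left.
  by right; rewrite addr0.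
by left; rewrite free_addxx.
Qed.

Lemma freeU_neq0 x : << x >> != 0 :> {freeg S / 'F_2}.
Proof. by rewrite freegU_eq0 oner_eq0. Qed.

Lemma supported_pred0 (P : pred S) c : (forall x, ~~ P x) ->
  c \in supported P -> c = 0.
Proof.
move=> P0 /supportedP cP; apply/eqP/freeg_eqP => x.
by rewrite coeff0 cP.
Qed.

End FreeF2.

(** Such identities hold coefficient by coefficient, where the finitely many
    combinations of parities are tried. *)
Ltac free_add := apply/eqP/freeg_eqP => ?; rewrite !(coeffD, coeff0);
  repeat (match goal with |- context [coeff ?k ?c] =>
            case: (F2P (coeff k c)) => -> end); exact: val_inj.

Section Extend.
Variables (S : choiceType) (M : lmodType 'F_2).
Implicit Type f : S -> M.

(** Locked, since simplification would otherwise expose the underlying formal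
    sums. *)
Definition extend f : {additive {freeg S / 'F_2} -> M} := locked (free_lift f).

Lemma extendU f x : extend f << x >> = f x.
Proof. by rewrite /extend -lock free_liftU. Qed.

Lemma extend_supported f (P : pred S) (A : zmodClosed M) :
  (forall x, P x -> f x \in A) ->
  forall c, c \in supported P -> extend f c \in A.
Proof. by rewrite /extend -lock; exact: free_lift_supported. Qed.

End Extend.

(** * Chains of lists *)

(** Lists of points stand for ordered affine simplices, degenerate ones
    included; the empty list generates an augmentation. *)
Notation lchains W := {freeg (seq W) / 'F_2}.

Section ListChains.
Variable W : choiceType.

Definition cone (x : W) : {additive lchains W -> lchains W} :=
  extend (fun l => << x :: l >>).

(** The recursion is the cone formula, which makes [cone x] a contraction; the
    usual sum over deleted entries is recovered in [list_bdE]. *)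
Fixpoint list_bd (l : seq W) : lchains W :=
  if l is x :: l' then << l' >> + cone x (list_bd l') else 0.

Definition lbd : {additive lchains W -> lchains W} := extend list_bd.

Lemma coneU x l : cone x << l >> = << x :: l >>.
Proof. exact: extendU. Qed.

Lemma lbdU l : lbd << l >> = list_bd l.
Proof. exact: extendU. Qed.

(** The identity holds in all degrees because of the augmentation: the complex
    is contractible by any cone. *)
Lemma lbd_cone x c : lbd (cone x c) = c + cone x (lbd c).
Proof.
elim/free_ind: c => [|l c IH]; first by rewrite !raddf0 addr0.
by rewrite !raddfD /= coneU !lbdU /= IH addrACA.
Qed.

Lemma lbdK c : lbd (lbd c) = 0.
Proof.
elim/free_ind: c => [|l c IH]; first by rewrite !raddf0.
rewrite !raddfD /= IH addr0 lbdU; elim: l => [|x l IHl] /=.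
  by rewrite raddf0.
by rewrite raddfD /= lbdU lbd_cone IHl raddf0 addr0 free_addxx.
Qed.

Definition sized (n : nat) : pred (seq W) := fun l => size l == n.

Lemma cone_sized n x c : c \in supported (sized n) ->
  cone x c \in supported (sized n.+1).
Proof. by apply: extend_supported => l ln; exact: supportedU. Qed.

Lemma list_bd_sized n l : size l = n.+1 -> list_bd l \in supported (sized n).
Proof.
elim: l n => // x l IH n [ln] /=; apply: rpredD.
  by apply: supportedU; apply/eqP.
by case: n ln => [|n] ln; [case: l ln {IH} => //= _; rewrite raddf0 rpred0|
  apply: cone_sized; exact: IH].
Qed.

Definition among (A : pred W) : pred (seq W) := all A.

Lemma cone_among (A : pred W) x c : A x -> c \in supported (among A) ->
  cone x c \in supported (among A).
Proof.
move=> Ax; apply: extend_supported => l lA; apply: supportedU.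
by rewrite /among /= Ax.
Qed.

Lemma list_bd_among (A : pred W) l : all A l ->
  list_bd l \in supported (among A).
Proof.
elim: l => [|x l IH] /=; first by rewrite rpred0.
move=> /andP[Ax Al]; apply: rpredD; first exact: supportedU.
by apply: cone_among => //; exact: IH.
Qed.

Definition delete_nth (i : nat) (l : seq W) := take i l ++ drop i.+1 l.

Lemma nth_delete x0 i l k : (i < size l)%N ->
  nth x0 (delete_nth i l) k = nth x0 l (bump i k).
Proof.
move=> il; rewrite /delete_nth nth_cat size_take il /bump.
case: ltnP => ki; first by rewrite nth_take.
by rewrite nth_drop addSn subnKC.
Qed.

Lemma size_delete i l : (i < size l)%N -> size (delete_nth i l) = (size l).-1.
Proof.
move=> il; rewrite size_cat size_take il size_drop.
by case: (size l) il => // n; rewrite ltnS subSS => /subnKC.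
Qed.

Lemma list_bdE l : list_bd l = \sum_(i < size l) << delete_nth i l >>.
Proof.
elim: l => [|x l IH] /=; first by rewrite big_ord0.
rewrite big_ord_recl /delete_nth /= drop0; congr (_ + _).
by rewrite IH raddf_sum; apply: eq_bigr => i _; rewrite coneU.
Qed.

End ListChains.

Arguments lbd {W}.
Arguments sized {W}.

Section ListMap.
Variables (W W' : choiceType) (f : W -> W').

Definition lmap : {additive lchains W -> lchains W'} :=
  extend (fun l => << map f l >>).

Lemma lmapU l : lmap << l >> = << map f l >>.
Proof. exact: extendU. Qed.

Lemma lmap_cone x c : lmap (cone x c) = cone (f x) (lmap c).
Proof.
elim/free_ind: c => [|l c IH]; first by rewrite !raddf0.
by rewrite !raddfD /= IH coneU !lmapU coneU.
Qed.

Lemma lmap_list_bd l : lmap (list_bd l) = list_bd (map f l).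
Proof.
elim: l => [|x l IH] /=; first by rewrite raddf0.
by rewrite raddfD /= lmapU lmap_cone IH.
Qed.

Lemma lmap_bd c : lmap (lbd c) = lbd (lmap c).
Proof.
elim/free_ind: c => [|l c IH]; first by rewrite !raddf0.
by rewrite !raddfD /= IH lmapU !lbdU lmap_list_bd.
Qed.

Lemma lmap_sized n c : c \in supported (sized n) ->
  lmap c \in supported (sized n).
Proof.
apply: extend_supported => l ln; apply: supportedU.
by rewrite /sized size_map.
Qed.

Lemma lmap_among (A : pred W) (A' : pred W') c :
  (forall x, A x -> A' (f x)) ->
  c \in supported (among A) -> lmap c \in supported (among A').
Proof.
move=> AA'; apply: extend_supported => l /allP lA; apply: supportedU.
by apply/allP => _ /mapP[x /lA /AA' ? ->].
Qed.
End ListMap.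

Lemma lmap_comp (W W' W'' : choiceType) (f : W -> W') (g : W' -> W'') c :
  lmap g (lmap f c) = lmap (g \o f) c.
Proof.
elim/free_ind: c => [|l c IH]; first by rewrite !raddf0.
by rewrite !raddfD /= IH !lmapU map_comp.
Qed.

Section Homotopy.
Variables (W W' : choiceType) (f g : {additive lchains W -> lchains W'}).
Variable y : seq W -> W'.

Fixpoint list_homotopy (n : nat) (l : seq W) : lchains W' :=
  if n is n'.+1 then
    cone (y l) (f << l >> + g << l >> +
                extend (list_homotopy n') (list_bd l))
  else 0.

(** The standard acyclic-carrier construction: two chain maps that agree on the
    empty list are joined by coning off their difference, simplex by simplex,
    from an apex that may depend on the simplex. *)
Definition homotopy n : {additive lchains W -> lchains W'} :=
  extend (list_homotopy n).

Lemma homotopyU n l : homotopy n << l >> = list_homotopy n l.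
Proof. exact: extendU. Qed.

Lemma homotopy0 c : homotopy 0 c = 0.
Proof.
elim/free_ind: c => [|l c IH]; first by rewrite raddf0.
by rewrite raddfD /= IH addr0 homotopyU.
Qed.

Hypothesis f_bd : forall c, f (lbd c) = lbd (f c).
Hypothesis g_bd : forall c, g (lbd c) = lbd (g c).
Hypothesis fg_nil : f << [::] >> = g << [::] >>.

Lemma homotopyP n c : c \in supported (sized n) ->
  lbd (homotopy n c) + homotopy n.-1 (lbd c) = f c + g c.
Proof.
elim: n c => [|n IH].
  apply: supported_ind => [|l c /eqP/size0nil -> IHc]; first by rewrite !raddf0.
  rewrite !raddfD /= addrACA IHc homotopyU lbdU /= !raddf0 fg_nil.
  by rewrite addr0 [RHS]addrACA free_addxx.
apply: supported_ind => [|l c /eqP ln IHc]; first by rewrite !raddf0.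
rewrite !raddfD /= addrACA IHc [RHS]addrACA; congr (_ + _).
have IHl : lbd (homotopy n (lbd << l >>)) = f (lbd << l >>) + g (lbd << l >>).
  rewrite -IH; first by rewrite lbdK raddf0 addr0.
  by rewrite lbdU; exact: list_bd_sized.
rewrite homotopyU /= -/(homotopy n) -lbdU lbd_cone !raddfD IHl !f_bd !g_bd.
by rewrite [cone _ (_ + _)]raddfD free_addxx addr0 free_addrK.
Qed.

Lemma homotopy_sized n c :
  (forall n c, c \in supported (sized n) -> f c \in supported (sized n)) ->
  (forall n c, c \in supported (sized n) -> g c \in supported (sized n)) ->
  c \in supported (sized n) -> homotopy n c \in supported (sized n.+1).
Proof.
move=> fs gs; elim: n c => [|n IH] c cn; first by rewrite homotopy0 rpred0.
move: cn; apply: extend_supported => l ln /=.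
apply: cone_sized; rewrite !rpredD //; [exact/fs/supportedU|exact/gs/supportedU|].
by apply: IH; apply: list_bd_sized; apply/eqP.
Qed.

(** The homotopy stays in any convex region that receives both chain maps and
    contains the apices; this is how all homotopies below are kept inside
    unions of cells. *)
Lemma homotopy_among (A : pred W) (A' : pred W') n c :
  (forall c, c \in supported (among A) -> f c \in supported (among A')) ->
  (forall c, c \in supported (among A) -> g c \in supported (among A')) ->
  (forall l, l != [::] -> all A l -> A' (y l)) ->
  c \in supported (sized n) -> c \in supported (among A) ->
  homotopy n c \in supported (among A').
Proof.
move=> fA gA yA cn cA.
have := supported_and cn cA => {cn cA}.
elim: n c => [|n IH] c; first by rewrite homotopy0 rpred0.
apply: extend_supported => l /andP[/eqP ln lA] /=.
apply: cone_among; first by apply: yA; rewrite // -size_eq0 ln.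
rewrite !rpredD //; [exact/fA/supportedU|exact/gA/supportedU|].
apply: IH; apply: supported_and; first exact: list_bd_sized.
exact: list_bd_among.
Qed.
End Homotopy.

Section HomotopyNaturality.
Variables (W W' V V' : choiceType).
Variables (f g : {additive lchains W -> lchains W'}).
Variables (f' g' : {additive lchains V -> lchains V'}).
Variables (y : seq W -> W') (y' : seq V -> V') (h : W -> V) (h' : W' -> V').
Hypothesis ff' : forall c, lmap h' (f c) = f' (lmap h c).
Hypothesis gg' : forall c, lmap h' (g c) = g' (lmap h c).
Hypothesis yy' : forall l, h' (y l) = y' (map h l).

(** Naturality is what allows a homotopy constructed on the vertices of the
    standard simplex to be transported to all singular simplices. *)
Lemma homotopy_nat n c :
  lmap h' (homotopy f g y n c) = homotopy f' g' y' n (lmap h c).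
Proof.
elim: n c => [|n IHn] c; first by rewrite !homotopy0 raddf0.
elim/free_ind: c => [|l c IH]; first by rewrite !raddf0.
rewrite !raddfD /= {}IH; congr (_ + _); rewrite lmapU !homotopyU /=.
by rewrite -!/(homotopy _ _ _ _) lmap_cone !raddfD /= ff' gg' yy' IHn
  lmap_list_bd lmapU.
Qed.
End HomotopyNaturality.

(** * The prism operator *)

Section Prism.
Variables (W W' : choiceType) (i0 i1 : W -> W').

Fixpoint list_prism (l : seq W) : lchains W' :=
  if l is x :: l' then cone (i0 x) (list_prism l' + << map i1 l >>) else 0.

(** The usual triangulation of the prism, as the sum of the lists that switch
    once from [i0] to [i1]. *)
Definition prism : {additive lchains W -> lchains W'} := extend list_prism.

Lemma prismU l : prism << l >> = list_prism l.
Proof. exact: extendU. Qed.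

Lemma prism_cone x c : prism (cone x c) =
  cone (i0 x) (prism c) + cone (i0 x) (cone (i1 x) (lmap i1 c)).
Proof.
elim/free_ind: c => [|l c IH]; first by rewrite !raddf0 addr0.
rewrite !raddfD /= IH addrACA; congr (_ + _).
by rewrite coneU lmapU coneU !prismU /= raddfD.
Qed.

Lemma prismP c : lbd (prism c) + prism (lbd c) = lmap i0 c + lmap i1 c.
Proof.
elim/free_ind: c => [|l c IH]; first by rewrite !raddf0.
rewrite !raddfD /= addrACA IH [RHS]addrACA; congr (_ + _).
rewrite prismU lbdU !lmapU; elim: l {c IH} => [|x l IHl] /=.
  by rewrite !raddf0 addr0 free_addxx.
rewrite lbd_cone !raddfD /= prismU prism_cone lbdU /=.
have -> : lbd (list_prism l) =
    prism (list_bd l) + << map i0 l >> + << map i1 l >>.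
  by rewrite -[RHS]addrA -IHl [RHS]addrC free_addrK.
rewrite !raddfD !coneU lmap_list_bd.
by free_add.
Qed.

Lemma prism_sized n c : c \in supported (sized n) ->
  prism c \in supported (sized n.+1).
Proof.
apply: extend_supported => l; elim: l n => [|x l IH] n ln /=.
  exact: rpred0.
case: n ln => // n ln; apply: cone_sized; apply: rpredD; first exact: IH.
by apply: supportedU; rewrite /sized /= size_map.
Qed.

Lemma prism_among (A : pred W) (A' : pred W') c :
  (forall x, A x -> A' (i0 x) && A' (i1 x)) ->
  c \in supported (among A) -> prism c \in supported (among A').
Proof.
move=> AA'; apply: extend_supported; elim=> [|x l IH] /=.
  by rewrite rpred0.
move=> /andP[/AA'/andP[x0 x1] lA]; apply: cone_among => //.
apply: rpredD; [exact: IH|apply: supportedU; rewrite /among /= x1].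
by apply/allP => _ /mapP[z /(allP lA) /AA' /andP[_ ?] ->].
Qed.
End Prism.

(** * Barycentric subdivision *)

Section Subdivision.
Variables (R : realType) (W : lmodType R).

Definition bary (l : seq W) : W := (size l)%:R^-1 *: \sum_(x <- l) x.

Definition bary_closed (A : pred W) :=
  forall l, l != [::] -> all A l -> A (bary l).

Lemma bary1 x : bary [:: x] = x.
Proof. by rewrite /bary big_seq1 invr1 scale1r. Qed.

Fixpoint list_sd (n : nat) (l : seq W) : lchains W :=
  if n is n'.+1 then cone (bary l) (extend (list_sd n') (list_bd l))
  else << l >>.

Definition sd : {additive lchains W -> lchains W} :=
  extend (fun l => list_sd (size l) l).

Lemma sdU l : sd << l >> = list_sd (size l) l.
Proof. exact: extendU. Qed.

(** The recursion parameter of [list_sd] only has to agree with the length of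
    the lists. *)
Lemma sd_graded n c : c \in supported (sized n) -> extend (list_sd n) c = sd c.
Proof.
move: c; apply: supported_ind => [|l c /eqP <- IH]; first by rewrite !raddf0.
by rewrite !raddfD IH extendU sdU.
Qed.

Lemma sd_cons x l : sd << x :: l >> =
  cone (bary (x :: l)) (sd (list_bd (x :: l))).
Proof. by rewrite sdU -(@sd_graded (size l)) //; exact: (@list_bd_sized _ _ (x :: l)). Qed.

Lemma sd_nil : sd << [::] >> = << [::] >>.
Proof. by rewrite sdU. Qed.

Lemma sd1 x : sd << [:: x] >> = << [:: x] >>.
Proof. by rewrite sd_cons bary1 /= raddf0 addr0 sd_nil coneU. Qed.

(** The subdivision of a list refers to that of its faces, which are not
    sublists obtained by peeling off heads. *)
Lemma sd_size_ind (Q : seq W -> Prop) :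
  Q [::] -> (forall x l,
    (forall l', size l' = size l -> Q l') -> Q (x :: l)) -> forall l, Q l.
Proof.
move=> Q0 QS l; elim: {l}(size l) {-2}l (erefl (size l)) => [|n IH] [|x l] //=.
by move=> [ln]; apply: QS => l' e; apply: IH; rewrite e.
Qed.

(** Coning the subdivided boundary from the barycentre produces a chain whose
    boundary is the subdivided boundary plus a cone on its own boundary, and
    the latter vanishes by induction. *)
Lemma sd_bd c : sd (lbd c) = lbd (sd c).
Proof.
elim/free_ind: c => [|l c IH]; first by rewrite !raddf0.
rewrite !raddfD {}IH; congr (_ + _).
elim/sd_size_ind: l => [|x l IH]; first by rewrite lbdU sd_nil lbdU raddf0.
rewrite sd_cons lbd_cone -lbdU.
suff -> : lbd (sd (lbd << x :: l >>)) = 0 by rewrite raddf0 addr0.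
have : lbd << x :: l >> \in supported (sized (size l)).
  by rewrite lbdU; exact: list_bd_sized.
move=> lsz; transitivity (sd (lbd (lbd << x :: l >>))); last first.
  by rewrite lbdK raddf0.
move: (lbd _) lsz; apply: supported_ind => [|l' c' /eqP l'n IHc].
  by rewrite !raddf0.
by rewrite !raddfD IH // IHc.
Qed.

Lemma sd_sized n c : c \in supported (sized n) -> sd c \in supported (sized n).
Proof.
elim: n c => [|n IH]; apply: extend_supported => [[|x l]] ln //.
  exact: supportedU.
rewrite -sdU sd_cons; apply: cone_sized; apply: IH.
by apply: list_bd_sized; apply/eqP.
Qed.

Lemma sd_among (A : pred W) c : bary_closed A ->
  c \in supported (among A) -> sd c \in supported (among A).
Proof.
move=> Ab; apply: extend_supported => l; rewrite -sdU.
elim/sd_size_ind: l => [|x l IH] lA; first by rewrite sd_nil supportedU.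
rewrite sd_cons; apply: cone_among; first exact: Ab.
have : list_bd (x :: l) \in supported (fun l' => sized (size l) l' && among A l').
  by apply: supported_and; [exact: (@list_bd_sized _ _ (x :: l))|
    exact: list_bd_among].
by apply: extend_supported => l' /andP[/eqP e l'A]; rewrite -sdU; exact: IH.
Qed.

Definition sdm (m : nat) :
    {additive lchains W -> lchains W} :=
  extend (fun l => iter m sd << l >>).

Lemma sdmE m c : sdm m c = iter m sd c.
Proof.
elim/free_ind: c => [|l c IH]; first by rewrite raddf0; elim: m => //= m <-; rewrite raddf0.
by rewrite raddfD IH extendU; elim: m {IH} => //= m <-; rewrite raddfD.
Qed.

Lemma sdm_bd m c : sdm m (lbd c) = lbd (sdm m c).
Proof. by rewrite !sdmE; elim: m => //= m ->; rewrite sd_bd. Qed.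

Lemma sdm_sized m n c :
  c \in supported (sized n) -> sdm m c \in supported (sized n).
Proof. by move=> cn; rewrite sdmE; elim: m => //= m IH; exact: sd_sized. Qed.

Lemma sdm_among m (A : pred W) c : bary_closed A ->
  c \in supported (among A) -> sdm m c \in supported (among A).
Proof. by move=> Ab cA; rewrite sdmE; elim: m => //= m; exact: sd_among. Qed.

Lemma sdm_nil m : sdm m << [::] >> = << [::] >>.
Proof. by rewrite sdmE; elim: m => //= m ->; rewrite sd_nil. Qed.

Lemma sdm1 m x : sdm m << [:: x] >> = << [:: x] >>.
Proof. by rewrite sdmE; elim: m => //= m ->; rewrite sd1. Qed.

Definition sd_homotopy m n :=
  homotopy (idfun : {additive lchains W -> lchains W})
    (sdm m) bary n.

Lemma sd_homotopyP m n c : c \in supported (sized n) ->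
  lbd (sd_homotopy m n c) + sd_homotopy m n.-1 (lbd c) = c + sdm m c.
Proof.
apply: homotopyP => // [c'|]; first exact: sdm_bd.
by rewrite sdm_nil.
Qed.

Lemma sd_homotopy_sized m n c : c \in supported (sized n) ->
  sd_homotopy m n c \in supported (sized n.+1).
Proof. by apply: homotopy_sized => // n' c'; exact: sdm_sized. Qed.

End Subdivision.

Arguments sd {R W}.
Arguments sdm {R W} m.
Arguments sd_homotopy {R W} m n.

Section SubdivisionNaturality.
Variables (R : realType) (W V : lmodType R) (h : W -> V).
Hypothesis h_bary : forall l, h (bary l) = bary (map h l).

Lemma sd_nat c : lmap h (sd c) = sd (lmap h c).
Proof.
elim/free_ind: c => [|l c IH]; first by rewrite !raddf0.
rewrite !raddfD {}IH; congr (_ + _); rewrite lmapU.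
elim/sd_size_ind: l => [|x l IH]; first by rewrite !sd_nil lmapU.
rewrite /= !sd_cons lmap_cone h_bary -[list_bd (h x :: _)](lmap_list_bd h (x :: l)).
congr (cone _ _); have : size (x :: l) = (size l).+1 by [].
move=> /list_bd_sized; move: (list_bd (x :: l)).
apply: supported_ind => [|l' c' /eqP l'n IHc]; first by rewrite !raddf0.
by rewrite !raddfD IHc IH ?lmapU.
Qed.

Lemma sdm_nat m c : lmap h (sdm m c) = sdm m (lmap h c).
Proof. by rewrite !sdmE; elim: m => //= m <-; rewrite sd_nat. Qed.

Lemma sd_homotopy_nat m n c :
  lmap h (sd_homotopy m n c) = sd_homotopy m n (lmap h c).
Proof. by apply: homotopy_nat => // c'; exact: sdm_nat. Qed.
End SubdivisionNaturality.

(** * The mesh of the iterated subdivisions *)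

Section Mesh.
Variables (R : realType) (W : normedModType R).

Definition narrow (d : R) (l : seq W) : bool :=
  all (fun x => all (fun y => `|x - y| <= d) l) l.

Lemma narrowP d l :
  reflect {in l &, forall x y, `|x - y| <= d} (narrow d l).
Proof.
apply: (iffP allP) => [h x y xl yl|h x xl]; first exact: (allP (h x xl)).
by apply/allP => y yl; exact: h.
Qed.

Lemma narrow_le d d' l : d <= d' -> narrow d l -> narrow d' l.
Proof.
move=> dd' /narrowP h; apply/narrowP => x y xl yl.
exact: le_trans (h x y xl yl) dd'.
Qed.

Lemma ball_bary (z : W) r : bary_closed (fun x => `|z - x| <= r).
Proof.
move=> l l0 /allP lr; have s0 : (size l)%:R != 0 :> R.
  by rewrite pnatr_eq0 size_eq0.
have -> : z - bary l = (size l)%:R^-1 *: \sum_(x <- l) (z - x).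
  rewrite sumrB scalerBr big_const_seq count_predT.
  by rewrite iter_addr_0 -[z *+ size l]scaler_nat scalerA mulVf // scale1r.
rewrite normrZ ger0_norm ?invr_ge0 // ler_pdivrMl ?lt_def ?s0 //=.
apply: le_trans (ler_norm_sum _ _ _) _; rewrite mulr_natl.
apply: (@le_trans _ _ (\sum_(x <- l) r)); last first.
  by rewrite big_const_seq count_predT iter_addr_0.
by rewrite big_seq [leRHS]big_seq; apply: ler_sum => x /lr.
Qed.

(** The term of the mean that comes from y itself vanishes, whence the factor
    (n - 1) / n. *)
Lemma bary_dist d l y : narrow d l -> y \in l ->
  `|bary l - y| <= (size l).-1%:R / (size l)%:R * d.
Proof.
move=> /narrowP ld yl; have l0 : (0 < size l)%N by case: l yl {ld}.
have s0 : (size l)%:R != 0 :> R by rewrite pnatr_eq0 -lt0n.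
have -> : bary l - y = (size l)%:R^-1 *: \sum_(x <- l) (x - y).
  rewrite sumrB scalerBr [X in _ - _ *: X]big_const_seq count_predT.
  by rewrite iter_addr_0 -[y *+ size l]scaler_nat scalerA mulVf // scale1r.
rewrite normrZ ger0_norm ?invr_ge0 // mulrAC mulrC ler_pM2r ?invr_gt0 ?ltr0n //.
apply: le_trans (ler_norm_sum _ _ _) _; rewrite mulr_natl.
rewrite (big_rem y) //= subrr normr0 add0r.
apply: (@le_trans _ _ (\sum_(x <- rem y l) d)); last first.
  by rewrite big_const_seq count_predT iter_addr_0 size_rem.
rewrite big_seq [leRHS]big_seq; apply: ler_sum => x /mem_rem xl.
exact: ld.
Qed.

Definition mesh (n : nat) : R := n%:R / n.+1%:R.

Lemma mesh_ge0 n : 0 <= mesh n.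
Proof. by rewrite /mesh divr_ge0. Qed.

Lemma mesh_lt1 n : mesh n < 1.
Proof. by rewrite /mesh ltr_pdivrMr // mul1r ltr_nat. Qed.

Lemma mesh_le n : mesh n <= mesh n.+1.
Proof.
rewrite /mesh ler_pdivrMr // mulrAC ler_pdivlMr // -!natrM ler_nat.
by rewrite mulnS mulSn leq_add2r.
Qed.

(** A list of the subdivision consists of the barycentre and of points of a
    subdivided face. The former is controlled by [bary_dist] and convexity of
    balls, the latter by induction, since [mesh] is increasing. *)
Lemma list_sd_narrow d n l : size l = n.+1 -> narrow d l ->
  sd << l >> \in supported (narrow (mesh n * d)).
Proof.
elim: n l => [|n IH] [|x l] //= [ln] ld.
  case: l ln ld => //= _ _; rewrite sd1 supportedU //.
  by apply/narrowP => y z; rewrite !inE => /eqP -> /eqP ->; rewrite subrr normr0 /mesh !mul0r.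
have d0 : 0 <= d.
  by have /narrowP/(_ x x) := ld; rewrite subrr normr0; apply; exact: mem_head.
rewrite sd_cons; set b := bary _.
pose B (y : W) := `|b - y| <= mesh n.+1 * d.
have lB : all B (x :: l).
  apply/allP => y yl; apply: le_trans (bary_dist ld yl) _.
  by rewrite /= ln.
have dB : sd (list_bd (x :: l)) \in supported (among B).
  apply: sd_among; first exact: ball_bary.
  exact: list_bd_among.
have ldn : all (fun y => all (fun z => `|y - z| <= d) (x :: l)) (x :: l) := ld.
have dN : sd (list_bd (x :: l)) \in supported (narrow (mesh n * d)).
  have : list_bd (x :: l) \in
      supported (fun l' => sized n.+1 l' && all (mem (x :: l)) l').
    apply: supported_and; first exact: (@list_bd_sized _ n.+1 (x :: l) (congr1 S ln)).
    by apply: list_bd_among; exact/allP.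
  apply: extend_supported => l' /andP[/eqP l'n /allP l'l]; rewrite -sdU.
  apply: IH => //; apply/narrowP => y z /l'l yl /l'l zl.
  by have /narrowP := ld; apply.
have := supported_and dB dN.
apply: extend_supported => l' /andP[/allP l'B l'N]; apply: supportedU.
have {}l'N : narrow (mesh n.+1 * d) l'.
  by apply: narrow_le l'N; rewrite ler_wpM2r // mesh_le.
apply/narrowP => y z; rewrite !inE => /orP[/eqP ->|yl] /orP[/eqP ->|zl].
- by rewrite subrr normr0 mulr_ge0 // mesh_ge0.
- exact: l'B.
- by rewrite distrC; exact: l'B.
- exact: (narrowP _ _ l'N).
Qed.

Lemma sdm_narrow d n m l : size l = n.+1 -> narrow d l ->
  sdm m << l >> \in supported (narrow (mesh n ^+ m * d)).
Proof.
move=> ln ld; rewrite sdmE.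
suff : iter m sd << l >> \in
    supported (fun l' => sized n.+1 l' && narrow (mesh n ^+ m * d) l').
  by apply: supported_sub => l' /andP[].
elim: m => [|m IH] /=.
  by apply: supportedU; rewrite expr0 mul1r ld andbT; apply/eqP.
apply: extend_supported IH => l' /andP[/eqP l'n l'd]; rewrite -sdU.
apply: supported_and; last by rewrite exprS -mulrA; exact: list_sd_narrow.
by apply: sd_sized; apply: supportedU; apply/eqP.
Qed.

(** Powers of a number less than one tend to zero. *)
Lemma mesh_small n (d e : R) : 0 < e -> exists m0, forall m, (m0 <= m)%N ->
  mesh n ^+ m * d < e.
Proof.
move=> e0; have : (fun m => mesh n ^+ m * d) @ \oo --> (0 * d).
  by apply: cvgMl; apply: cvg_expr; rewrite ger0_norm ?mesh_ge0 ?mesh_lt1.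
rewrite mul0r => /cvgrPdist_lt /(_ e e0) [m0 _ h]; exists m0 => m /h /=.
rewrite sub0r normrN; exact: le_lt_trans (ler_norm _).
Qed.
End Mesh.

Arguments sing_bd {R E} p.
Arguments sing_in_chain {R E} X p.

(** * Singular simplices spanned by lists of points *)

Section AffineSimplices.
Variables (R : realType) (W : lmodType R).

Definition aff (p : nat) (l : seq W) (z : @stdsimplex R p) : W :=
  \sum_(j < p.+1) set_val z ord0 j *: nth 0 l j.

Definition aff_closed (A : pred W) := forall p l (z : @stdsimplex R p),
  size l = p.+1 -> all A l -> A (aff l z).

Lemma stdsimplex_ge0 p (z : @stdsimplex R p) j : 0 <= set_val z ord0 j.
Proof. by have [] := set_valP z. Qed.

Lemma stdsimplex_sum p (z : @stdsimplex R p) : \sum_j set_val z ord0 j = 1.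
Proof. by have [] := set_valP z. Qed.

(** Zeroing one barycentric coordinate amounts to dropping the corresponding
    point. *)
Lemma aff_coface p (i : 'I_p.+2) (l : seq W) (z : @stdsimplex R p) :
  size l = p.+2 ->
  aff l (coface i z) = aff (delete_nth i l) z.
Proof.
move=> ln; rewrite /aff (bigD1_ord i) //= mxE unlift_none scale0r add0r.
apply: eq_bigr => k _; rewrite mxE liftK /=; congr (_ *: _).
by rewrite nth_delete // ln.
Qed.

Lemma centre_subproof p : @stdsimplex R p (const_mx (p.+1%:R^-1)).
Proof.
split=> [i|]; first by rewrite mxE invr_ge0.
under eq_bigr do rewrite mxE.
by rewrite sumr_const card_ord -[LHS]mulr_natl mulfV // pnatr_eq0.
Qed.

Definition centre p : @stdsimplex R p := SigSub (mem_set (@centre_subproof p)).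

(** The barycentre is the image of the centre of the standard simplex. *)
Lemma aff_bary_closed (A : pred W) : aff_closed A -> bary_closed A.
Proof.
move=> Aaff [//|x l] _ lA.
suff -> : bary (x :: l) = aff (x :: l) (centre (size l)) by exact: Aaff.
rewrite /aff /bary scaler_sumr (big_nth 0) big_mkord.
by apply: eq_bigr => j _; rewrite mxE.
Qed.
End AffineSimplices.

Section LinearFunction.
Variables (R : realType) (W V : lmodType R) (h : W -> V).
Hypothesis hl : linear h.

Lemma linear_fun0 : h 0 = 0.
Proof. by have := hl (-1) 0 0; rewrite scaler0 addr0 scaleN1r addNr. Qed.

Lemma linear_funZ a x : h (a *: x) = a *: h x.
Proof. by have := hl a x 0; rewrite linear_fun0 !addr0. Qed.

Lemma linear_fun_sum (I : Type) (r : seq I) (F : I -> W) :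
  h (\sum_(i <- r) F i) = \sum_(i <- r) h (F i).
Proof.
have hD : {morph h : x y / x + y}.
  by move=> x y; have := hl 1 x y; rewrite !scale1r.
exact: (big_morph h hD linear_fun0).
Qed.

Lemma aff_map p l (z : @stdsimplex R p) : size l = p.+1 ->
  h (aff l z) = aff (map h l) z.
Proof.
move=> ln; rewrite linear_fun_sum; apply: eq_bigr => j _.
by rewrite linear_funZ (nth_map 0) // ln.
Qed.

Lemma bary_map l : h (bary l) = bary (map h l).
Proof. by rewrite /bary linear_funZ linear_fun_sum big_map size_map. Qed.
End LinearFunction.

(** Only composites with affine simplices ever have to be continuous; asking
    for no more avoids a topology on the vector space of parameters. *)
Record swmap (R : realType) (W : lmodType R) (E : topologicalType) := SwMap {
  sw_fun :> W -> E;
  sw_cont : forall p (l : seq W), continuous (fun z : @stdsimplex R p => sw_fun (aff l z)) }.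

(** * Singular simplices given by lists of parameters *)

Section Realization.
Variables (R : realType) (W : lmodType R) (E : topologicalType).
Implicit Type G : swmap W E.

Definition aff_sing p G (l : seq W) : sing R E p := mkcts (@sw_cont _ _ _ G p l).

Definition real p G : {additive lchains W -> sing_chain R E p} :=
  extend (fun l => << aff_sing p G l >>).

Lemma realU p G l : real p G << l >> = << aff_sing p G l >>.
Proof. exact: extendU. Qed.

Lemma sing_bdU p (s : sing R E p.+1) :
  sing_bd p << s >> = \sum_(i < p.+2) << sface i s >>.
Proof. exact: free_liftU. Qed.

(** The length condition matters: lists that are too short or too long are read
    with default values or truncated. *)
Lemma real_bd p G c : c \in supported (sized p.+2) ->
  sing_bd p (real p.+1 G c) = real p G (lbd c).
Proof.
move: c; apply: supported_ind => [|l c /eqP ln IH]; first by rewrite !raddf0.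
rewrite !raddfD IH realU lbdU list_bdE ln raddf_sum; congr (_ + _).
rewrite sing_bdU; apply: eq_bigr => i _; rewrite realU.
congr (<< _ >>); apply/continuousEP => z /=.
by rewrite -[LHS]/(G (aff l (coface i z))) aff_coface // ln.
Qed.

Lemma real_in p G (A : pred W) (P : pred (sing R E p)) c :
  (forall l, size l = p.+1 -> all A l -> P (aff_sing p G l)) ->
  c \in supported (sized p.+1) -> c \in supported (among A) ->
  real p G c \in supported P.
Proof.
move=> AP cs cA; have := supported_and cs cA.
apply: extend_supported => l /andP[/eqP ln lA]; apply: supportedU; exact: AP.
Qed.
End Realization.

(** The two maps have to agree only on the convex region spanned by the points
    in use, which matters because maps defined on a standard simplex are
    extended to the ambient space through a retraction. *)
Lemma eq_real (R : realType) (W V : lmodType R) (E : topologicalType) p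
    (G : swmap W E) (H : swmap V E) (h : W -> V) (A : pred W) c :
  linear h -> aff_closed A -> (forall x, A x -> G x = H (h x)) ->
  c \in supported (sized p.+1) -> c \in supported (among A) ->
  real p G c = real p H (lmap h c).
Proof.
move=> hl Aaff GH cs cA; have := supported_and cs cA; move: c {cs cA}.
apply: supported_ind => [|l c /andP[/eqP ln lA] IH]; first by rewrite !raddf0.
rewrite !raddfD IH lmapU !realU; congr (<< _ >> + _); apply/continuousEP => z /=.
by rewrite /mkcts GH ?Aaff // aff_map.
Qed.

(** * Natural operators on singular chains *)

Section Vertices.
Variable R : realType.

Definition vertices (p : nat) : seq 'rV[R]_p.+1 :=
  [seq delta_mx 0 j | j <- enum 'I_p.+1].

Lemma size_vertices p : size (vertices p) = p.+1.
Proof. by rewrite size_map size_enum_ord. Qed.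

Lemma nth_vertices p (j : 'I_p.+1) : nth 0 (vertices p) j = delta_mx 0 j.
Proof. by rewrite (nth_map ord0) ?size_enum_ord ?nth_ord_enum. Qed.

Lemma aff_vertices p (z : @stdsimplex R p) : aff (vertices p) z = set_val z.
Proof.
rewrite /aff; under eq_bigr do rewrite nth_vertices.
by rewrite -row_sum_delta.
Qed.

Lemma coface_row_linear p (i : 'I_p.+2) : linear (@coface_row R p i).
Proof.
move=> a x y; apply/rowP => j; rewrite !mxE.
by case: (unlift i j) => [k|] /=; rewrite ?mxE // mulr0 addr0.
Qed.

Lemma delete_vertices p (i : 'I_p.+2) :
  delete_nth i (vertices p.+1) = map (coface_row i) (vertices p).
Proof.
have iv : (i < size (vertices p.+1))%N by rewrite size_vertices.
apply: (@eq_from_nth _ 0).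
  by rewrite size_delete // size_vertices size_map size_vertices.
move=> k; rewrite size_delete // size_vertices /= => kp.
rewrite nth_delete // (nth_map 0 0 (coface_row i)) ?size_vertices //.
pose k' : 'I_p.+1 := Ordinal kp; rewrite -[k]/(nat_of_ord k').
rewrite -[bump _ _]/(nat_of_ord (fintype.lift i k')) !nth_vertices.
apply/rowP => j; rewrite !mxE /=.
case: (unliftP i j) => [j' ->|->] /=; first by rewrite mxE (inj_eq lift_inj).
by rewrite (negbTE (neq_lift _ _)).
Qed.

Definition in_simplex p : pred 'rV[R]_p.+1 := fun x => x \in @stdsimplex R p.

Lemma vertices_in_simplex p : all (@in_simplex p) (vertices p).
Proof.
apply/allP => _ /mapP[j _ ->]; rewrite /in_simplex inE; split=> [k|].
  by rewrite mxE.
rewrite (bigD1 j) //= mxE !eqxx big1 ?addr0 // => k /negbTE kj.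
by rewrite mxE kj andbF.
Qed.

Lemma in_simplex_aff_closed p : aff_closed (@in_simplex p).
Proof.
move=> q l z ln /allP lA; rewrite /in_simplex inE.
have lS (j : 'I_q.+1) : @stdsimplex R p (nth 0 l j).
  by apply/set_mem/lA/mem_nth; rewrite ln.
split=> [i|].
  rewrite summxE sumr_ge0 // => j _; rewrite mxE mulr_ge0 ?stdsimplex_ge0 //.
  by have [] := lS j.
under eq_bigr do rewrite summxE.
rewrite exchange_big /= -[RHS](stdsimplex_sum z); apply: eq_bigr => j _.
under eq_bigr do rewrite mxE.
by rewrite -mulr_sumr; have [_ ->] := lS j; rewrite mulr1.
Qed.
End Vertices.

Arguments in_simplex {R p}.

Section NaturalOperators.
Variables (R : realType) (E : topologicalType).

(** A natural operator commutes with taking faces: the faces of the standard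
    simplex are its images under the coface maps. *)
Lemma real_faces (W V : lmodType R) p q
  (N : {additive lchains ('rV[R]_p.+1) -> lchains W})
  (N' : {additive lchains ('rV[R]_p.+2) -> lchains V})
  (g : 'I_p.+2 -> swmap W E) (G : swmap V E) (h : 'I_p.+2 -> W -> V)
  (A : pred W) :
  (forall i, linear (h i)) -> aff_closed A ->
  (forall i c, N' (lmap (coface_row i) c) = lmap (h i) (N c)) ->
  (forall i x, A x -> g i x = G (h i x)) ->
  N << vertices R p >> \in supported (sized q.+1) ->
  N << vertices R p >> \in supported (among A) ->
  \sum_i real q (g i) (N << vertices R p >>) =
  real q G (N' (lbd << vertices R p.+1 >>)).
Proof.
move=> hl Aaff NN' gG Ns NA; rewrite lbdU list_bdE size_vertices !raddf_sum.
apply: eq_bigr => i _; rewrite (eq_real (hl i) Aaff (gG i) Ns NA) -NN' lmapU.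
by rewrite delete_vertices.
Qed.

(** The second summand vanishes on the standard simplex and keeps the total
    weight positive everywhere, so that normalizing the weights is a retraction
    defined on the whole space. *)
Definition weight p (x : 'rV[R]_p.+1) (j : 'I_p.+1) : R :=
  `|x ord0 j| + `|1 - \sum_i `|x ord0 i| |.

Lemma weight_sum_gt0 p (x : 'rV[R]_p.+1) : 0 < \sum_j weight x j.
Proof.
rewrite lt_def sumr_ge0 ?andbT; last by move=> j _; rewrite addr_ge0.
apply/negP => /eqP w0.
have w j : weight x j = 0.
  by apply: (psumr_eq0P _ w0) => // k _; rewrite addr_ge0.
have x0 j : x ord0 j = 0.
  apply/eqP; rewrite -normr_le0 -(w j) lerDl //.
have := w ord0; rewrite /weight x0 normr0 add0r big1 => [|j _].
  by rewrite subr0 normr1 => /eqP; rewrite oner_eq0.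
by rewrite x0 normr0.
Qed.

Definition retract_row p (x : 'rV[R]_p.+1) : 'rV[R]_p.+1 :=
  \row_j (weight x j / \sum_k weight x k).

Lemma retract_rowP p (x : 'rV[R]_p.+1) : @stdsimplex R p (retract_row x).
Proof.
split=> [j|].
  by rewrite mxE divr_ge0 ?addr_ge0 // ltW // weight_sum_gt0.
under eq_bigr do rewrite mxE.
by rewrite -mulr_suml mulfV // gt_eqF // weight_sum_gt0.
Qed.

Definition retract p (x : 'rV[R]_p.+1) : @stdsimplex R p :=
  SigSub (mem_set (retract_rowP x)).

Lemma retract_id p (x : 'rV[R]_p.+1) : in_simplex x ->
  set_val (retract x) = x.
Proof.
rewrite /in_simplex inE => -[x0 x1]; have w j : weight x j = x ord0 j.
  rewrite /weight ger0_norm // (eq_bigr (x ord0)) ?x1 ?subrr ?normr0 ?addr0 //.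
  by move=> k _; rewrite ger0_norm.
apply/rowP => j; rewrite mxE w; under eq_bigr do rewrite w.
by rewrite x1 divr1.
Qed.

Lemma retract_val p (z : @stdsimplex R p) : retract (set_val z) = z.
Proof.
by apply: val_inj; apply: retract_id; rewrite /in_simplex inE; exact: set_valP.
Qed.

Lemma continuous_row (X : topologicalType) n (f : X -> 'rV[R]_n) :
  (forall j, continuous (fun x => f x ord0 j)) -> continuous f.
Proof.
move=> fc x A [B nB BA].
have : nbhs x [set y | forall aj : 'I_1 * 'I_n, B aj.1 aj.2 (f y aj.1 aj.2)].
  apply: (@filter_forall _ _ (fun aj : 'I_1 * 'I_n =>
    [set y | B aj.1 aj.2 (f y aj.1 aj.2)]) (nbhs x)) => -[a j].
  by rewrite /= (ord1 a); exact: fc.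
by apply: filterS => y yB; apply: BA => a j; exact: (yB (a, j)).
Qed.

Lemma continuous_sum (X : topologicalType) (I : finType) (f : I -> X -> R) :
  (forall i, continuous (f i)) -> continuous (fun x => \sum_i f i x).
Proof.
move=> fc; have -> : (fun x => \sum_i f i x) = \sum_i f i.
  by apply/funext => x; rewrite fct_sumE.
elim/big_ind: _ => // [|g h gc hc] x; first exact: cvg_cst.
exact: cvgD (gc x) (hc x).
Qed.

Lemma continuous_mulr (X : topologicalType) (f : X -> R) (a : R) :
  continuous f -> continuous (fun x => f x * a).
Proof. by move=> fc x; apply: cvgMl; exact: fc. Qed.

Lemma continuous_set_val p j : continuous (fun z : @stdsimplex R p => set_val z ord0 j).
Proof.
move=> z; apply: (@continuous_comp _ _ _ set_val (fun M : 'rV[R]_p.+1 => M ord0 j)).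
  exact: initial_continuous.
exact: coord_continuous.
Qed.

Lemma continuous_aff_coord p q (l : seq 'rV[R]_q.+1) j :
  continuous (fun z : @stdsimplex R p => aff l z ord0 j).
Proof.
have -> : (fun z : @stdsimplex R p => aff l z ord0 j) =
    fun z => \sum_(i < p.+1) set_val z ord0 i * nth 0 l i ord0 j.
  by apply/funext => z; rewrite summxE; apply: eq_bigr => i _; rewrite mxE.
by apply: continuous_sum => i; apply: continuous_mulr; exact: continuous_set_val.
Qed.

Lemma continuous_retract (X : topologicalType) p (f : X -> 'rV[R]_p.+1) :
  (forall j, continuous (fun x => f x ord0 j)) ->
  continuous (fun x => retract (f x)).
Proof.
move=> fc; apply: continuous_comp_initial; apply: continuous_row => j.
have nc k : continuous (fun x => `|f x ord0 k|).
  by move=> x; apply: cvg_norm; exact: fc.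
have wc k : continuous (fun x => weight (f x) k).
  move=> x; apply: cvgD; first exact: nc.
  apply: cvg_norm; apply: cvgB; first exact: cvg_cst.
  exact: (continuous_sum nc).
have -> : (fun x => (set_val \o (fun x => retract (f x))) x ord0 j) =
    fun x => weight (f x) j / \sum_k weight (f x) k.
  by apply/funext => x /=; rewrite mxE.
move=> x; apply: cvgM; first exact: wc.
apply: cvgV; first by rewrite gt_eqF // weight_sum_gt0.
exact: (continuous_sum wc).
Qed.

Section Frame.
Variables (p : nat) (s : sing R E p).

Lemma frame_cont q (l : seq 'rV[R]_p.+1) :
  continuous (fun z : @stdsimplex R q => s (retract (aff l z))).
Proof.
move=> z; apply: (@continuous_comp _ _ _ (fun z => retract (aff l z)) s).
  by apply: continuous_retract => j; exact: continuous_aff_coord.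
exact: cts_fun.
Qed.

(** Precomposing with the retraction lets the simplex be evaluated on arbitrary
    lists of points. *)
Definition frame : swmap 'rV[R]_p.+1 E :=
  @SwMap R _ E (fun x => s (retract x)) frame_cont.

Lemma real_frame : real p frame << vertices R p >> = << s >>.
Proof.
rewrite realU; congr << _ >>; apply/continuousEP => z /=.
by rewrite /mkcts /= aff_vertices retract_val.
Qed.
End Frame.

Lemma frame_face p (i : 'I_p.+2) (s : sing R E p.+1) x : in_simplex x ->
  frame (sface i s) x = frame s (coface_row i x).
Proof.
move=> xs; rewrite /= ; congr (s _); apply: val_inj.
rewrite [RHS]retract_id /=; first by rewrite retract_id.
by rewrite /in_simplex inE -(retract_id xs); exact: coface_rowP.
Qed.

Section Operator.
Variables (p q : nat).
Variable N : {additive lchains ('rV[R]_p.+1) -> lchains ('rV[R]_p.+1)}.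

Definition sing_op : {additive sing_chain R E p -> sing_chain R E q} :=
  extend (fun s => real q (frame s) (N << vertices R p >>)).

Lemma sing_opU s : sing_op << s >> = real q (frame s) (N << vertices R p >>).
Proof. exact: extendU. Qed.

(** The operator replaces a simplex by simplices with smaller range. *)
Lemma sing_op_in X c : c \in sing_in_chain X p ->
  sing_op c \in sing_in_chain X q.
Proof.
apply: extend_supported => s /asboolP sX.
suff : N << vertices R p >> \in supported xpredT.
  apply: extend_supported => l _; apply: supportedU; apply/asboolP => _ [z _ <-].
  by apply: sX; exists (retract (aff l z)).
by apply/allP.
Qed.
End Operator.

Lemma sing_op_bd p q
  (N : {additive lchains ('rV[R]_p.+1) -> lchains ('rV[R]_p.+1)})
  (N' : {additive lchains ('rV[R]_p.+2) -> lchains ('rV[R]_p.+2)})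
  (s : sing R E p.+1) :
  (forall (i : 'I_p.+2) c, N' (lmap (coface_row i) c) = lmap (coface_row i) (N c)) ->
  N << vertices R p >> \in supported (sized q.+1) ->
  N << vertices R p >> \in supported (among in_simplex) ->
  sing_op q N (sing_bd p << s >>) =
  real q (frame s) (N' (lbd << vertices R p.+1 >>)).
Proof.
move=> NN' Ns NA; rewrite sing_bdU raddf_sum.
under eq_bigr do rewrite sing_opU.
apply: (real_faces (fun i => @coface_row_linear R p i) (@in_simplex_aff_closed R p)) => //.
move=> i x; exact: frame_face.
Qed.
End NaturalOperators.

(** * Chains of subsets *)

Section SetChains.
Import mathcomp.boot.finset.
Variable T : finType.
Implicit Types (s t A : {set T}) (u v : T).

Local Notation fchain := {freeg {set T} / 'F_2}.

Definition fbd : {additive fchain -> fchain} :=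
  extend (fun s => \sum_(v in s) << s :\ v >>).

Lemma fbdU s : fbd << s >> = \sum_(v in s) << s :\ v >>.
Proof. exact: extendU. Qed.

(** Coning with apex v in the full simplex; a repeated vertex gives a
    degenerate simplex, hence zero. *)
Definition join v : {additive fchain -> fchain} :=
  extend (fun s => if v \in s then 0 else << v |: s >>).

Lemma joinU v s : join v << s >> = if v \in s then 0 else << v |: s >>.
Proof. exact: extendU. Qed.

Lemma joinP v c : fbd (join v c) + join v (fbd c) = c.
Proof.
elim/free_ind: c => [|s c IH]; first by rewrite !raddf0 addr0.
rewrite !raddfD addrACA IH; congr (_ + _); rewrite joinU fbdU raddf_sum.
case: ifPn => vs.
  rewrite raddf0 add0r (bigD1 v) //= joinU setD11 setD1K // big1 ?addr0 //.
  by move=> w /andP[ws wv]; rewrite joinU !inE vs eq_sym wv.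
rewrite fbdU big_setU1 //= setU1K // -addrA -big_split big1 ?addr0 // => w ws.
rewrite joinU !inE (negbTE vs) andbF /=.
have vw : v != w by apply: contraNneq vs => ->.
have -> : (v |: s) :\ w = v |: (s :\ w).
  apply/setP => x; rewrite !inE; have [->|//] := eqVneq x v.
  by rewrite vw.
by rewrite free_addxx.
Qed.

(** Removing a vertex and joining it back expresses the boundary by that of a
    smaller simplex, which gives an induction without double sums. *)
Lemma fbdK c : fbd (fbd c) = 0.
Proof.
elim/free_ind: c => [|s c IH]; first by rewrite !raddf0.
rewrite !raddfD {}IH addr0.
elim: {s}#|s| {-2}s (erefl #|s|) => [|n IH] s sn.
  by move/eqP: sn; rewrite cards_eq0 => /eqP ->; rewrite fbdU big_set0 raddf0.
have /card_gt0P[v vs] : (0 < #|s|)%N by rewrite sn.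
have sE : << s >> = join v << s :\ v >> by rewrite joinU setD11 setD1K.
have dE : fbd << s >> = << s :\ v >> + join v (fbd << s :\ v >>).
  by rewrite sE -[X in _ = X + _](joinP v) free_addrK.
(* the second boundary of the smaller simplex vanishes by induction *)
have dj : fbd (join v (fbd << s :\ v >>)) = fbd << s :\ v >>.
  rewrite -[RHS](joinP v) IH; first by rewrite raddf0 addr0.
  by move: sn; rewrite (cardsD1 v) vs => -[].
by rewrite dE raddfD dj free_addxx.
Qed.

Definition carded (n : nat) : pred {set T} := fun s => #|s| == n.
Definition contained A : pred {set T} := fun s => s \subset A.

Lemma fbdU_carded n s : #|s| = n.+1 -> fbd << s >> \in supported (carded n).
Proof.
move=> sn; rewrite fbdU; apply: rpred_sum => v vs; apply: supportedU.
by rewrite /carded -eqSS -sn (cardsD1 v s) vs.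
Qed.

Lemma fbd_carded n c : c \in supported (carded n.+1) ->
  fbd c \in supported (carded n).
Proof.
move: c; apply: supported_ind => [|s c /eqP sn IH]; first by rewrite raddf0 rpred0.
by rewrite raddfD rpredD // fbdU_carded.
Qed.

Lemma fbdU_contained A s : s \subset A -> fbd << s >> \in supported (contained A).
Proof.
move=> sA; rewrite fbdU; apply: rpred_sum => v vs; apply: supportedU.
exact: fintype.subset_trans (subsetDl _ _) sA.
Qed.

Lemma join_carded n v c : c \in supported (carded n) ->
  join v c \in supported (carded n.+1).
Proof.
apply: extend_supported => s sn; case: ifPn => vs; first exact: rpred0.
by apply: supportedU; rewrite /carded cardsU1 vs.
Qed.

Lemma join_contained A v c : v \in A -> c \in supported (contained A) ->
  join v c \in supported (contained A).
Proof.
move=> vA; apply: extend_supported => s sA; case: ifP => _; first exact: rpred0.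
by apply: supportedU; rewrite /contained subUset sub1set vA.
Qed.

(** The normalization map from ordered to unordered simplicial chains: lists
    with a repetition are degenerate. *)
Definition spanned : {additive lchains T -> fchain} :=
  extend (foldr (fun v c => join v c) << set0 >>).

Lemma spannedU l : spanned << l >> = foldr (fun v c => join v c) << set0 >> l.
Proof. exact: extendU. Qed.

Lemma spanned_cone v c : spanned (cone v c) = join v (spanned c).
Proof.
elim/free_ind: c => [|l c IH]; first by rewrite !raddf0.
by rewrite !raddfD IH coneU !spannedU.
Qed.

Lemma spanned_bd c : fbd (spanned c) = spanned (lbd c).
Proof.
elim/free_ind: c => [|l c IH]; first by rewrite !raddf0.
rewrite !raddfD {}IH; congr (_ + _); rewrite lbdU; elim: l => [|v l IH].
  by rewrite spannedU fbdU big_set0 raddf0.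
rewrite /= raddfD spanned_cone -IH -coneU spanned_cone.
by rewrite -[X in _ = X + _](joinP v) free_addrK.
Qed.

Lemma spanned_carded n c : c \in supported (sized n) ->
  spanned c \in supported (carded n).
Proof.
apply: extend_supported => l; elim: l n => [|v l IH] [|n] //= ln.
  by apply: supportedU; rewrite /carded cards0.
by apply: join_carded; exact: IH.
Qed.

Lemma spanned_contained A c : c \in supported (among (mem A)) ->
  spanned c \in supported (contained A).
Proof.
apply: extend_supported; elim=> [|v l IH] /=.
  by move=> _; apply: supportedU; exact: sub0set.
by move=> /andP[vA lA]; apply: join_contained => //; exact: IH.
Qed.

End SetChains.

Arguments fbd {T}.
Arguments spanned {T}.

(** * The cellular boundary of the hypersurface *)

Section Hypersurface.
Import mathcomp.boot.finset.
Variables (T : finType) (eps : T -> 'F_2).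
Implicit Types (s t A : {set T}) (u v : T).

Local Notation constant s := (constant_on eps s).

Lemma constant_onP s : reflect {in s &, forall u v, eps u = eps v} (constant s).
Proof.
apply: (iffP forall_inP) => [h u v us vs|h u us].
  by have /forall_inP/(_ v vs)/eqP := h u us.
by apply/forall_inP => v vs; apply/eqP; exact: h.
Qed.

Lemma constant_sub s t : t \subset s -> constant s -> constant t.
Proof.
move=> /fintype.subsetP ts /constant_onP h; apply/constant_onP => u v /ts us /ts vs.
exact: h.
Qed.

Lemma constant1 v : constant [set v].
Proof. by apply/constant_onP => x y /set1P -> /set1P ->. Qed.

Lemma nonconstant_card s : ~~ constant s -> (1 < #|s|)%N.
Proof.
apply: contraNltn => s1; apply/constant_onP => u v us vs.
by rewrite (card_le1_eqP s1 u v).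
Qed.

Lemma nonconstantP s : reflect
  (exists u v, [/\ u \in s, v \in s, eps u = 0 & eps v != 0]) (~~ constant s).
Proof.
apply: (iffP idP) => [sc|[u [v [us vs u0]]]]; last first.
  by apply: contraNN => /constant_onP h; rewrite -(h u v us vs) u0.
have [[u /andP[us /eqP u0]]|no0] :=
    altP (@existsP _ (fun u => (u \in s) && (eps u == 0))).
  have [[v /andP[vs v0]]|no1] :=
    altP (@existsP _ (fun v => (v \in s) && (eps v != 0))).
    by exists u, v.
  case/negP: sc; apply/constant_onP => x y xs ys.
  have e0 z : z \in s -> eps z = 0.
    move=> zs; have /existsPn/(_ z) := no1.
    by rewrite zs negbK => /eqP.
  by rewrite !e0.
case/negP: sc; apply/constant_onP => x y xs ys.
have e1 z : z \in s -> eps z = 1.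
  move=> zs; have /existsPn/(_ z) := no0.
  by rewrite zs; have [->|->] := F2P (eps z).
by rewrite !e1.
Qed.

Definition label := {x : T * T | (eps x.1 == 0) && (eps x.2 != 0)}.

Definition lab0 (x : label) : T := (val x).1.
Definition lab1 (x : label) : T := (val x).2.

Lemma lab0P x : eps (lab0 x) = 0.
Proof. by have /andP[/eqP] := valP x. Qed.

Lemma lab1P x : eps (lab1 x) != 0.
Proof. by have /andP[] := valP x. Qed.

Definition label_in A : pred label := fun x => (lab0 x \in A) && (lab1 x \in A).

Local Notation fchain := {freeg {set T} / 'F_2}.
Local Notation labchain := (lchains label).

(** The Alexander-Whitney map: the prism between the lists of first and of
    second components, with degenerate simplices removed. *)
Definition diag (c : labchain) : fchain := spanned (prism lab0 lab1 c).

Lemma diag_is_zmod_morphism : zmod_morphism diag.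
Proof. by move=> x y; rewrite /diag !raddfB. Qed.
HB.instance Definition _ :=
  GRing.isZmodMorphism.Build labchain fchain diag diag_is_zmod_morphism.

(** The prism formula; the two end terms are spanned by simplices on which eps
    is constant, so they vanish in the relative complex. *)
Lemma diag_bd c :
  fbd (diag c) = diag (lbd c) + (spanned (lmap lab0 c) + spanned (lmap lab1 c)).
Proof.
by rewrite -raddfD -prismP raddfD [RHS]addrC free_addrK spanned_bd.
Qed.

Lemma diag_carded n c : c \in supported (sized n) ->
  diag c \in supported (@carded T n.+1).
Proof. by move=> cn; apply: spanned_carded; exact: prism_sized. Qed.

Lemma diag_contained A c : c \in supported (among (label_in A)) ->
  diag c \in supported (contained A).
Proof.
by move=> cA; apply: spanned_contained; apply: prism_among cA.
Qed.

Lemma diag1 x : diag << [:: x] >> = << [set lab0 x; lab1 x] >>.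
Proof.
rewrite /diag prismU /= add0r coneU spannedU /= !joinU inE setU0 joinU inE.
case: eqP => // e; have := lab1P x; by rewrite -e lab0P eqxx.
Qed.

Lemma spanned_constant A (f : label -> T) c : constant A -> (forall x, f x \in A) ->
  spanned (lmap f c) \in supported (fun s => constant s).
Proof.
move=> Ac fA; apply: (@supported_sub _ (contained A)) => [s sA|].
  exact: constant_sub sA Ac.
apply: spanned_contained; apply: (lmap_among (A := xpredT)) => [x _|].
  exact: fA.
by apply/allP => l _; exact: all_predT.
Qed.

Lemma spanned_lab0_constant c :
  spanned (lmap lab0 c) \in supported (fun s => constant s).
Proof.
apply: (@spanned_constant [set v | eps v == 0]) => [|x].
  by apply/constant_onP => u v; rewrite !inE => /eqP -> /eqP ->.
by rewrite inE lab0P.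
Qed.

Lemma spanned_lab1_constant c :
  spanned (lmap lab1 c) \in supported (fun s => constant s).
Proof.
apply: (@spanned_constant [set v | eps v != 0]) => [|x]; last by rewrite inE lab1P.
apply/constant_onP => u v; rewrite !inE.
by have [->|->] := F2P (eps u); have [->|->] := F2P (eps v).
Qed.

(** The quotient by the constant simplices, realized on the span of the others.
    *)
Definition rel_part : {additive fchain -> fchain} :=
  extend (fun s => if constant s then 0 else << s >>).

Lemma rel_partU s : rel_part << s >> = if constant s then 0 else << s >>.
Proof. exact: extendU. Qed.

Lemma coeff_rel_part s c : ~~ constant s -> coeff s (rel_part c) = coeff s c.
Proof.
move=> sc; elim/free_ind: c => [|t c IH]; first by rewrite raddf0.
rewrite raddfD !coeffD IH rel_partU; congr (_ + _); case: ifP => // tc.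
rewrite coeff0 coeffU; case: eqP => [ts|_]; last by rewrite mulr0.
by rewrite -ts tc in sc.
Qed.

Lemma rel_part_constant c : c \in supported (fun s => constant s) -> rel_part c = 0.
Proof.
move: c; apply: supported_ind => [|s c sc IH]; first by rewrite raddf0.
by rewrite raddfD IH addr0 rel_partU sc.
Qed.

Lemma rel_part_id c : c \in supported (fun s => ~~ constant s) -> rel_part c = c.
Proof.
move: c; apply: supported_ind => [|s c sc IH]; first by rewrite raddf0.
by rewrite raddfD IH rel_partU (negbTE sc).
Qed.

Lemma rel_part_supported (P P' : pred {set T}) c :
  (forall s, P s -> ~~ constant s -> P' s) ->
  c \in supported P -> rel_part c \in supported P'.
Proof.
move=> PP'; apply: extend_supported => s sP; case: ifPn => sc.
  exact: rpred0.
by apply: supportedU; exact: PP'.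
Qed.

(** Faces of constant simplices are constant. *)
Lemma rel_part_bd c : rel_part (fbd (rel_part c)) = rel_part (fbd c).
Proof.
elim/free_ind: c => [|s c IH]; first by rewrite !raddf0.
rewrite !raddfD {}IH; congr (_ + _); rewrite rel_partU; case: ifP => // sc.
rewrite !raddf0; apply/esym/rel_part_constant.
apply: (@supported_sub _ (contained s)); last exact: fbdU_contained.
by move=> t ts; exact: constant_sub ts sc.
Qed.

Lemma rel_part_diag_bd c : rel_part (fbd (rel_part (diag c))) = rel_part (diag (lbd c)).
Proof.
rewrite rel_part_bd diag_bd !raddfD.
rewrite (rel_part_constant (spanned_lab0_constant c)).
by rewrite (rel_part_constant (spanned_lab1_constant c)) !addr0.
Qed.

(** With at least three vertices, some vertex can be removed while keeping one
    of each kind, and the facet opposite to it occurs exactly once. *)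
Lemma rel_part_fbd_neq0 s : ~~ constant s -> (2 < #|s|)%N ->
  rel_part (fbd << s >>) != 0.
Proof.
move=> /nonconstantP[u [v [us vs u0 v0]]] s2.
have uv : u != v by apply: contraNneq v0 => <-; rewrite u0.
have /card_gt0P[w] : (0 < #|s :\: [set u; v]|)%N.
  have uvs : [set u; v] \subset s by rewrite subUset !sub1set us.
  by rewrite cardsDS // subn_gt0 cards2 uv.
rewrite !inE negb_or => /andP[/andP[wu wv] ws].
have sw : ~~ constant (s :\ w).
  apply/nonconstantP; exists u, v.
  by rewrite !inE us vs u0 v0 eq_sym wu eq_sym wv.
apply/eqP => /(congr1 (coeff (s :\ w))).
rewrite fbdU raddf_sum raddf_sum (bigD1 w) //= big1 => [|x /andP[xs xw]].
  by rewrite rel_partU (negbTE sw) coeffU eqxx mulr1 addr0 coeff0.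
rewrite rel_partU; case: ifP => _; first by rewrite coeff0.
rewrite coeffU; case: eqP => [|_]; last exact: mulr0.
by move=> /setP/(_ w); rewrite !inE ws eqxx eq_sym xw.
Qed.

(** ** The cells as chains of points *)

Section Filling.
Variables (W : choiceType) (b : {set T} -> W).

(** The empty list comes from the single vertices with eps = 0 only. As an edge
    joining the two kinds has exactly one such end, this is the right
    augmentation: the filling of its boundary is the empty list, whose cone is
    the point of the cell. *)
Definition fill_constant s : lchains W :=
  if [exists v, (s == [set v]) && (eps v == 0)] then << [::] >> else 0.

Fixpoint fill_rec (n : nat) s : lchains W :=
  if constant s then fill_constant s
  else if n is n'.+1 then cone (b s) (extend (fill_rec n') (fbd << s >>))
  else 0.

Definition fill : {additive fchain -> lchains W} :=
  extend (fun s => fill_rec #|s| s).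

Lemma fillU_constant s : constant s -> fill << s >> = fill_constant s.
Proof. by move=> sc; rewrite extendU; case: #|s| => [|n] /=; rewrite sc. Qed.

Lemma fill1 v : fill << [set v] >> = if eps v == 0 then << [::] >> else 0.
Proof.
rewrite fillU_constant ?constant1 // /fill_constant.
congr (if _ then _ else _); apply/existsP/idP => [[u /andP[/eqP/set1_inj -> //]]|v0].
by exists v; rewrite eqxx.
Qed.

Lemma fill_big_constant s : constant s -> #|s| != 1%N -> fill << s >> = 0.
Proof.
move=> sc s1; rewrite fillU_constant // /fill_constant; case: existsP => // -[v].
by case/andP=> /eqP sv _; rewrite sv cards1 in s1.
Qed.

Lemma fillU s : ~~ constant s -> fill << s >> = cone (b s) (fill (fbd << s >>)).
Proof.
move=> sc; rewrite [LHS]extendU; have := nonconstant_card sc.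
case sn : #|s| => [//|n] _ /=; rewrite (negbTE sc); congr (cone _ _).
have := fbdU_carded sn; move: (fbd _); apply: supported_ind.
  by rewrite !raddf0.
by move=> t c /eqP tn IH; rewrite !raddfD IH extendU -tn; congr (_ + _); rewrite [RHS]extendU.
Qed.

Lemma fill_rel_part n c : c \in supported (@carded T n.+2) ->
  fill (rel_part c) = fill c.
Proof.
move: c; apply: supported_ind => [|s c /eqP sn IH]; first by rewrite !raddf0.
rewrite !raddfD IH rel_partU; case: ifP => // sc.
by rewrite raddf0 fill_big_constant ?sn.
Qed.

(** Facets of constant simplices are killed, except when they are single
    vertices; then the simplex is an edge and its two ends have equal fillings.
    *)
Lemma fill_constant_bd s : constant s -> fill (fbd << s >>) = 0.
Proof.
move=> sc; rewrite fbdU raddf_sum.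
have sub v : constant (s :\ v) by apply: constant_sub sc; exact: subsetDl.
have [s2|s2] := eqVneq #|s| 2%N; last first.
  rewrite big1 // => v vs; apply: fill_big_constant; first exact: sub.
  by apply: contra s2; rewrite (cardsD1 v s) vs => /eqP ->.
have /cards2P[u [v [uv sE]]] : #|s| == 2%N by rewrite s2.
have evu : eps v = eps u.
  by have /constant_onP := sc; apply; rewrite sE !inE eqxx ?orbT.
rewrite sE big_setU1 ?inE //= big_set1 setU1K ?inE //.
have -> : [set u; v] :\ v = [set u] by rewrite setUC setU1K // inE eq_sym.
by rewrite !fill1 evu free_addxx.
Qed.

(** For a nonconstant simplex the boundary of the cone is the filling of the
    boundary plus the cone on the filling of its second boundary. *)
Lemma fill_bd c : lbd (fill c) = fill (fbd c).
Proof.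
elim/free_ind: c => [|s c IH]; first by rewrite !raddf0.
rewrite !raddfD {}IH; congr (_ + _).
elim: {s}#|s| {-2}s (leqnn #|s|) => [|n IH] s sn.
  have sc : constant s.
    apply: contraT => /nonconstant_card; move: sn; rewrite leqn0 => /eqP ->.
    by [].
  rewrite fill_constant_bd // fillU_constant // /fill_constant.
  by case: ifP; rewrite ?raddf0 // lbdU.
have [sc|sc] := boolP (constant s).
  rewrite fill_constant_bd // fillU_constant // /fill_constant.
  by case: ifP; rewrite ?raddf0 // lbdU.
rewrite fillU // lbd_cone.
suff -> : lbd (fill (fbd << s >>)) = fill (fbd (fbd << s >>)).
  by rewrite fbdK !raddf0 addr0.
rewrite fbdU !raddf_sum; apply: eq_bigr => v vs; apply: IH.
by move: sn; rewrite (cardsD1 v s) vs.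
Qed.

Lemma fill_sized n c : c \in supported (@carded T n.+1) ->
  fill c \in supported (sized n).
Proof.
move: c; apply: supported_ind => [|s c /eqP sn IH]; first by rewrite raddf0 rpred0.
rewrite raddfD rpredD {c IH}//.
elim: n s sn => [|n IH] s sn; have [sc|sc] := boolP (constant s).
- by rewrite fillU_constant // /fill_constant; case: ifP => _; rewrite ?rpred0 ?supportedU.
- by have := nonconstant_card sc; rewrite sn.
- by rewrite fill_big_constant ?rpred0 ?sn.
rewrite fillU //; apply: cone_sized; rewrite fbdU raddf_sum rpred_sum // => v vs.
by apply: IH; move: sn; rewrite (cardsD1 v s) vs => -[].
Qed.

Lemma fill_among A (P : pred W) c :
  (forall t, t \subset A -> ~~ constant t -> P (b t)) ->
  c \in supported (contained A) -> fill c \in supported (among P).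
Proof.
move=> bP; move: c; apply: supported_ind => [|s c sA IH].
  by rewrite raddf0 rpred0.
rewrite raddfD rpredD {c IH}//.
elim: {s}#|s| {-2}s (leqnn #|s|) sA => [|n IH] s sn sA.
all: have [sc|sc] := boolP (constant s).
- by rewrite fillU_constant // /fill_constant; case: ifP => _; rewrite ?rpred0 ?supportedU.
- by have := nonconstant_card sc; case: #|s| sn.
- by rewrite fillU_constant // /fill_constant; case: ifP => _; rewrite ?rpred0 ?supportedU.
rewrite fillU //; apply: cone_among; first exact: bP.
rewrite fbdU raddf_sum rpred_sum // => v vs; apply: IH.
  by move: sn; rewrite (cardsD1 v s) vs.
exact: fintype.subset_trans (subsetDl _ _) sA.
Qed.

Variables (mid : label -> W) (w0 : W).

(** Corrects the augmentation: [diag] kills the empty list, while the map to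
    which it is compared fixes it. *)
Definition empty_part :
    {additive labchain -> lchains W} :=
  extend (fun l => if l is [::] then << [::] >> else 0).

Definition fill_diag : {additive labchain -> lchains W} :=
  extend (fun l => fill (diag << l >>) + empty_part << l >>).

Lemma fill_diagE c : fill_diag c = fill (diag c) + empty_part c.
Proof.
elim/free_ind: c => [|l c IH]; first by rewrite !raddf0 addr0.
by rewrite !raddfD IH extendU [RHS]addrACA.
Qed.

Lemma empty_part_sized n c : c \in supported (sized n.+1) -> empty_part c = 0.
Proof.
move: c; apply: supported_ind => [|[|x l] c // _ IH]; first by rewrite raddf0.
by rewrite raddfD IH addr0 extendU.
Qed.

Lemma fill_spanned_labels l :
  fill (spanned << map lab0 l >>) + fill (spanned << map lab1 l >>) =
  empty_part (list_bd l).
Proof.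
case: l => [|x [|y l]].
- by rewrite free_addxx raddf0.
- rewrite !spannedU /= !joinU !inE /= !setU0 !fill1 lab0P eqxx.
  by rewrite (negbTE (lab1P x)) !addr0 raddf0 addr0 extendU.
have big (f : label -> T) :
    (forall c, spanned (lmap f c) \in supported (fun s => constant s)) ->
    fill (spanned << [seq f i | i <- [:: x, y & l]] >>) = 0.
  move=> fc; have sc : spanned << [seq f i | i <- [:: x, y & l]] >> \in
      supported (@carded T (size l).+2).
    by apply: spanned_carded; apply: supportedU; rewrite /sized size_map.
  have := fc << [:: x, y & l] >>; rewrite lmapU => /(supported_and sc).
  move: (spanned _); apply: supported_ind => [|s c /andP[/eqP sn sk] IH].
    by rewrite raddf0.
  by rewrite raddfD IH addr0 fill_big_constant ?sn.
rewrite !big ?addr0; [|exact: spanned_lab1_constant|exact: spanned_lab0_constant].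
by rewrite (@empty_part_sized (size l)) //; exact: (@list_bd_sized _ _ [:: x, y & l]).
Qed.

(** The end terms of the prism are filled by zero except for a list with a
    single entry, where they give the empty list and account for the correction
    term. *)
Lemma fill_diag_bd c : fill_diag (lbd c) = lbd (fill_diag c).
Proof.
elim/free_ind: c => [|l c IH]; first by rewrite !raddf0.
rewrite !raddfD IH; congr (_ + _); rewrite !fill_diagE raddfD fill_bd diag_bd.
have -> : lbd (empty_part << l >>) = 0.
  by rewrite extendU; case: l => [|x l]; rewrite ?lbdU ?raddf0.
rewrite addr0 !raddfD !lmapU; congr (_ + _).
by rewrite fill_spanned_labels lbdU.
Qed.

Lemma fill_diag_nil : fill_diag << [::] >> = << [::] >>.
Proof. by rewrite extendU extendU /diag prismU /= !raddf0 add0r. Qed.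

Lemma fill_diag_sized n c : c \in supported (sized n) ->
  fill_diag c \in supported (sized n).
Proof.
move=> cn; rewrite fill_diagE rpredD ?fill_sized ?diag_carded //.
by move: cn; apply: extend_supported => -[|x l] ln; rewrite ?rpred0 ?supportedU.
Qed.

Lemma fill_diag_among A (P : pred W) c :
  (forall t, t \subset A -> ~~ constant t -> P (b t)) ->
  c \in supported (among (label_in A)) -> fill_diag c \in supported (among P).
Proof.
move=> bP cA; rewrite fill_diagE rpredD //.
  by apply: fill_among bP _; exact: diag_contained.
by move: cA; apply: extend_supported => -[|x l] ln; rewrite ?rpred0 ?supportedU.
Qed.

(** Both maps send the simplex with given labels to chains in one convex cell,
    so coning from the midpoint of the first label connects them there. *)
Definition fill_homotopy n :=
  homotopy (lmap mid) fill_diag (fun l => head w0 (map mid l)) n.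

Lemma fill_homotopyP n c : c \in supported (sized n) ->
  lbd (fill_homotopy n c) + fill_homotopy n.-1 (lbd c) =
  lmap mid c + fill_diag c.
Proof.
apply: homotopyP => [c'|c'|]; [exact: lmap_bd|exact: fill_diag_bd|].
by rewrite lmapU fill_diag_nil.
Qed.

Lemma fill_homotopy_sized n c : c \in supported (sized n) ->
  fill_homotopy n c \in supported (sized n.+1).
Proof.
by apply: homotopy_sized => n' c'; [exact: lmap_sized|exact: fill_diag_sized].
Qed.

Lemma fill_homotopy_among A (P : pred W) n c :
  (forall t, t \subset A -> ~~ constant t -> P (b t)) ->
  (forall x, label_in A x -> P (mid x)) ->
  c \in supported (sized n) -> c \in supported (among (label_in A)) ->
  fill_homotopy n c \in supported (among P).
Proof.
move=> bP mP; apply: homotopy_among => [c'|c'|[//|x l] _ /andP[xA _]].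
- exact: lmap_among.
- exact: fill_diag_among.
- exact: mP.
Qed.
End Filling.
End Hypersurface.

(** * Subdivision of singular chains *)

Section SingularSubdivision.
Variables (R : realType) (E : topologicalType).

Definition sing_sd m p : {additive sing_chain R E p -> sing_chain R E p} :=
  @sing_op R E p p (sdm m).

Definition sing_sd_homotopy m p :
    {additive sing_chain R E p -> sing_chain R E p.+1} :=
  @sing_op R E p p.+1 (sd_homotopy m p.+1).

Lemma vertices_sized p :
  (<< vertices R p >> : {freeg _ / 'F_2}) \in supported (sized p.+1).
Proof. by apply: supportedU; rewrite /sized size_vertices. Qed.

Lemma vertices_among p :
  (<< vertices R p >> : {freeg _ / 'F_2}) \in supported (among in_simplex).
Proof. by apply: supportedU; exact: vertices_in_simplex. Qed.

Lemma in_simplex_bary_closed p : bary_closed (@in_simplex R p).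
Proof. by apply: aff_bary_closed; exact: in_simplex_aff_closed. Qed.

Lemma coface_row_bary p (i : 'I_p.+2) (l : seq 'rV[R]_p.+1) :
  coface_row i (bary l) = bary (map (coface_row i) l).
Proof. exact/bary_map/coface_row_linear. Qed.

Lemma sing_sd_bd m p c :
  sing_sd m p (sing_bd p c) = sing_bd p (sing_sd m p.+1 c).
Proof.
elim/free_ind: c => [|s c IH]; first by rewrite !raddf0.
rewrite !raddfD IH; congr (_ + _).
rewrite /sing_sd (sing_op_bd (N' := sdm m)) => [|i c'||].
- rewrite sing_opU real_bd ?sdm_bd //.
  by apply: sdm_sized; exact: vertices_sized.
- by rewrite (sdm_nat (coface_row_bary i)).
- by apply: sdm_sized; exact: vertices_sized.
- by apply: sdm_among; [exact: in_simplex_bary_closed|exact: vertices_among].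
Qed.

(** On the standard simplex the homotopy formula has an extra term coming from
    the boundary; it is left in this form because in degree zero it vanishes
    and in positive degrees it is the operator of the faces. *)
Lemma sing_sd_homotopyU m p (s : sing R E p) :
  sing_bd p (sing_sd_homotopy m p << s >>) +
    real p (frame s) (sd_homotopy m p (lbd << vertices R p >>)) =
  << s >> + sing_sd m p << s >>.
Proof.
rewrite !sing_opU real_bd; last first.
  by apply: sd_homotopy_sized; exact: vertices_sized.
by rewrite -raddfD sd_homotopyP ?vertices_sized // raddfD real_frame.
Qed.

Lemma sd_homotopy_among m n (W : lmodType R) (A : pred W) c :
  bary_closed A -> c \in supported (sized n) -> c \in supported (among A) ->
  sd_homotopy m n c \in supported (among A).
Proof.
move=> Ab; by apply: homotopy_among => // c'; exact: sdm_among.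
Qed.

Lemma sing_sd_homotopyP m p c :
  sing_bd p.+1 (sing_sd_homotopy m p.+1 c) + sing_sd_homotopy m p (sing_bd p c)
  = c + sing_sd m p.+1 c.
Proof.
elim/free_ind: c => [|s c IH]; first by rewrite !raddf0 addr0.
rewrite !raddfD addrACA IH [RHS]addrACA; congr (_ + _).
rewrite -sing_sd_homotopyU; congr (_ + _).
rewrite /sing_sd_homotopy (sing_op_bd (N' := sd_homotopy m p.+1)) //.
- by move=> i c'; rewrite (sd_homotopy_nat (coface_row_bary i)).
- by apply: sd_homotopy_sized; exact: vertices_sized.
- apply: sd_homotopy_among; [exact: in_simplex_bary_closed|
    exact: vertices_sized|exact: vertices_among].
Qed.

Lemma sing_sd_homotopy0P m c :
  sing_bd 0 (sing_sd_homotopy m 0 c) = c + sing_sd m 0 c.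
Proof.
elim/free_ind: c => [|s c IH]; first by rewrite !raddf0 addr0.
rewrite !raddfD IH [RHS]addrACA; congr (_ + _).
by rewrite -sing_sd_homotopyU /sd_homotopy homotopy0 raddf0 addr0.
Qed.

End SingularSubdivision.

Arguments sing_sd {R E} m p.
Arguments sing_sd_homotopy {R E} m p.

(** * Straightening of singular chains *)

Section Straightening.
Variables (R : realType) (T : finType).
Local Notation E := {ptws T -> R}.
Variable (L : choiceType) (mid : L -> E) (lab : E -> L).

(** The topology of pointwise convergence is the initial one for the
    coordinates. *)
Lemma continuous_ptws (X : topologicalType) (f : X -> E) :
  (forall v, continuous (fun x => f x v)) -> continuous f.
Proof.
move=> fc x; apply/cvg_sup => v U [V [[W oW <-] /= Wfv WU]].
apply: (filterS WU); apply: (fc v x).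
exact: open_nbhs_nbhs.
Qed.

Lemma continuous_coord v : continuous (fun x : E => x v).
Proof. exact: (@proj_continuous T (fun=> R) v). Qed.

Lemma linear_aff_cont p (l : seq E) :
  continuous (fun z : @stdsimplex R p => aff l z : E).
Proof.
apply: continuous_ptws => v.
have -> : (fun z : @stdsimplex R p => aff l z v) =
    fun z => \sum_(i < p.+1) set_val z ord0 i * nth 0 l i v.
  by apply/funext => z; rewrite /aff fct_sumE.
by apply: continuous_sum => i; apply: continuous_mulr; exact: continuous_set_val.
Qed.

Definition idmap : swmap ({ptws T -> R} : lmodType R) E := 
  @SwMap R ({ptws T -> R} : lmodType R) E (fun x => x) linear_aff_cont.

Local Notation cyl p := ('rV[R]_p.+1 * R^o)%type.

Definition sing_points p (s : sing R E p) : seq E :=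
  map (frame s) (vertices R p).

(** The straight-line homotopy from the simplex to the affine one through the
    points that [mid] attaches to the labels of its vertices. *)
Definition straight_fun p (s : sing R E p) (xt : cyl p) : E :=
  (1 - xt.2) *: frame s xt.1 +
  xt.2 *: \sum_(j < p.+1) xt.1 ord0 j *: nth 0 (map (mid \o lab) (sing_points s)) j.

Lemma aff_pair p q (l : seq (cyl p)) (z : @stdsimplex R q) :
  aff l z = (aff (map fst l) z, aff (map snd l) z).
Proof.
rewrite /aff; have : forall n, (nth 0 l n).1 = nth 0 (map fst l) n.
  by elim: l => [|x l IH] [|n] //=.
have : forall n, (nth 0 l n).2 = nth 0 (map snd l) n.
  by elim: l => [|x l IH] [|n] //=.
move=> h2 h1; elim/big_ind3: _ => //= [x1 x2 x3 y1 y2 y3 -> ->|] //.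
by move=> i _; rewrite -h1 -h2.
Qed.

Lemma continuous_interpolation (X : topologicalType) (t f g : X -> R) :
  continuous t -> continuous f -> continuous g ->
  continuous (fun x => (1 - t x) * f x + t x * g x).
Proof.
move=> tc fc gc x; apply: cvgD; apply: cvgM; [|exact: fc|exact: tc|exact: gc].
by apply: cvgB; [exact: cvg_cst|exact: tc].
Qed.

Lemma straight_cont p (s : sing R E p) q (l : seq (cyl p)) :
  continuous (fun z : @stdsimplex R q => straight_fun s (aff l z)).
Proof.
have c1 : continuous (fun z : @stdsimplex R q => frame s (aff l z).1).
  have -> : (fun z : @stdsimplex R q => frame s (aff l z).1) =
      (fun z => frame s (aff (map fst l) z)).
    by apply/funext => z; rewrite aff_pair.
  exact: sw_cont.
have c2 : continuous (fun z : @stdsimplex R q => (aff l z).2).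
  have -> : (fun z : @stdsimplex R q => (aff l z).2) =
      (fun z => \sum_(i < q.+1) set_val z ord0 i * nth 0 (map snd l) i).
    by apply/funext => z; rewrite aff_pair.
  apply: continuous_sum => i; apply: continuous_mulr.
  exact: continuous_set_val.
have c3 j : continuous (fun z : @stdsimplex R q => (aff l z).1 ord0 j).
  have -> : (fun z : @stdsimplex R q => (aff l z).1 ord0 j) =
      (fun z => aff (map fst l) z ord0 j).
    by apply/funext => z; rewrite aff_pair.
  exact: continuous_aff_coord.
apply: continuous_ptws => v; pose m := map (mid \o lab) (sing_points s).
have -> : (fun z : @stdsimplex R q => straight_fun s (aff l z) v) =
    (fun z => (1 - (aff l z).2) * frame s (aff l z).1 v +
      (aff l z).2 * \sum_(j < p.+1) (aff l z).1 ord0 j * nth 0 m j v).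
  by apply/funext => z; congr (_ + _ * _); rewrite fct_sumE.
apply: continuous_interpolation => //.
  move=> z; apply: (@continuous_comp _ _ _
    (fun z : @stdsimplex R q => frame s (aff l z).1) (fun x : E => x v)).
    exact: c1.
  exact: continuous_coord.
by apply: continuous_sum => i; apply: continuous_mulr.
Qed.

Definition straight p (s : sing R E p) : swmap (cyl p : lmodType R) E :=
  @SwMap R (cyl p : lmodType R) E (straight_fun s)
    (@straight_cont p s).

Definition base p (x : 'rV[R]_p.+1) : cyl p := (x, 0).
Definition top p (x : 'rV[R]_p.+1) : cyl p := (x, 1).

(** Carried by the prism over the standard simplex; the apices on the base make
    it natural. *)
Definition cyl_homotopy p n := homotopy (lmap (@base p)) (lmap (@top p))
  (fun l => base (bary l)) n.

Definition in_cyl p : pred (cyl p) := fun xt =>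
  [&& in_simplex xt.1, 0 <= xt.2 & xt.2 <= 1].

Definition sing_labels p :
    {additive sing_chain R E p -> lchains L} :=
  extend (fun s : sing R E p => << map lab (sing_points s) >>).

Lemma sing_labelsU p (s : sing R E p) :
  sing_labels p << s >> = << map lab (sing_points s) >>.
Proof. exact: extendU. Qed.

Lemma sing_labels_sized p (c : sing_chain R E p) :
  sing_labels p c \in supported (sized p.+1).
Proof.
have : c \in supported xpredT by apply/allP.
apply: extend_supported => s _; apply: supportedU.
by rewrite /sized size_map size_map size_vertices.
Qed.

Lemma sing_labels_bd p (c : sing_chain R E p.+1) :
  lbd (sing_labels p.+1 c) = sing_labels p (sing_bd p c).
Proof.
elim/free_ind: c => [|s c IH]; first by rewrite !raddf0.
rewrite !raddfD IH; congr (_ + _).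
rewrite sing_labelsU lbdU -map_comp -lmap_list_bd list_bdE size_vertices.
rewrite sing_bdU !raddf_sum; apply: eq_bigr => i _.
rewrite lmapU sing_labelsU delete_vertices; congr << _ >>.
rewrite -[LHS]map_comp /sing_points -[RHS]map_comp.
apply/eq_in_map => x xv; have xs := allP (vertices_in_simplex R p) x xv.
by rewrite -[LHS]/(lab (frame s (coface_row i x))) -frame_face.
Qed.

(** The affine simplex through the points attached to the labels of the
    vertices; the first of two steps from a singular chain to a filling. *)
Definition straighten p (c : sing_chain R E p) : sing_chain R E p :=
  real p idmap (lmap mid (sing_labels p c)).

Definition straighten_homotopy p : {additive sing_chain R E p -> sing_chain R E p.+1} :=
  extend (fun s => real p.+1 (straight s) (cyl_homotopy p p.+1 << vertices R p >>)).

Lemma straighten_homotopyU p (s : sing R E p) : straighten_homotopy p << s >> =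
  real p.+1 (straight s) (cyl_homotopy p p.+1 << vertices R p >>).
Proof. exact: extendU. Qed.

Lemma cyl_homotopy_sized p n c : c \in supported (sized n) ->
  cyl_homotopy p n c \in supported (sized n.+1).
Proof. by apply: homotopy_sized => n' c'; exact: lmap_sized. Qed.

Lemma cyl_homotopyP p n c : c \in supported (sized n) ->
  lbd (cyl_homotopy p n c) + cyl_homotopy p n.-1 (lbd c) =
  lmap (@base p) c + lmap (@top p) c.
Proof.
by apply: homotopyP => [c'|c'|]; rewrite ?lmap_bd // !lmapU.
Qed.

Lemma cyl_homotopy_among p n c : c \in supported (sized n) ->
  c \in supported (among in_simplex) ->
  cyl_homotopy p n c \in supported (among (@in_cyl p)).
Proof.
apply: homotopy_among => [c'|c'|l l0 lA].
- by apply: lmap_among => x xs; rewrite /in_cyl /= xs lexx ler01.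
- by apply: lmap_among => x xs; rewrite /in_cyl /= xs lexx ler01.
- by rewrite /in_cyl /= lexx ler01 in_simplex_bary_closed.
Qed.

Lemma in_cyl_aff_closed p : aff_closed (@in_cyl p).
Proof.
move=> q l z ln /allP lA; rewrite aff_pair /in_cyl /=; apply/and3P; split.
- apply: in_simplex_aff_closed; first by rewrite size_map.
  by apply/allP => _ /mapP[x /lA/and3P[] ? _ _ ->].
- rewrite sumr_ge0 // => j _; rewrite mulr_ge0 ?stdsimplex_ge0 //.
  rewrite (nth_map 0) ?ln //.
  by have /lA/and3P[] : nth 0 l j \in l by rewrite mem_nth // ln.
- rewrite -[leRHS](stdsimplex_sum z); apply: ler_sum => j _.
  rewrite ler_piMr ?stdsimplex_ge0 // (nth_map 0) ?ln //.
  by have /lA/and3P[] : nth 0 l j \in l by rewrite mem_nth // ln.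
Qed.

Lemma straight_base p (s : sing R E p) :
  real p (straight s) (lmap (@base p) << vertices R p >>) = << s >>.
Proof.
rewrite lmapU realU; congr << _ >>; apply/continuousEP => z.
rewrite -[LHS]/(straight_fun s (aff (map (@base p) (vertices R p)) z)) aff_pair.
have -> : map fst (map (@base p) (vertices R p)) = vertices R p.
  by rewrite -map_comp map_id.
rewrite aff_vertices /straight_fun /=.
have -> : aff (map snd (map (@base p) (vertices R p))) z = 0 :> R^o.
  rewrite /aff big1 // => j _.
  by rewrite -map_comp (nth_map 0 0 (snd \o _)) ?size_vertices //; exact: mulr0.
by rewrite subr0 scale1r scale0r addr0 retract_val.
Qed.

Lemma straight_top p (s : sing R E p) :
  real p (straight s) (lmap (@top p) << vertices R p >>) = straighten << s >>.
Proof.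
rewrite /straighten sing_labelsU !lmapU !realU; congr << _ >>.
apply/continuousEP => z.
rewrite -[LHS]/(straight_fun s (aff (map (@top p) (vertices R p)) z)) aff_pair.
have -> : map fst (map (@top p) (vertices R p)) = vertices R p.
  by rewrite -map_comp map_id.
rewrite aff_vertices /straight_fun /=.
have -> : aff (map snd (map (@top p) (vertices R p))) z = 1 :> R^o.
  rewrite -[RHS](stdsimplex_sum z); apply: eq_bigr => j _.
  by rewrite -map_comp (nth_map 0 0 (snd \o _)) ?size_vertices //; exact: mulr1.
by rewrite subrr scale0r scale1r add0r map_comp.
Qed.

Lemma straighten_homotopyE p (s : sing R E p) :
  sing_bd p (straighten_homotopy p << s >>) +
  real p (straight s) (cyl_homotopy p p (lbd << vertices R p >>)) =
  << s >> + straighten << s >>.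
Proof.
rewrite straighten_homotopyU real_bd; last first.
  by apply: cyl_homotopy_sized; exact: vertices_sized.
rewrite -raddfD cyl_homotopyP ?vertices_sized // raddfD.
by rewrite straight_base straight_top.
Qed.
Lemma sing_points_sface p (i : 'I_p.+2) (s : sing R E p.+1) :
  sing_points (sface i s) = delete_nth i (sing_points s).
Proof.
rewrite /sing_points /delete_nth -map_take -map_drop -map_cat.
rewrite -/(delete_nth i (vertices R p.+1)) delete_vertices -[RHS]map_comp.
apply/eq_in_map => x xv; have xs := allP (vertices_in_simplex R p) x xv.
by rewrite frame_face.
Qed.

Lemma straight_sface p (i : 'I_p.+2) (s : sing R E p.+1) (xt : cyl p) :
  in_cyl xt ->
  straight (sface i s) xt = straight s (coface_row i xt.1, xt.2).
Proof.
move=> /and3P[xs _ _]; rewrite /= /straight_fun frame_face //=; congr (_ + _ *: _).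
rewrite [RHS](bigD1_ord i) //= mxE unlift_none scale0r add0r.
have iv : (i < size (sing_points s))%N by rewrite size_map size_vertices.
apply: eq_bigr => k _; rewrite mxE liftK /= sing_points_sface; congr (_ *: _).
rewrite /delete_nth map_cat map_take map_drop -/(delete_nth i (map _ _)).
by rewrite nth_delete // size_map.
Qed.

(** The prism over a face is the face of the prism. *)
Lemma straighten_homotopyP p (c : sing_chain R E p.+1) :
  sing_bd p.+1 (straighten_homotopy p.+1 c) + straighten_homotopy p (sing_bd p c)
  = c + straighten c.
Proof.
rewrite /straighten; elim/free_ind: c => [|s c IH]; first by rewrite !raddf0 addr0.
rewrite !raddfD addrACA IH [RHS]addrACA; congr (_ + _).
rewrite -[RHS]straighten_homotopyE sing_bdU raddf_sum; congr (_ + _).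
under eq_bigr do rewrite straighten_homotopyU.
apply: (@real_faces _ _ _ _ _ _ _ _ (fun i => straight (sface i s)) _
  (fun i xt => (coface_row i xt.1, xt.2)) (@in_cyl p)).
- move=> i a x y; rewrite /= coface_row_linear //.
- exact: in_cyl_aff_closed.
- move=> i c'; symmetry; apply: homotopy_nat => [d|d|l] //.
  + by rewrite !lmap_comp.
  + by rewrite !lmap_comp.
  + by rewrite /base /= coface_row_bary.
- by move=> i x xA; exact: straight_sface.
- by apply: cyl_homotopy_sized; exact: vertices_sized.
- by apply: cyl_homotopy_among; [exact: vertices_sized|exact: vertices_among].
Qed.

Lemma straighten_homotopy0P (c : sing_chain R E 0) :
  sing_bd 0 (straighten_homotopy 0 c) = c + straighten c.
Proof.
rewrite /straighten; elim/free_ind: c => [|s c IH]; first by rewrite !raddf0 addr0.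
rewrite !raddfD IH [RHS]addrACA; congr (_ + _).
by rewrite -[RHS]straighten_homotopyE /cyl_homotopy homotopy0 raddf0 addr0.
Qed.

End Straightening.

(** * Uniform continuity of singular simplices *)

Section AffineDistance.
Variables (R : realType) (W : normedModType R).

(** Balls are convex. *)
Lemma ball_aff_closed (c : W) (r : R) :
  aff_closed (fun x : (W : lmodType R) => `|c - x| <= r).
Proof.
move=> p l z ln /allP lr.
have -> : c - aff l z = \sum_(j < p.+1) set_val z ord0 j *: (c - nth 0 l j).
  under eq_bigr do rewrite scalerBr.
  by rewrite sumrB -scaler_suml stdsimplex_sum scale1r.
apply: le_trans (ler_norm_sum _ _ _) _.
rewrite -[r]mul1r -(stdsimplex_sum z) mulr_suml; apply: ler_sum => j _.
rewrite normrZ ger0_norm ?stdsimplex_ge0 // ler_wpM2l ?stdsimplex_ge0 //.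
by apply/lr/mem_nth; rewrite ln.
Qed.

Lemma narrow_aff d p (l : seq W) (z z' : @stdsimplex R p) : size l = p.+1 ->
  narrow d l -> `|(aff l z : W) - aff l z'| <= d.
Proof.
move=> ln /narrowP ld; apply: (@ball_aff_closed _ d p l z' ln).
apply/allP => y yl; rewrite distrC.
apply: (@ball_aff_closed _ d p l z ln); apply/allP => x xl.
exact: ld.
Qed.

Lemma narrow_ex (l : seq W) : exists d, narrow d l.
Proof.
exists (\sum_(x <- l) \sum_(y <- l) `|x - y|); apply/narrowP => x y xl yl.
rewrite (big_rem x) //= (big_rem y) //= -addrA lerDl addr_ge0 //.
  by apply: sumr_ge0 => *.
by apply: sumr_ge0 => *; apply: sumr_ge0.
Qed.
End AffineDistance.

Section Uniform.
Variables (R : realType) (T : finType).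
Local Notation E := {ptws T -> R}.

(** Uniform continuity over the unit cube, which is compact and contains the
    standard simplex; the covering is by halves of balls, as in the Lebesgue
    number lemma. *)
Lemma frame_uniform p (g : sing R E p) (e : R) : 0 < e ->
  exists2 d : R, 0 < d & forall x y : 'rV[R]_p.+1, in_simplex x ->
    `|x - y| < d -> forall v, `|frame g x v - frame g y v| < e.
Proof.
move=> e0.
have fc v : continuous (fun x => frame g x v).
  move=> x; apply: (@continuous_comp _ _ _ (frame g) (fun y : E => y v)).
    apply: (@continuous_comp _ _ _ (@retract R p) g); last exact: cts_fun.
    by apply: continuous_retract => j; exact: coord_continuous.
  exact: continuous_coord.
pose B : set 'rV[R]_p.+1 := [set x | forall i, `[0, 1]%classic (x ord0 i)].
have cB : compact B.
  apply: (@rV_compact R p.+1 (fun=> `[0, 1]%classic)) => i.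
  exact: segment_compact.
pose P (d : R) (x : 'rV[R]_p.+1) := forall y, `|x - y| < d ->
  forall v, `|frame g x v - frame g y v| < e.
have near_P : forall x, B x -> \forall x' \near x & d \near 0^'+, P d x'.
  move=> x _.
  have : \forall y \near x, forall v, `|frame g x v - frame g y v| < e / 2.
    apply: (@filter_forall _ T (fun v => [set y | `|frame g x v - frame g y v| < e / 2]) (nbhs x)).
    by move=> v; have /cvgrPdist_lt := fc v x; apply; rewrite divr_gt0.
  move=> /nbhs_ballP[r /= r0 rB].
  exists (ball x (r / 2), [set d | d < r / 2]) => /=.
    split; first by apply: nbhsx_ballx; rewrite divr_gt0.
    by apply: nbhs_right_lt; rewrite divr_gt0.
  move=> [x' d] /= [xx' dr] y yd v.
  have xx'r : `|x - x'| < r / 2 by move: xx'; rewrite -ball_normE.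
  have h1 : `|frame g x v - frame g x' v| < e / 2.
    by apply: rB; rewrite -ball_normE /=; lra.
  have h2 : `|frame g x v - frame g y v| < e / 2.
    apply: rB; rewrite -ball_normE /=.
    apply: le_lt_trans (ler_distD x' _ _) _; lra.
  apply: le_lt_trans (ler_distD (frame g x v) _ _) _.
  by rewrite distrC; lra.
have /compact_near_coveringP/(_ R 0^'+ P _ near_P) := cB.
move=> nP; near (0 : R)^'+ => d.
have dP : B `<=` P d by near: d.
have d0 : 0 < d by near: d; exact: nbhs_right_gt.
exists d => // x y xs xy v; apply: dP => // i /=.
move: xs; rewrite /in_simplex inE => -[x0 x1].
rewrite in_itv /= x0 -x1 (bigD1 i) //= lerDl sumr_ge0 //.
Unshelve. all: by end_near.
Qed.
End Uniform.

(** * Geometry of the cells *)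

Section Cells.
Import mathcomp.boot.finset.
Variables (R : realType) (T : finType) (eps : T -> 'F_2).
Local Notation E := {ptws T -> R}.
Local Notation lab_ := (label eps).
Local Notation cell s := (@midpoint_hull R T eps s).
Implicit Types (s t : {set T}) (x y : E) (K : {set {set T}}).

Definition supp x : {set T} := [set v | 0 < x v]%SET.

(** The equation of the hypersurface in the simplex on all vertices. *)
Definition balanced x : Prop :=
  [/\ forall v, 0 <= x v, \sum_v x v = 1 & \sum_(v | eps v == 0) x v = 2^-1].

Lemma cellP s x : cell s x <-> balanced x /\ supp x \subset s.
Proof.
rewrite midpoint_hullE; split=> [[[x0 x1 xs] xh]|[[x0 x1 xh] xs]].
  split=> //; apply/fintype.subsetP => v; rewrite inE; apply: contraTT => /xs ->.
  by rewrite ltxx.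
split=> //; split=> // v vs; apply/eqP; rewrite eq_le x0 andbT leNgt.
by apply: contra vs => vx; apply: (fintype.subsetP xs); rewrite inE.
Qed.

Definition region K : set E := \bigcup_(s in [set s | s \in K]%classic) cell s.

Lemma regionP K x : region K x <->
  balanced x /\ exists2 s, s \in K & supp x \subset s.
Proof.
split=> [[s sK /cellP[xb xs]]|[xb [s sK xs]]]; first by split=> //; exists s.
by exists s => //; apply/cellP.
Qed.

(** Both groups of coordinates have the positive sum 1/2. *)
Lemma supp_nonconstant x : balanced x -> ~~ constant_on eps (supp x).
Proof.
move=> [x0 x1 xh]; have xpos v : v \notin supp x -> x v = 0.
  by rewrite inE -leNgt => xv; apply/eqP; rewrite eq_le x0 xv.
have half0 : 2^-1 <> 0 :> R by apply/eqP; rewrite invr_eq0 pnatr_eq0.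
have xh' : \sum_(v | eps v != 0) x v = 2^-1.
  by move: x1; rewrite (bigID (fun v => eps v == 0)) /= xh; lra.
apply/nonconstantP.
have [u /andP[/eqP u0 us]] : exists u, (eps u == 0) && (u \in supp x).
  apply/existsP; apply: contraPT xh => /existsPn h.
  rewrite big1 => [/esym //|v v0]; apply: xpos.
  by have := h v; rewrite v0.
have [v /andP[v0 vs]] : exists v, (eps v != 0) && (v \in supp x).
  apply/existsP; apply: contraPT xh' => /existsPn h.
  rewrite big1 => [/esym //|v v0]; apply: xpos.
  by have := h v; rewrite v0.
by exists u, v.
Qed.

Lemma cell_convex s : @convex_set R ({ptws T -> R} : lmodType R) (cell s).
Proof.
move=> x y r /set_mem xs /set_mem ys; apply: mem_set => B BA.
have [Bc _] := BA; apply: set_mem; apply: Bc; apply: mem_set.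
  exact: (xs B BA).
exact: (ys B BA).
Qed.

Lemma cell_aff_closed s : aff_closed (fun x : ({ptws T -> R} : lmodType R) => `[< cell s x >]).
Proof.
move=> p l z ln /allP lA; apply/asboolP.
apply: (convex_sum (@cell_convex s)).
- exact: stdsimplex_ge0.
- exact: stdsimplex_sum.
- by move=> j _; apply/asboolP/lA/mem_nth; rewrite ln.
Qed.

Definition edge_mid (a : lab_) : E := @midpoint R T (lab0 a) (lab1 a).

Lemma edge_mid_cell s a : label_in s a -> cell s (edge_mid a).
Proof.
move=> /andP[a0 a1] B [_]; apply; exists (lab0 a), (lab1 a); split=> //.
by rewrite lab0P eq_sym lab1P.
Qed.

Lemma nonconstant_label s : ~~ constant_on eps s -> exists a : lab_, label_in s a.
Proof.
move=> /nonconstantP[u [v [us vs u0 v0]]].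
have uv : (eps (u, v).1 == 0) && (eps (u, v).2 != 0) by rewrite /= u0 eqxx.
by exists (Sub (u, v) uv); apply/andP.
Qed.

(** Any point of the cell can serve as a cone point, as degenerate singular
    simplices are harmless. *)
Definition cell_point s : E := xget (0 : E) (cell s).

Lemma cell_pointP s t : t \subset s -> ~~ constant_on eps t -> cell s (cell_point t).
Proof.
move=> ts /nonconstant_label[a aL].
have : cell t (cell_point t).
  by apply: xgetPex; exists (edge_mid a); exact: edge_mid_cell.
by move=> /cellP[b bt]; apply/cellP; split=> //; exact: fintype.subset_trans ts.
Qed.

(** Less than this in each of the at most #|T| coordinates of one kind would
    make them add up to less than 1/2. *)
Definition gap : R := (2 * #|T|.+1%:R)^-1.

Lemma gap_gt0 : 0 < gap.
Proof. by rewrite invr_gt0 mulr_gt0 // ltr0n. Qed.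

Lemma gap_pigeonhole x (P : pred T) : \sum_(v | P v) x v = 2^-1 ->
  exists2 v, P v & gap <= x v.
Proof.
move=> xh; have [v /andP[Pv xv]] : exists v, P v && (gap <= x v).
  apply/existsP; apply: contraPT xh => /existsPn h; apply/eqP.
  rewrite lt_eqF //; apply: (@le_lt_trans _ _ (\sum_(v : T) gap)).
    rewrite big_mkcond; apply: ler_sum => v _; have := h v.
    by case: (P v) => /=; rewrite ?(ltW gap_gt0) // -ltNge => /ltW.
  rewrite sumr_const -[ltLHS]mulr_natl /gap invfM mulrCA.
  rewrite -[ltRHS]mulr1 ltr_pM2l ?invr_gt0 // ltr_pdivrMr ?ltr0n // mul1r.
  by rewrite ltr_nat.
by exists v.
Qed.

Variable a0 : lab_.

(** The default value is taken only outside the hypersurface. *)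
Definition lab x : lab_ :=
  odflt a0 [pick a : lab_ | (gap <= x (lab0 a)) && (gap <= x (lab1 a))].

Lemma labP x : balanced x -> gap <= x (lab0 (lab x)) /\ gap <= x (lab1 (lab x)).
Proof.
move=> [_ x1 xh]; have xh' : \sum_(v | eps v != 0) x v = 2^-1.
  by move: x1; rewrite (bigID (fun v => eps v == 0)) /= xh; lra.
rewrite /lab; case: pickP => [a /andP[] //|no].
have [u u0 xu] := gap_pigeonhole xh; have [v v0 xv] := gap_pigeonhole xh'.
have uv : (eps (u, v).1 == 0) && (eps (u, v).2 != 0) by rewrite /= u0.
by have := no (Sub (u, v) uv); rewrite /lab0 /lab1 SubK /= xu xv.
Qed.

Lemma lab_near x y : balanced x -> (forall v, `|x v - y v| < gap) ->
  label_in (supp y) (lab x).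
Proof.
move=> /labP[x0 x1] xy.
have pos v : gap <= x v -> v \in supp y.
  move=> gx; rewrite inE; have := xy v; rewrite ltr_norml => /andP[_].
  by lra.
by rewrite /label_in !pos.
Qed.

Lemma lab_supp x : balanced x -> label_in (supp x) (lab x).
Proof. by move=> xb; apply: lab_near => // v; rewrite subrr normr0 gap_gt0. Qed.

Lemma label_inS s t a : s \subset t -> label_in s a -> @label_in T eps t a.
Proof.
by move=> /fintype.subsetP st /andP[/st a_ /st a_']; apply/andP.
Qed.

(** The labels of all points of the simplex belong to the support of each of
    its points. All labels then lie in a single simplex, and segments from
    points of the simplex to the cell of the labels never leave the closed
    cells that these points lie in. *)
Definition small p : pred (sing R E p) := fun g =>
  `[< forall z z', label_in (supp (g z')) (lab (g z)) >].

Lemma small_bd p c : c \in supported (@small p.+1) ->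
  sing_bd p c \in supported (@small p).
Proof.
rewrite -[sing_bd p c]/(free_lift _ c).
apply: free_lift_supported => g /asboolP gf; apply: rpred_sum => i _.
by apply: supportedU; apply/asboolP => z z'; exact: gf.
Qed.

Variables (K : {set {set T}}).

(** At each time the homotopy joins a point of the simplex to a point of the
    hull of midpoints of labels, and a cell containing the former contains the
    latter, as all labels are in its support. *)
Lemma straighten_homotopy_region p c :
  c \in sing_in_chain (region K) p -> c \in supported (@small p) ->
  straighten_homotopy edge_mid lab p c \in sing_in_chain (region K) p.+1.
Proof.
move=> cK cf; have := supported_and cK cf; apply: extend_supported.
move=> g /andP[/asboolP gK /asboolP gf].
apply: (real_in (A := @in_cyl R p)) => [l ln lA||].
- apply/asboolP => _ [z _ <-]; rewrite -[X in region K X]/(straight_fun _ _ g (aff l z)).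
  have /and3P[] := in_cyl_aff_closed z ln lA.
  move: (aff l z) => -[x r] /= xs r0 r1; rewrite /straight_fun /=.
  have [yb [t tK yt]] : balanced (g (retract x)) /\
      exists2 t, t \in K & supp (g (retract x)) \subset t.
    by apply/regionP; apply: gK; exists (retract x).
  exists t => //; apply: (convex_pair (@cell_convex t)) => //.
  + by rewrite subr_ge0.
  + by rewrite subrK.
  + by apply/cellP.
  + rewrite -(retract_id xs); apply: (convex_sum (@cell_convex t)).
    * exact: stdsimplex_ge0.
    * exact: stdsimplex_sum.
    * move=> j _; have js : (j < size (sing_points g))%N.
        by rewrite /sing_points size_map size_vertices.
      rewrite (nth_map 0) // /=; apply: edge_mid_cell; apply: label_inS yt _.
      rewrite /sing_points (nth_map 0 0 (frame g)) ?size_vertices //.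
      exact: gf.
- by apply: cyl_homotopy_sized; exact: vertices_sized.
- by apply: cyl_homotopy_among; [exact: vertices_sized|exact: vertices_among].
Qed.

Lemma small_labels p (g : sing R E p) : range g `<=` region K -> small g ->
  exists2 t, t \in K & all (@label_in T eps t) (map lab (sing_points g)).
Proof.
move=> gK /asboolP gf; pose z := @retract R p 0.
have [_ [t tK yt]] : balanced (g z) /\ exists2 t, t \in K & supp (g z) \subset t.
  by apply/regionP; apply: gK; exists z.
exists t => //; apply/allP => _ /mapP[_ /mapP[x _ ->] ->].
exact: label_inS yt (gf _ _).
Qed.

Lemma real_cell_region p t c : t \in K -> c \in supported (sized p.+1) ->
  c \in supported (among (fun x : ({ptws T -> R} : lmodType R) => `[< cell t x >])) ->
  real p (@idmap R T) c \in sing_in_chain (region K) p.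
Proof.
move=> tK; apply: real_in => l ln lA; apply/asboolP => _ [z _ <-].
exists t => //; apply/asboolP; exact: (cell_aff_closed z ln lA).
Qed.

Definition filling_homotopy p c : sing_chain R E p.+1 :=
  real p.+1 (@idmap R T)
    (fill_homotopy cell_point edge_mid (0 : E) p.+1 (sing_labels lab p c)).

Lemma filling_homotopy_region p c :
  c \in sing_in_chain (region K) p -> c \in supported (@small p) ->
  filling_homotopy c \in sing_in_chain (region K) p.+1.
Proof.
rewrite /filling_homotopy => cK cf; have := supported_and cK cf; move: c {cK cf}.
apply: supported_ind => [|g c /andP[/asboolP gK gf] IH]; first by rewrite !raddf0 rpred0.
rewrite !raddfD rpredD // sing_labelsU.
have [t tK gt] := small_labels gK gf.
have gs : (<< map lab (sing_points g) >> : {freeg _ / 'F_2}) \in supported (sized p.+1).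
  by rewrite -sing_labelsU; exact: sing_labels_sized.
apply: (real_cell_region tK); first exact: fill_homotopy_sized.
apply: (@fill_homotopy_among _ _ _ _ _ _ t) => //; last exact: supportedU.
- by move=> s st sc; apply/asboolP; exact: cell_pointP.
- by move=> a aL; apply/asboolP; exact: edge_mid_cell.
Qed.

Definition filling p : {additive {freeg {set T} / 'F_2} -> sing_chain R E p} :=
  extend (fun s => real p (@idmap R T) (fill eps cell_point << s >>)).

Lemma fillingE p d : filling p d = real p (@idmap R T) (fill eps cell_point d).
Proof.
elim/free_ind: d => [|s d IH]; first by rewrite !raddf0.
by rewrite !raddfD IH extendU.
Qed.

(** The chain of the labels, read modulo constant simplices: the comparison map
    from singular chains back to the cells. *)
Definition carrier p : {additive sing_chain R E p -> {freeg {set T} / 'F_2}} :=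
  extend (fun g => rel_part eps (diag << map lab (sing_points g) >>)).

Lemma carrierE p c : carrier p c = rel_part eps (diag (sing_labels lab p c)).
Proof.
elim/free_ind: c => [|g c IH]; first by rewrite !raddf0.
by rewrite !raddfD IH extendU sing_labelsU.
Qed.

Lemma carrier_bd p (c : sing_chain R E p.+1) :
  rel_part eps (fbd (carrier p.+1 c)) = carrier p (sing_bd p c).
Proof. by rewrite !carrierE rel_part_diag_bd sing_labels_bd. Qed.

Lemma carrier_carded p (c : sing_chain R E p) :
  carrier p c \in supported (@carded T p.+2).
Proof.
rewrite carrierE; apply: (rel_part_supported (P := @carded T p.+2)) => //.
by apply: diag_carded; exact: sing_labels_sized.
Qed.

Lemma carrier_nonconstant p (c : sing_chain R E p) :
  carrier p c \in supported (fun s => ~~ constant_on eps s).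
Proof.
by rewrite carrierE; apply: (rel_part_supported (P := xpredT)) => //; apply/allP.
Qed.

Definition nonconstant_closed (F : {set {set T}}) := forall s t,
  s \in F -> t \subset s -> ~~ constant_on eps t -> t \in F.

Hypothesis Kclosed : nonconstant_closed K.

(** The labels of a small simplex span a face of any simplex whose cell meets
    its range. *)
Lemma carrier_region p c :
  c \in sing_in_chain (region K) p -> c \in supported (@small p) ->
  carrier p c \in supported (fun s => s \in K).
Proof.
move=> cK cf; have := supported_and cK cf; move: c {cK cf}.
apply: supported_ind => [|g c /andP[/asboolP gK gf] IH]; first by rewrite raddf0 rpred0.
rewrite raddfD rpredD //.
have [t tK gt] := small_labels gK gf.
rewrite carrierE.
suff h : diag (sing_labels lab p << g >>) \in supported (contained t).
  by apply: rel_part_supported h => s st sc; exact: Kclosed tK st sc.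
by apply: diag_contained; rewrite sing_labelsU supportedU.
Qed.

Lemma filling_homotopyP p (c : sing_chain R E p.+1) :
  sing_bd p.+1 (filling_homotopy c) + filling_homotopy (sing_bd p c) =
  straighten edge_mid lab c + filling p.+1 (carrier _ c).
Proof.
have ls := sing_labels_sized lab c.
rewrite /filling_homotopy real_bd; last exact: fill_homotopy_sized.
rewrite -sing_labels_bd -raddfD fill_homotopyP // fill_diagE.
rewrite (empty_part_sized _ ls) addr0 raddfD; congr (_ + _).
by rewrite fillingE carrierE (@fill_rel_part _ _ _ _ p.+1) // diag_carded.
Qed.

Lemma filling_homotopy0P (c : sing_chain R E 0) :
  sing_bd 0 (filling_homotopy c) =
  straighten edge_mid lab c + filling 0 (carrier _ c).
Proof.
have ls := sing_labels_sized lab c.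
rewrite /filling_homotopy real_bd; last exact: fill_homotopy_sized.
have := fill_homotopyP cell_point edge_mid (0 : E) ls.
rewrite /fill_homotopy homotopy0 addr0 => ->; rewrite fill_diagE.
rewrite (empty_part_sized _ ls) addr0 raddfD; congr (_ + _).
by rewrite fillingE carrierE (@fill_rel_part _ _ _ _ 0) // diag_carded.
Qed.

(** ** Every chain of a region becomes small under subdivision *)

(** If the coordinates of two points differ by less than [gap], the labels of
    one are in the support of the other; uniform continuity provides this as
    soon as the mesh is small. *)
Lemma small_sd p (g : sing R E p) : range g `<=` region K ->
  exists m0, forall m, (m0 <= m)%N -> sing_sd m p << g >> \in supported (@small p).
Proof.
move=> gK; have [e e0 ge] := frame_uniform g gap_gt0.
have [d vd] := narrow_ex (vertices R p).
have [m0 hm] := mesh_small p d e0; exists m0 => m /hm md; rewrite sing_opU.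
have := sdm_narrow m (size_vertices R p) vd => cN.
have cs : sdm m << vertices R p >> \in supported (sized p.+1).
  by apply: sdm_sized; exact: vertices_sized.
have cA : sdm m << vertices R p >> \in supported (among in_simplex).
  by apply: sdm_among; [exact: in_simplex_bary_closed|exact: vertices_among].
have := supported_and (supported_and cs cA) cN.
apply: extend_supported => l /andP[/andP[/eqP ln lA] lN].
apply: supportedU; apply/asboolP => z z'; apply: lab_near => [|v].
  suff /regionP[] : region K (frame g (aff l z)) by [].
  by apply: gK; exists (retract (aff l z)).
apply: ge; first exact: (in_simplex_aff_closed z ln lA).
by apply: le_lt_trans md; exact: narrow_aff.
Qed.

Lemma small_sd_chain p c : c \in sing_in_chain (region K) p ->
  exists m0, forall m, (m0 <= m)%N -> sing_sd m p c \in supported (@small p).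
Proof.
move: c; apply: supported_ind => [|g c /asboolP gK [m1 IH]].
  by exists 0%N => m _; rewrite raddf0 rpred0.
have [m2 h] := small_sd gK; exists (maxn m1 m2) => m; rewrite geq_max => /andP[h1 h2].
by rewrite raddfD rpredD // ?h // IH.
Qed.

(** Subdivide, straighten along the labels, and connect the result to the
    filling of the chain of labels. *)
Definition total_homotopy m p (c : sing_chain R E p) : sing_chain R E p.+1 :=
  sing_sd_homotopy m p c + (straighten_homotopy edge_mid lab p (sing_sd m p c) +
    filling_homotopy (sing_sd m p c)).

Lemma total_homotopyP m p (c : sing_chain R E p.+1) :
  sing_bd p.+1 (total_homotopy m c) + total_homotopy m (sing_bd p c) =
  c + filling p.+1 (carrier _ (sing_sd m p.+1 c)).
Proof.
rewrite /total_homotopy !raddfD sing_sd_bd addrACA sing_sd_homotopyP.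
rewrite [X in _ + X]addrACA straighten_homotopyP filling_homotopyP.
by free_add.
Qed.

Lemma total_homotopy0P m (c : sing_chain R E 0) :
  sing_bd 0 (total_homotopy m c) = c + filling 0 (carrier _ (sing_sd m 0 c)).
Proof.
rewrite /total_homotopy !raddfD sing_sd_homotopy0P.
rewrite straighten_homotopy0P filling_homotopy0P.
by free_add.
Qed.

Lemma total_homotopy_region m p c : c \in sing_in_chain (region K) p ->
  sing_sd m p c \in supported (@small p) ->
  total_homotopy m c \in sing_in_chain (region K) p.+1.
Proof.
move=> cK cf; have sK : sing_sd m p c \in sing_in_chain (region K) p.
  exact: sing_op_in.
rewrite /total_homotopy !rpredD //; first exact: sing_op_in.
- exact: straighten_homotopy_region.
- exact: filling_homotopy_region.
Qed.

End Cells.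

Arguments carrier {R T eps} a0 p.
Arguments total_homotopy {R T eps} a0 m {p} c.

(** * Relative homology of skeleta *)

Section SkeletonHomology.
Import mathcomp.boot.finset.
Variables (R : realType) (T : finType) (eps : T -> 'F_2).
Local Notation E := {ptws T -> R}.
Local Notation cell s := (@midpoint_hull R T eps s).
Local Notation fill_ p := (@filling R T eps p).
Implicit Types (s t : {set T}) (F : {set {set T}}).

Definition top_cells F p : pred {set T} :=
  fun s => [&& s \in F, ~~ constant_on eps s & #|s| == p.+2].

Lemma filling_bd p d : d \in supported (@carded T p.+3) ->
  sing_bd p (fill_ p.+1 d) = fill_ p (fbd d).
Proof.
by move=> dc; rewrite !fillingE real_bd ?fill_bd // fill_sized.
Qed.

Lemma filling_in_cell p s d : d \in supported (@carded T p.+2) ->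
  d \in supported (contained s) -> fill_ p d \in sing_in_chain (cell s) p.
Proof.
rewrite fillingE => dc ds; pose A := fun x : ({ptws T -> R} : lmodType R) => `[< cell s x >].
apply: (@real_in _ _ _ _ _ A) => [l ln lA||]; last 2 first.
- exact: fill_sized.
- apply: fill_among ds => t ts tc; apply/asboolP; exact: cell_pointP.
apply/asboolP => _ [z _ <-]; apply/asboolP; exact: (cell_aff_closed z ln lA).
Qed.

Lemma filling_region F p d : d \in supported (@carded T p.+2) ->
  d \in supported (fun s => ~~ constant_on eps s ==> (s \in F)) ->
  fill_ p d \in sing_in_chain (region eps F) p.
Proof.
move=> dc dF; have := supported_and dc dF; move: d {dc dF}.
apply: supported_ind => [|s d /andP[/eqP sp sF] IH]; first by rewrite raddf0 rpred0.
rewrite raddfD rpredD //; have [sc|sc] := boolP (constant_on eps s).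
  by rewrite fillingE fill_big_constant ?sp // raddf0 rpred0.
have : fill_ p << s >> \in sing_in_chain (cell s) p.
  apply: filling_in_cell; apply: supportedU; first exact/eqP.
  exact: subxx.
apply: supported_sub => g /asboolP gs; apply/asboolP => x /gs xs.
by exists s => //; move: sF; rewrite sc.
Qed.

Lemma filling_cycle F F' p d : d \in supported (@carded T p.+2) ->
  d \in supported (fun s => ~~ constant_on eps s ==> (s \in F)) ->
  fbd d \in supported (fun s => ~~ constant_on eps s ==> (s \in F')) ->
  @is_rel_cycle (singular_chains R E) (singular_in R (region eps F))
    (singular_in R (region eps F')) p (fill_ p d).
Proof.
move=> dc dF bF; have fF := filling_region dc dF.
case: p dc fF => [|p] dc fF; first exact: fF.
apply/andP; split; first exact: fF.
suff : sing_bd p (fill_ p.+1 d) \in sing_in_chain (region eps F') p by [].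
by rewrite filling_bd //; apply: filling_region; first exact: fbd_carded.
Qed.

(** If no edge is nonconstant there are no labels to choose from, but then
    there are no cells either. *)
Lemma region_nonempty F p c : c \in sing_in_chain (region eps F) p ->
  c = 0 :> sing_chain R E p \/ inhabited (label eps).
Proof.
move=> cF; have [F0|/existsNP[x nx]] := pselect (forall x : E, ~ region eps F x).
  left; move: cF; apply: supported_pred0 => g.
  by apply/asboolPn => gF; apply: (F0 (g (centre R p))); apply: gF; exists (centre R p).
right; have [xb _] : balanced eps x /\ exists2 s, s \in F & supp x \subset s.
  by apply/regionP; exact: contrapT.
by have [a _] := nonconstant_label (supp_nonconstant xb).
Qed.

Variables K K' : {set {set T}}.
Hypothesis Kclosed : nonconstant_closed eps K.
Hypothesis K'closed : nonconstant_closed eps K'.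

(** The total homotopy changes the cycle into the filling of its carrier, up to
    a boundary in the large region and, as the boundary of the cycle is in the
    small one, a chain in the small region. *)
Lemma filling_surj p (z : sing_chain R E p) :
  @is_rel_cycle (singular_chains R E)
    (singular_in R (region eps K)) (singular_in R (region eps K')) p z ->
  exists d b a, [/\ d \in supported (top_cells K p),
    b \in sing_in_chain (region eps K) p.+1,
    a \in sing_in_chain (region eps K') p
    & z = fill_ p d + (sing_bd p b + a)].
Proof.
move=> zc; have zK : z \in sing_in_chain (region eps K) p.
  by case: p z zc => [|p] z // /andP[].
(* without labels there are no singular simplices, hence nothing to show *)
have [z0|[a0]] := region_nonempty zK.
  exists 0, 0, 0; split; rewrite ?rpred0 //.
  by rewrite z0 !raddf0 !addr0.
have [m hm] := small_sd_chain a0 zK.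
have zs := hm m (leqnn m).
have sK : sing_sd m p z \in sing_in_chain (region eps K) p by exact: sing_op_in.
exists (carrier a0 p (sing_sd m p z)), (total_homotopy a0 m z).
have dtop : carrier a0 p (sing_sd m p z) \in supported (top_cells K p).
  have h1 := carrier_region Kclosed sK zs.
  have h2 := carrier_nonconstant a0 (sing_sd m p z).
  have h3 := carrier_carded a0 (sing_sd m p z).
  exact: supported_and h1 (supported_and h2 h3).
have bK : total_homotopy a0 m z \in sing_in_chain (region eps K) p.+1.
  exact: total_homotopy_region.
case: p z zc zK zs sK dtop bK {hm} => [|p] z zc zK zs sK dtop bK.
  exists 0; split; rewrite ?rpred0 //.
  by rewrite total_homotopy0P addr0 [RHS]addrC free_addrK.
move: zc => /andP[_ zK'].
have zs' : sing_sd m p (sing_bd p z) \in supported (@small R _ _ a0 p).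
  by rewrite sing_sd_bd; exact: small_bd.
exists (total_homotopy a0 m (sing_bd p z)); split => //.
  by apply: total_homotopy_region.
by rewrite total_homotopyP [RHS]addrC free_addrK.
Qed.

Section Injectivity.
Variable a0 : label eps.

Definition recover m p (d : {freeg {set T} / 'F_2}) : {freeg {set T} / 'F_2} :=
  carrier a0 p (sing_sd m p (fill_ p d)).

Lemma recover_bd m p d : d \in supported (@carded T p.+3) ->
  rel_part eps (fbd (recover m p.+1 d)) = recover m p (fbd d).
Proof. by move=> dc; rewrite /recover carrier_bd -sing_sd_bd filling_bd. Qed.

Lemma recover_contained m p s d : d \in supported (@carded T p.+2) ->
  d \in supported (contained s) -> recover m p d \in supported (contained s).
Proof.
move=> dc ds; have : sing_sd m p (fill_ p d) \in sing_in_chain (cell s) p.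
  by apply: sing_op_in; exact: filling_in_cell.
rewrite /recover; move: (sing_sd _ _ _); apply: supported_ind.
  by rewrite raddf0 rpred0.
move=> g c /asboolP gs IH; rewrite raddfD rpredD // carrierE.
suff h : diag (sing_labels (lab a0) p << g >>) \in supported (contained s).
  by apply: rel_part_supported h.
apply: diag_contained; rewrite sing_labelsU; apply: supportedU.
apply/allP => _ /mapP[_ /mapP[x _ ->] ->].
have /cellP[xb xs] : cell s (frame g x) by apply: gs; exists (retract x).
exact: label_inS xs (lab_supp a0 xb).
Qed.

(** In degree zero subdivision does nothing and the labels of any point span an
    edge. *)
Lemma recover_edge m s : ~~ constant_on eps s -> #|s| = 2%N ->
  recover m 0 << s >> != 0.
Proof.
move=> sc s2; have [u [v [us vs u0 v0]]] := nonconstantP _ _ sc.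
have uv : u != v by apply: contraNneq v0 => <-; rewrite u0.
have sE : s = [set u; v].
  apply/eqP; rewrite eq_sym eqEcard subUset !sub1set us vs s2.
  by rewrite cards2 uv.
rewrite /recover; have -> : fill_ 0 << s >> = real 0 (@idmap R T) << [:: cell_point R eps s] >>.
  rewrite fillingE fillU // fbdU sE big_setU1 ?inE //= big_set1 setU1K ?inE //.
  have -> : [set u; v] :\ v = [set u] by rewrite setUC setU1K // inE eq_sym.
  by rewrite raddfD !fill1 u0 eqxx (negbTE v0) add0r coneU.
rewrite realU sing_opU.
have sd0 : sdm m << vertices R 0 >> = << vertices R 0 >>.
  have := size_vertices R 0; case: (vertices R 0) => [|x [|]] // _.
  exact: sdm1.
rewrite sd0 real_frame carrierE sing_labelsU; move: (aff_sing _ _ _) => g.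
have : size (map (lab a0) (sing_points g)) = 1%N.
  by rewrite size_map /sing_points size_map size_vertices.
case: (map _ (sing_points g)) => [|a [|]] // _; rewrite diag1 rel_partU ifF.
  by rewrite freegU_eq0 oner_eq0.
apply/negbTE/nonconstantP; exists (lab0 a), (lab1 a).
by rewrite !inE !eqxx orbT lab0P lab1P.
Qed.

(** For reasons of degree and support: the labels of points of a cell are
    vertices of its simplex. *)
Lemma recover_multiple m p s : ~~ constant_on eps s -> #|s| = p.+2 ->
  recover m p << s >> = 0 \/ recover m p << s >> = << s >>.
Proof.
move=> sc sp; apply: supported_pred1.
have sC : << s >> \in supported (@carded T p.+2).
  by apply: supportedU; rewrite /carded sp.
have h1 : recover m p << s >> \in supported (contained s).
  by apply: recover_contained sC _; apply: supportedU; exact: subxx.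
have h2 : recover m p << s >> \in supported (@carded T p.+2).
  exact: carrier_carded.
apply: supported_sub (supported_and h1 h2) => t /andP[ts /eqP tp].
by rewrite /= eqEcard tp sp leqnn andbT.
Qed.

(** By [recover_multiple] only the value 0 has to be excluded, and by induction
    the relative boundary is that of the simplex, which is not zero. *)
Lemma recoverE m p d : d \in supported (@carded T p.+2) ->
  recover m p d = rel_part eps d.
Proof.
have on_cells q : (forall s, ~~ constant_on eps s -> #|s| = q.+2 ->
      recover m q << s >> = << s >>) ->
    forall c, c \in supported (@carded T q.+2) -> recover m q c = rel_part eps c.
  move=> hq; apply: supported_ind => [|s c /eqP sq IH].
    by rewrite /recover !raddf0.
  rewrite [RHS]raddfD -IH {IH}/recover !raddfD; congr (_ + _).
  rewrite rel_partU; case: ifPn => sc; last exact: hq.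
  by rewrite fillingE fill_big_constant ?sq // !raddf0.
move: d; apply: (on_cells p) => s; elim: p s => [|p IH] s sc sp.
all: have [r0|//] := recover_multiple m sc sp; exfalso.
  by have := recover_edge m sc sp; rewrite r0 eqxx.
have sC : << s >> \in supported (@carded T p.+3).
  by apply: supportedU; rewrite /carded sp.
have s3 : (2 < #|s|)%N by rewrite sp.
have /eqP := rel_part_fbd_neq0 sc s3; apply.
rewrite -(on_cells p IH) -?recover_bd ?r0 ?raddf0 //.
exact: fbdU_carded.
Qed.

End Injectivity.

(** The carrier of a subdivided filling is the chain that was filled. It
    vanishes if the filling bounds, since the carrier of b lives on simplices
    with one vertex too many for the large region, and that of a on simplices
    with one too many for the small one. *)
Lemma filling_inj p d b a : (forall s, s \in K -> (#|s| <= p.+2)%N) ->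
  (forall s, s \in K' -> (#|s| <= p.+1)%N) ->
  d \in supported (top_cells K p) ->
  b \in sing_in_chain (region eps K) p.+1 ->
  a \in sing_in_chain (region eps K') p ->
  fill_ p d = sing_bd p b + a -> d = 0.
Proof.
move=> Kp K'p dK bK aK' e; have dc : d \in supported (@carded T p.+2).
  by apply: supported_sub dK => s /and3P[].
have dn : d \in supported (fun s => ~~ constant_on eps s).
  by apply: supported_sub dK => s /and3P[].
have [a0|no] := pselect (inhabited (label eps)); last first.
  move: dn; apply: supported_pred0 => s; apply/negP => /nonconstant_label[x _].
  exact: no.
case: a0 => a0.
have [m1 h1] := small_sd_chain a0 bK; have [m2 h2] := small_sd_chain a0 aK'.
(* one subdivision that makes both chains small *)
pose m := maxn m1 m2; have {}h1 := h1 m (leq_maxl _ _).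
have {}h2 := h2 m (leq_maxr _ _).
rewrite -(rel_part_id dn) -(recoverE a0 m dc) /recover e !raddfD sing_sd_bd -carrier_bd.
have bK1 : sing_sd m p.+1 b \in sing_in_chain (region eps K) p.+1.
  exact: sing_op_in.
have aK1 : sing_sd m p a \in sing_in_chain (region eps K') p.
  exact: sing_op_in.
have -> : carrier a0 p.+1 (sing_sd m p.+1 b) = 0.
  have := supported_and (carrier_region Kclosed bK1 h1)
    (carrier_carded a0 (sing_sd m p.+1 b)).
  apply: supported_pred0 => s; apply/negP => /andP[/Kp sp /eqP sq].
  by rewrite sq ltnn in sp.
have -> : carrier a0 p (sing_sd m p a) = 0.
  have := supported_and (carrier_region K'closed aK1 h2)
    (carrier_carded a0 (sing_sd m p a)).
  apply: supported_pred0 => s; apply/negP => /andP[/K'p sp /eqP sq].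
  by rewrite sq ltnn in sp.
by rewrite !raddf0 addr0.
Qed.
End SkeletonHomology.

(** * Quotients and bijections *)

Lemma quot_pi_eq0 (V : zmodType) (A : zmodClosed V) (c : V) :
  \pi_(Quotient.quot A)%qT c = 0 <-> c \in A.
Proof.
rewrite -[in X in _ <-> X](subr0 c) Quotient.idealrBE raddf0.
by split=> /eqP.
Qed.

Lemma inj_surj_bijective (U V : Type) (f : U -> V) :
  injective f -> (forall y, exists x, f x = y) -> bijective f.
Proof.
move=> fi fs; pose g y := projT1 (cid (fs y)).
have fg y : f (g y) = y by rewrite /g; case: cid.
by exists g => // x; apply: fi; rewrite fg.
Qed.

(** * The cells of the hypersurface *)

Section DualCells.
Import mathcomp.boot.finset.
Variables (R : realType) (T : finType) (eps : T -> 'F_2) (K : scomplex T).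
Local Notation E := {ptws T -> R}.
Local Notation cell s := (@midpoint_hull R T eps s).
Local Notation fill_ p := (@filling R T eps p).
Implicit Types (s t : {set T}).

Definition cells k : {set {set T}} :=
  [set s : {set T} |
    [&& s \in (K : {set {set T}}), ~~ constant_on eps s & (#|s| <= k)%N]]%SET.

Definition faces s k : {set {set T}} :=
  [set t : {set T} |
    [&& t \subset s, ~~ constant_on eps t & (#|t| <= k)%N]]%SET.

Lemma nonconstant_neq0 s : ~~ constant_on eps s -> s != set0.
Proof. by move=> /nonconstant_card s1; rewrite -card_gt0 ltnW. Qed.

Lemma cells_closed k : nonconstant_closed eps (cells k).
Proof.
move=> s t; rewrite !inE => /and3P[sK _ sk] ts tc.
rewrite (sc_face sK ts (nonconstant_neq0 tc)) tc /=.
exact: leq_trans (subset_leq_card ts) sk.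
Qed.

Lemma faces_closed s k : nonconstant_closed eps (faces s k).
Proof.
move=> t u; rewrite !inE => /and3P[ts _ tk] ut uc.
rewrite uc (fintype.subset_trans ut ts) /=.
exact: leq_trans (subset_leq_card ut) tk.
Qed.

Lemma cells_card k s : s \in cells k -> (#|s| <= k)%N.
Proof. by rewrite inE => /and3P[]. Qed.

Lemma faces_card s k t : t \in faces s k -> (#|t| <= k)%N.
Proof. by rewrite inE => /and3P[]. Qed.

(** The convention of the cellular complex: the skeleton of dimension -1 is
    empty, and indices are shifted by one. *)
Definition filtration (p : nat) : set E :=
  if p is q.+1 then dual_skeleton eps K q else classical_sets.set0.

(** A simplex with at most one vertex is constant, so the formula includes the
    empty skeleton. *)
Lemma filtrationE p : filtration p = region eps (cells p.+1).
Proof.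
apply/seteqP; case: p => [|p]; split=> x //=.
- move=> [s /=]; rewrite inE => /and3P[_ /nonconstant_card s1 s2].
  by have := leq_trans s1 s2.
- move=> [s /= [sK sc sp]]; rewrite dual_cellE // => xs.
  by exists s => //=; rewrite inE sK sc sp.
- move=> [s /=]; rewrite inE => /and3P[sK sc sp] xs.
  by exists s => //=; rewrite dual_cellE.
Qed.

Lemma dual_cell_region p s : s \in (K : {set {set T}}) -> ~~ constant_on eps s ->
  #|s| = p.+2 -> @dual_cell R T eps K s = region eps (faces s p.+2).
Proof.
move=> sK sc sp; rewrite dual_cellE //; apply/seteqP; split=> x.
  by move=> xs; exists s => //=; rewrite inE subxx sc sp leqnn.
move=> [t /=]; rewrite inE => /and3P[ts _ _] /cellP[xb xt].
by apply/cellP; split=> //; exact: fintype.subset_trans xt ts.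
Qed.

(** A point of the cell of s in a smaller cell lies in the cell of its own
    support, which is common to both simplices. *)
Lemma dual_cell_filtration p s : s \in (K : {set {set T}}) ->
  @dual_cell R T eps K s `&` filtration p = region eps (faces s p.+1).
Proof.
move=> sK; rewrite dual_cellE // filtrationE; apply/seteqP; split=> x.
  move=> [/cellP[xb xs] /regionP[_ [t]]]; rewrite inE => /and3P[tK _ tp] xt.
  apply/regionP; split=> //; exists (supp x) => //.
  rewrite inE xs supp_nonconstant //=.
  exact: leq_trans (subset_leq_card xt) tp.
move=> [t /=]; rewrite inE => /and3P[ts tc tp] /cellP[xb xt]; split.
  by apply/cellP; split=> //; exact: fintype.subset_trans xt ts.
apply/regionP; split=> //; exists t => //.
by rewrite inE (sc_face sK ts (nonconstant_neq0 tc)) tc.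
Qed.

(** ** Simplicial chains as chains of subsets *)

Definition underlying p : {additive schain K p -> {freeg {set T} / 'F_2}} :=
  extend (fun s : psimplex K p => << (s : {set T}) >>).

Lemma underlyingU p (s : psimplex K p) :
  underlying p << s >> = << (s : {set T}) >>.
Proof. exact: extendU. Qed.

Lemma psimplexP p (s : psimplex K p) :
  (s : {set T}) \in (K : {set {set T}}) /\ #|s| = p.+1.
Proof. by have /andP[sK /eqP] := valP s. Qed.

Lemma underlying_carded p c : underlying p c \in supported (@carded T p.+1).
Proof.
have : c \in supported xpredT by apply/allP.
apply: extend_supported => s _; apply: supportedU.
by have [_ sp] := psimplexP s; apply/eqP.
Qed.

Lemma underlying_complex p c :
  underlying p c \in supported (fun s => s \in (K : {set {set T}})).
Proof.
have : c \in supported xpredT by apply/allP.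
apply: extend_supported => s _; apply: supportedU.
by have [] := psimplexP s.
Qed.

Lemma coeff_underlying p (s : psimplex K p) c :
  coeff (s : {set T}) (underlying p c) = coeff s c.
Proof.
elim/free_ind: c => [|t c IH]; first by rewrite raddf0 !coeff0.
rewrite raddfD !coeffD IH underlyingU !coeffU.
by congr (_ * _%:R + _).
Qed.

(** Deleting a vertex is a bijection onto the facets. *)
Lemma underlying_bd p c :
  fbd (underlying p.+1 c) = underlying p (sbd K p c).
Proof.
elim/free_ind: c => [|s c IH]; first by rewrite !raddf0.
rewrite !raddfD IH underlyingU fbdU; congr (_ + _).
rewrite -[sbd K p << s >>]/(free_lift _ << s >>) free_liftU raddf_sum.
under [RHS]eq_bigr do rewrite underlyingU.
have [sK sp] := psimplexP s.
have dinj : {in (s : {set T}) &, injective (fun v => (s : {set T}) :\ v)}.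
  move=> u v us vs /setP/(_ u); rewrite !inE us eqxx andbT /=.
  by case: eqVneq.
rewrite -(big_imset (fun t => << t >> : {freeg {set T} / 'F_2}) dinj).
rewrite -(big_imset (A := mem [pred t : psimplex K p | (t : {set T}) \subset s])
  (fun t => << t >> : {freeg {set T} / 'F_2}) (h := val)) /=; last first.
  by move=> t u _ _; exact: val_inj.
apply: eq_bigl => t; apply/imsetP/imsetP => [[v vs ->]|[u us ->]].
  have tp : #|(s : {set T}) :\ v| = p.+1.
    by move: sp; rewrite (cardsD1 v) vs => -[].
  have tK : (s : {set T}) :\ v \in (K : {set {set T}}).
    by apply: (sc_face sK); rewrite ?subsetDl // -card_gt0 tp.
  have tP : ((s : {set T}) :\ v \in (K : {set {set T}})) && (#|(s : {set T}) :\ v| == p.+1).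
    by rewrite tK tp eqxx.
  by exists (PSimplex tP) => //; exact: subsetDl.
have [uK up] := psimplexP u; have {}us : (u : {set T}) \subset s := us.
have /cards1P[v vE] : #|(s : {set T}) :\: u| == 1%N.
  by rewrite cardsDS // sp up subSnn.
have : v \in (s : {set T}) :\: u by rewrite vE inE.
rewrite inE => /andP[vu vs]; exists v => //.
apply/eqP; rewrite eqEcard subsetD1 us vu /=.
by have := cardsD1 v s; rewrite vs sp add1n up => -[<-].
Qed.

End DualCells.

(** * The comparison isomorphism *)

Section Isomorphism.
Import mathcomp.boot.finset.
Variables (R : realType) (T : finType) (eps : T -> 'F_2) (K : scomplex T).
Local Notation E := {ptws T -> R}.
Local Notation fill_ p := (@filling R T eps p).
Local Notation K0 := (const_subcomplex eps K).
Local Notation X p := (singular_in R (@filtration R T eps K p)).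
Implicit Types (s t : {set T}).

Lemma underlying_cells p (c : schain K p) :
  underlying K p c \in
    supported (fun s => ~~ constant_on eps s ==> (s \in cells eps K p.+1)).
Proof.
apply: supported_sub (supported_and (underlying_complex c) (underlying_carded c)).
by move=> s /andP[sK /eqP sp]; apply/implyP => sc; rewrite inE sK sc sp leqnn.
Qed.

Lemma filling_is_rel_cycle p (c : schain K p.+1) :
  @is_rel_cycle (singular_chains R E) (X p.+1) (X p) p
    (fill_ p (underlying K p.+1 c)).
Proof.
rewrite !filtrationE; apply: filling_cycle.
- exact: underlying_carded.
- exact: underlying_cells.
- by rewrite underlying_bd; exact: underlying_cells.
Qed.

Definition cell_cycle p (c : schain K p.+1) : rel_cycle (X p.+1) (X p) p :=
  RelCycle (filling_is_rel_cycle c).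

Lemma cell_cycle_is_zmod_morphism p : zmod_morphism (@cell_cycle p).
Proof. by move=> c d; apply: val_inj; rewrite /= !raddfB. Qed.
HB.instance Definition _ p := GRing.isZmodMorphism.Build
  (schain K p.+1) (rel_cycle (X p.+1) (X p) p) (@cell_cycle p)
  (@cell_cycle_is_zmod_morphism p).

(** Constant simplices have zero filling. *)
Lemma cell_cycle_constant p (c : schain K p.+1) :
  c \in sub_schain K K0 p.+1 -> cell_cycle c \in rel_boundary (X p.+1) (X p) p.
Proof.
move=> cK0; suff -> : cell_cycle c = 0 by exact: rpred0.
apply: val_inj; change (fill_ p (underlying K p.+1 c) = 0).
move: c cK0; apply: supported_ind => [|s c sK0 IH]; first by rewrite !raddf0.
rewrite !raddfD IH addr0 underlyingU fillingE fill_big_constant ?raddf0 //.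
  by move: sK0; rewrite /in_sub inE => /andP[].
by have [_ ->] := psimplexP s.
Qed.

Definition cell_iso p :
    {additive relative_chains K K0 p.+1 -> dual_chains R eps K p} :=
  quot_map (@cell_cycle_constant p).

Definition comparison p :
    {additive relative_chains K K0 p -> shift_complex (dual_chains R eps K) p} :=
  match p return {additive relative_chains K K0 p ->
      shift_complex (dual_chains R eps K) p} with
  | 0 => (\0 : relative_chains K K0 0 -> 'rV['F_2]_0)
  | q.+1 => cell_iso q
  end.

Lemma cell_isoE p (c : schain K p.+1) :
  cell_iso p (quo_class (sub_simplicial K K0) c) = hclass (cell_cycle c).
Proof. exact: quot_mapE. Qed.

Lemma comparison_bd p (c : relative_chains K K0 p.+1) :
  comparison p (bd p c) = bd p (comparison p.+1 c).
Proof.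
case: p c => [|p] c; first by apply/matrixP => i [].
elim/quotW: c => c.
have bdE : quo_bd (sub_simplicial K K0) p.+1 (quo_class _ c) =
    quo_class (sub_simplicial K K0) (sbd K p.+1 c) by exact: quot_mapE.
rewrite -[LHS]/(cell_iso p (quo_bd (sub_simplicial K K0) p.+1 (quo_class _ c))).
rewrite bdE cell_isoE.
rewrite -[RHS]/(filt_bd (fun q => X q) p
  (cell_iso p.+1 (quo_class (sub_simplicial K K0) c))) cell_isoE.
have connE z : filt_bd (fun q => X q) p (hclass z) = hclass (bd_rel_cycle (X p) z).
  exact: quot_mapE.
rewrite connE.
rewrite /hclass; congr (\pi_(_)%qT _); apply: val_inj.
change (fill_ p (underlying K p.+1 (sbd K p.+1 c)) =
  sing_bd p (fill_ p.+1 (underlying K p.+2 c))).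
by rewrite filling_bd ?underlying_carded // underlying_bd.
Qed.

(** Single vertices are constant, so both complexes vanish in degree zero. *)
Lemma relative_chains0 (x : relative_chains K K0 0) : x = 0.
Proof.
elim/quotW: x => c; apply/quot_pi_eq0; apply/supportedP => s; rewrite /in_sub inE.
have [-> sp] := psimplexP s; case/negP; apply: contraT => /nonconstant_card.
by rewrite sp.
Qed.

Lemma rel_boundaryP (C : chain_complex) (A B : subcomplex C) p (z : rel_cycle A B p) :
  z \in rel_boundary A B p <-> exists b a, [/\ b \in sub_chain A p.+1,
    a \in sub_chain B p & (z : C p) = bd p b + a].
Proof. by split=> /asboolP. Qed.

Lemma top_cells_underlying p d : d \in supported (top_cells eps (cells eps K p.+2) p) ->
  exists c : schain K p.+1, underlying K p.+1 c = d.
Proof.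
move: d; apply: supported_ind => [|s d /and3P[]].
  by exists 0; rewrite raddf0.
rewrite inE => /and3P[sK _ _] _ /eqP sp [c <-].
have sP : (s \in (K : {set {set T}})) && (#|s| == p.+2) by rewrite sK sp eqxx.
by exists (<< PSimplex sP >> + c); rewrite raddfD underlyingU.
Qed.

Lemma rel_part_top_cells p (c : schain K p.+1) :
  rel_part eps (underlying K p.+1 c) \in
    supported (top_cells eps (cells eps K p.+2) p).
Proof.
have := supported_and (underlying_complex c) (underlying_carded c).
apply: rel_part_supported => s /andP[sK /eqP sp] sc.
by rewrite /top_cells inE sK sc sp leqnn eqxx.
Qed.

Lemma cell_iso_inj p : injective (cell_iso p).
Proof.
suff ker0 x : cell_iso p x = 0 -> x = 0.
  move=> x y /eqP; rewrite -subr_eq0 -raddfB => /eqP/ker0/eqP.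
  by rewrite subr_eq0 => /eqP.
elim/quotW: x => c.
rewrite -[\pi_(_)%qT c]/(quo_class (sub_simplicial K K0) c) cell_isoE.
move=> /quot_pi_eq0/rel_boundaryP[b [a [bX aX e]]].
have {}e : fill_ p (rel_part eps (underlying K p.+1 c)) = sing_bd p b + a.
  by rewrite fillingE (@fill_rel_part _ _ _ _ p) ?underlying_carded // -fillingE.
have {}bX : b \in sing_in_chain (@filtration R T eps K p.+1) p.+1 := bX.
have {}aX : a \in sing_in_chain (@filtration R T eps K p) p := aX.
rewrite !filtrationE in bX aX.
have d0 : rel_part eps (underlying K p.+1 c) = 0.
  apply: (filling_inj (K := cells eps K p.+2) (K' := cells eps K p.+1)) e.
  - exact: cells_closed.
  - exact: cells_closed.
  - by move=> s; exact: cells_card.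
  - by move=> s; exact: cells_card.
  - exact: rel_part_top_cells.
  - exact: bX.
  - exact: aX.
apply/quot_pi_eq0/supportedP => s sK0; rewrite -coeff_underlying.
have [sK _] := psimplexP s; move: sK0; rewrite /in_sub inE sK /= => sc.
by rewrite -(coeff_rel_part _ sc) d0 coeff0.
Qed.

Lemma cell_iso_surj p y : exists x, cell_iso p x = y.
Proof.
elim/quotW: y => z.
have : @is_rel_cycle (singular_chains R E) (X p.+1) (X p) p (val z) := valP z.
rewrite !filtrationE => /(filling_surj (@cells_closed _ _ _ _)).
move=> [d [b [a [dK bX aX e]]]]; have [c cd] := top_cells_underlying dK.
exists (quo_class (sub_simplicial K K0) c); rewrite cell_isoE.
apply/eqP; rewrite -subr_eq0 -raddfB; apply/eqP/quot_pi_eq0/rel_boundaryP.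
exists (- b), (- a); split.
- by rewrite -filtrationE in bX; rewrite rpredN.
- by rewrite -filtrationE in aX; rewrite rpredN.
rewrite raddfN -opprD; change (fill_ p (underlying K p.+1 c) - val z = - (bd p b + a)).
by rewrite e cd opprD addrA subrr add0r.
Qed.

Lemma comparison_bij p : bijective (comparison p).
Proof.
apply: inj_surj_bijective; case: p => [|p].
- by move=> x y _; rewrite (relative_chains0 x) (relative_chains0 y).
- exact: cell_iso_inj.
- by move=> y; exists 0; apply/matrixP => i [].
- exact: cell_iso_surj.
Qed.

(** ** The class of a cell *)

(** The relative homology of a single cell is computed by the same two lemmas
    as that of the skeleta, applied to the faces of s; the only simplex of top
    degree is s itself. *)
Lemma cell_iso_class p (s : psimplex K p.+1) : ~~ constant_on eps s ->
  is_dual_cell_class R eps K p s (cell_iso p (simplex_class K0 s)).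
Proof.
move=> sc; have [sK sp] := psimplexP s.
set e := @dual_cell R T eps K s; set Y := @filtration R T eps K p.
have eE : e = region eps (faces eps s p.+2) by exact: dual_cell_region.
have eYE : e `&` Y = region eps (faces eps s p.+1) by exact: dual_cell_filtration.
have top_s d : d \in supported (top_cells eps (faces eps s p.+2) p) ->
    d = 0 \/ d = << (s : {set T}) >>.
  move=> ds; apply: supported_pred1; apply: supported_sub ds => t /and3P[].
  rewrite inE => /and3P[ts _ _] _ /eqP tp.
  by rewrite /= eqEcard ts tp sp leqnn.
have s_top : << (s : {set T}) >> \in supported (top_cells eps (faces eps s p.+2) p).
  by apply: supportedU; rewrite /top_cells inE subxx sc sp leqnn eqxx.
have sC : << (s : {set T}) >> \in supported (@carded T p.+2).
  by apply: supportedU; rewrite /carded sp.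
have zP : @is_rel_cycle (singular_chains R E) (singular_in R e)
    (singular_in R (e `&` Y)) p (fill_ p << (s : {set T}) >>).
  rewrite eYE eE; apply: filling_cycle => //.
    by apply: supported_sub s_top => t /and3P[tF _ _]; apply/implyP.
  apply: supported_sub (supported_and (fbdU_carded sp) (fbdU_contained (subxx s))).
  move=> t /andP[/eqP tp ts]; apply/implyP => tc.
  by rewrite inE tc tp leqnn (ts : t \subset s).
exists (RelCycle zP), (cell_cycle << s >>); split.
- change (fill_ p << (s : {set T}) >> = fill_ p (underlying K p.+1 << s >>)).
  by rewrite underlyingU.
- move=> h; split=> [|->]; last first.
    move=> /quot_pi_eq0/rel_boundaryP[b [a [bX aX bE]]].
    have {}bX : b \in sing_in_chain e p.+1 := bX.
    have {}aX : a \in sing_in_chain (e `&` Y) p := aX.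
    have {}bE : fill_ p << (s : {set T}) >> = sing_bd p b + a := bE.
    rewrite eE in bX; rewrite eYE in aX.
    have /eqP := freeU_neq0 (s : {set T}); apply.
    apply: (filling_inj (K := faces eps s p.+2) (K' := faces eps s p.+1)) bE => //.
    - exact: faces_closed.
    - exact: faces_closed.
    - by move=> t; exact: faces_card.
    - by move=> t; exact: faces_card.
  elim/quotW: h => w w0.
  have [x xw] : exists x : sing_chain R E p, x = val w by exists (val w).
  have xc : @is_rel_cycle (singular_chains R E) (singular_in R e)
    (singular_in R (e `&` Y)) p x by rewrite xw; exact: valP w.
  rewrite eYE eE in xc.
  have [d [b [a [dK bX aX]]]] := filling_surj (@faces_closed _ _ _ _) xc.
  rewrite xw => wE {xc xw}; rewrite -eE in bX; rewrite -eYE in aX.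
  case: (top_s d dK) => dE.
    case: w0; apply/quot_pi_eq0/rel_boundaryP; exists b, a; split=> //.
    by rewrite -[LHS]/(val w) wE dE raddf0 add0r.
  apply/eqP; rewrite -subr_eq0 /hclass -raddfB; apply/eqP/quot_pi_eq0/rel_boundaryP.
  exists b, a; split=> //.
  change (val w - fill_ p << (s : {set T}) >> = sing_bd p b + a).
  by rewrite wE dE addrC addKr.
- by rewrite -cell_isoE.
Qed.
End Isomorphism.

Theorem theorem1p4 (R : realType) (T : finType) (K : scomplex T) (n : nat)
    (dimK : sc_dim K = n) (n_gt0 : (0 < n)%N) (eps : T -> 'F_2) :
  exists Phi : chain_iso (relative_chains K (const_subcomplex eps K))
                         (shift_complex (dual_chains R eps K)),
    forall (p : nat) (s : psimplex K p.+1), ~~ constant_on eps s ->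
      is_dual_cell_class R eps K p s
        (iso_map Phi p.+1 (simplex_class (const_subcomplex eps K) s)).
Proof.
exists (ChainIso (@comparison_bij R T eps K) (@comparison_bd R T eps K)).
move=> p s; exact: cell_iso_class.
Qed.
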